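(* For any real number $\delta > 0$, let $k \geq \frac{50(1+\delta)^2}{\delta^2}$, $\Delta \geq 2$, and $q$ be integers such that $$\Delta \le \left( \frac{q}{50} \right)^{\frac{k-3}{2+\delta}}.$$ Then there is an FPTAS for the number of proper $q$-colourings in $k$-uniform linear hypergraphs with maximum degree $\Delta$.
   Context: A hypergraph $H=(V,\mathcal E)$ is $k$-uniform if every hyperedge has exactly $k$ vertices, and linear if any two distinct hyperedges share at most one vertex; the maximum degree is the maximum number of hyperedges containing a vertex. A colouring $\sigma\in[q]^V$ is proper if no hyperedge is monochromatic. An FPTAS is a deterministic algorithm which, given an instance of size $n$ and $\varepsilon\in(0,1)$, outputs a number within a factor $1\pm\varepsilon$ of the true count in time polynomial in $n$ and $1/\varepsilon$ (with $k,\Delta,q,\delta$ constants). *)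

(* Defs.v *)
From HB Require Import structures.
From mathcomp Require Import all_boot all_order all_algebra.

Set Implicit Arguments.
Unset Strict Implicit.
Unset Printing Implicit Defensive.

Import Order.TTheory GRing.Theory Num.Theory.

Record hypergraph := Hypergraph {
  nvertices : nat;
  edges : {set {set 'I_nvertices}} }.

Definition k_uniform (k : nat) (H : hypergraph) : Prop :=
  forall e, e \in edges H -> #|e| = k.

Definition linear_hypergraph (H : hypergraph) : Prop :=
  forall e f, e \in edges H -> f \in edges H -> e != f -> #|e :&: f| <= 1.

Definition degree (H : hypergraph) (v : 'I_(nvertices H)) : nat :=
  #|[set e in edges H | v \in e]|.

Definition max_degree (H : hypergraph) : nat := \max_(v < nvertices H) degree v.

Definition monochromatic (q n : nat) (s : {ffun 'I_n -> 'I_q}) (e : {set 'I_n})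
  : bool := [exists c, [forall v in e, s v == c]].

Definition proper_colouring (q : nat) (H : hypergraph)
  (s : {ffun 'I_(nvertices H) -> 'I_q}) : bool :=
  [forall e in edges H, ~~ monochromatic s e].

Definition num_colourings (q : nat) (H : hypergraph) : nat :=
  #|[set s : {ffun 'I_(nvertices H) -> 'I_q} | proper_colouring s]|.

(** Model of computation: the WHILE language on binary trees (N. D. Jones,
    "Computability and Complexity from a Programming Perspective", 1997), with
    finitely many tree-valued variables used by each program.  An assignment
    is charged the size of the assigned tree rather than a unit cost, so that
    the size of the store, hence of the output, is bounded by the size of the
    input plus the running time.  Polynomial time in this model is the same as
    polynomial time on Turing machines. *)
Inductive tree := Leaf | Node of tree & tree.

Fixpoint tree_size (t : tree) : nat :=
  if t is Node l r then (tree_size l + tree_size r).+1 else 1.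

Inductive expr :=
  | EVar of nat
  | ELeaf
  | ENode of expr & expr
  | ELeft of expr
  | ERight of expr.

Inductive cmd :=
  | CSkip
  | CAssign of nat & expr
  | CSeq of cmd & cmd
  | CIf of expr & cmd & cmd
  | CWhile of expr & cmd.

Definition store := nat -> tree.

Definition upd (s : store) (x : nat) (t : tree) : store :=
  fun y => if y == x then t else s y.

Definition tleft (t : tree) : tree := if t is Node l _ then l else Leaf.
Definition tright (t : tree) : tree := if t is Node _ r then r else Leaf.

Fixpoint eval (s : store) (e : expr) : tree :=
  match e with
  | EVar x => s x
  | ELeaf => Leaf
  | ENode a b => Node (eval s a) (eval s b)
  | ELeft a => tleft (eval s a)
  | ERight a => tright (eval s a)
  end.

(** Guards hold when they evaluate to a tree other than [Leaf]. *)
Definition holds (s : store) (e : expr) : bool :=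
  if eval s e is Node _ _ then true else false.

(** [exec c s s' t]: started in store [s], the command [c] halts in store [s']
    after time [t]. *)
Inductive exec : cmd -> store -> store -> nat -> Prop :=
  | ExecSkip s : exec CSkip s s 1
  | ExecAssign s x e :
      exec (CAssign x e) s (upd s x (eval s e)) (tree_size (eval s e)).+1
  | ExecSeq c1 c2 s s1 s2 t1 t2 :
      exec c1 s s1 t1 -> exec c2 s1 s2 t2 ->
      exec (CSeq c1 c2) s s2 (t1 + t2).+1
  | ExecIfTrue e c1 c2 s s' t :
      holds s e -> exec c1 s s' t -> exec (CIf e c1 c2) s s' t.+1
  | ExecIfFalse e c1 c2 s s' t :
      ~~ holds s e -> exec c2 s s' t -> exec (CIf e c1 c2) s s' t.+1
  | ExecWhileTrue e c s s1 s2 t1 t2 :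
      holds s e -> exec c s s1 t1 -> exec (CWhile e c) s1 s2 t2 ->
      exec (CWhile e c) s s2 (t1 + t2).+1
  | ExecWhileFalse e c s :
      ~~ holds s e -> exec (CWhile e c) s s 1.

(** Input and output are both held in variable 0. *)
Definition computes_in (p : cmd) (input output : tree) (t : nat) : Prop :=
  exists2 s : store,
    exec p (upd (fun=> Leaf) 0 input) s t & s 0 = output.

Lemma exec_det c s s1 s2 t1 t2 :
  exec c s s1 t1 -> exec c s s2 t2 -> s1 = s2 /\ t1 = t2.
Proof.
move=> H; elim: H s2 t2 => {c s s1 t1}.
- by move=> s s2 t2 H; inversion H.
- by move=> s x e s2 t2 H; inversion H.
- move=> c1 c2 s s1 s' t1 t2 _ IH1 _ IH2 s2 u H.
  inversion H as [| |? ? ? ? ? ? ? E1 E2| | | |]; subst.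
  by case: (IH1 _ _ E1) => ? ?; subst; case: (IH2 _ _ E2) => -> ->.
- move=> e c1 c2 s s' t he _ IH s2 u H.
  inversion H as [| | |? ? ? ? ? ? _ E|? ? ? ? ? ? E _| |]; subst.
    by case: (IH _ _ E) => -> ->.
  by rewrite he in E.
- move=> e c1 c2 s s' t he _ IH s2 u H.
  inversion H as [| | |? ? ? ? ? ? E _|? ? ? ? ? ? _ E| |]; subst.
    by rewrite E in he.
  by case: (IH _ _ E) => -> ->.
- move=> e c s s1 s' t1 t2 he _ IH1 _ IH2 s2 u H.
  inversion H as [| | | | |? ? ? ? ? ? ? _ E1 E2|? ? ? E]; subst.
    by case: (IH1 _ _ E1) => ? ?; subst; case: (IH2 _ _ E2) => -> ->.
  by rewrite he in E.
- move=> e c s he s2 u H.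
  inversion H as [| | | | |? ? ? ? ? ? ? E _ _|]; subst => //.
  by rewrite E in he.
Qed.

Definition enc_seq (T : Type) (enc : T -> tree) (s : seq T) : tree :=
  foldr (fun x t => Node (enc x) t) Leaf s.

Definition enc_bool (b : bool) : tree := if b then Node Leaf Leaf else Leaf.

(** Binary digits, least significant first, without leading zeros. *)
Definition bits (n : nat) : seq bool :=
  mkseq (fun i => odd (n %/ 2 ^ i)) (up_log 2 n.+1).

Definition enc_nat (n : nat) : tree := enc_seq enc_bool (bits n).

Definition enc_frac (a b : nat) : tree := Node (enc_nat a) (enc_nat b).

(** [H] is presented by the list of its vertices (i.e. their number in unary, as
    there may be isolated vertices) and the list of its hyperedges, each given
    as a list of vertices in binary; the hyperedges, and the vertices in each
    of them, come in an arbitrary order without repetition. *)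
Definition encodes_hypergraph (H : hypergraph) (t : tree) : Prop :=
  exists es : seq (seq 'I_(nvertices H)),
    [/\ all uniq es,
        perm_eq [seq [set v in e] | e <- es] (enum (edges H)) &
        t = Node (enc_seq (fun=> Leaf) (enum 'I_(nvertices H)))
                 (enc_seq (enc_seq (fun v : 'I_(nvertices H) => enc_nat v)) es)].

Local Open Scope ring_scope.

(** The counting problem [f], restricted to the instances in [D], has a fully
    polynomial-time approximation scheme.  The accuracy [eps] is rational, so
    that it can be part of the input. *)
Definition has_FPTAS (I : Type) (encodes : I -> tree -> Prop) (D : I -> Prop)
    (f : I -> nat) : Prop :=
  exists (p : cmd) (c d : nat),
  forall (x : I) (code : tree) (eps : rat),
    D x -> encodes x code -> 0 < eps < 1 ->
    let input := Node code (enc_frac `|numq eps| `|denq eps|) in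
    exists a b t : nat,
      [/\ computes_in p input (enc_frac a b) t, (0 < b)%N,
          t%:R <= c%:R * ((tree_size input)%:R + eps^-1) ^+ d &
          (1 - eps) * (f x)%:R <= a%:R / b%:R <= (1 + eps) * (f x)%:R].

(* Main.v *)
Require Import Defs.
From mathcomp Require Import all_boot all_order all_algebra.
From mathcomp Require Import reals exp.
From mathcomp Require Import perm ring lra zify.

Set Implicit Arguments.
Unset Strict Implicit.
Unset Printing Implicit Defensive.
Import Order.TTheory GRing.Theory Num.Theory.

(** Adding the hyperedges one at a time, the number of proper colourings is
    [q ^ n] times the product over the edges [g] of the probability that [g] is
    not monochromatic in a uniform proper colouring of the edges [H] added
    before [g].  For a partial colouring [P] let [Y P H] be [q ^ #|dom P|] times
    the probability that such a colouring extends [P].  Writing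
    [kap = q ^ (1 - k)], the missing probabilities are [kap * Y (g := c0) H], and
    [Y] obeys two exact recursions:
    - if an edge [g] of [H] has one coloured vertex, of colour [c], then
      [Y P H = Y P (H - g) - kap * Y (P + (g := c)) (H - g)
               + kap * Y P H * Y (g := c0) (H - g)],
      and if [g] has two colours the second term disappears;
    - for an uncoloured vertex [w], [Y P H] is the mean over the colours [a] of
      [Y (P + (w := a)) H].
    The first recursion is applied as long as it can be; the second one is then
    applied to a vertex of a touched edge, and all touched edges now have at
    least two coloured vertices, all of the same colour.  Replacing [Y] by [0] at
    recursion depth [f] gives an error of at most
    [(1 - kap) ^ f * (1 + 16 * kap) ^ wt], where [wt] counts the touched edges
    with weight [9 * Delta + 1] if they are monochromatic with at least two
    coloured vertices, and weight [1] otherwise: a recursion step of the first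
    kind loses an edge of weight 1, while one of the second kind gains at most
    [Delta] edges of weight 1 and, but for one colour out of [q], turns a heavy
    edge into a light one.  This contraction holds when
    [320 * k * Delta ^ 2 <= q ^ (k - 1)], which the hypotheses imply.
    Depth [O(log (n / eps))] therefore suffices, and the recursion tree has
    polynomial size. *)

(** The term [kap * Y P H * Y (g := c0) (H - g)] arises because [Y P H] is normalised by the number
    of proper colourings of [H] and not of [H - g]. It calls [Y P H] again, so the recursion is well
    founded in its depth only; the factor [kap] makes this implicit equation harmless. With the
    factor [q ^ #|dom P|], [Y] is 1 when no edge is touched, and a local lemma bounds it by
    [(1 - 2 * kap) ^- t] for [t] touched edges, which is why [0] is an admissible starting value.

    The obstacle is an edge with [j >= 2] coloured vertices, all of one colour. Pinning the rest of
    it colours only [k - j] new vertices, so the first recursion would have the coefficient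
    [kap * q ^ (j - 1)], too large for the contraction. This is what forces the averaging step,
    whose gain must come from a potential and not from a small coefficient.

    The number of calls and the digits of the unreduced fractions both grow by a factor of about
    [q + 4] per level, which a logarithmic depth can afford. The programs have loops but no
    procedure calls, hence an explicit stack machine. *)

Section Regime.
Local Open Scope ring_scope.

(** Squaring the bound on [Delta] gives the exponent [2 * (k - 3) / (2 + delta) <= k - 3], hence
    [50 ^ (k - 3) * Delta ^ 2 <= q ^ (k - 3)]. The power of 50 pays for [320 * k]. *)
Lemma regime_bound (R : realType) (delta : R) (k Delta q : nat) :
  0 < delta -> 50 * (1 + delta) ^+ 2 / delta ^+ 2 <= k%:R -> (2 <= Delta)%N ->
  Delta%:R <= (q%:R / 50) `^ ((k%:R - 3) / (2 + delta)) ->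
  [/\ (50 <= k)%N, (50 < q)%N & (320 * k * Delta ^ 2 <= q ^ k.-1)%N].
Proof.
move=> d0 hk hD hq.
have k50 : (50 <= k)%N.
  rewrite -(ler_nat R); apply: le_trans hk.
  rewrite ler_pdivlMr ?exprn_gt0 // ler_wpM2l //.
  by rewrite lerXn2r ?nnegrE; lra.
have kR : 50 <= k%:R :> R by rewrite (ler_nat _ 50).
have e0 : 0 < (k%:R - 3) / (2 + delta) by apply: divr_gt0; lra.
have q50 : (50 < q)%N.
  rewrite ltnNge; apply/negP => q50.
  have : Delta%:R <= 1 :> R.
    apply: le_trans hq (le_trans (_ : _ <= 1 `^ ((k%:R - 3) / (2 + delta))) _).
      2: by rewrite powR1.
    apply: ge0_ler_powR; rewrite ?nnegrE ?(ltW e0) ?divr_ge0 ?ler0n //.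
    by rewrite ler_pdivrMr // mul1r (ler_nat _ _ 50).
  by rewrite lern1; lia.
split=> //.
have q1 : 1 <= q%:R / 50 :> R by rewrite ler_pdivlMr // mul1r (ler_nat _ 50) ltnW.
have hD2 : (Delta ^ 2)%:R <= (q%:R / 50) ^+ (k - 3) :> R.
  rewrite natrX; apply: le_trans (_ : ((q%:R / 50) `^ ((k%:R - 3) / (2 + delta))) ^+ 2 <= _).
    by rewrite lerXn2r ?nnegrE ?ler0n ?powR_ge0.
  rewrite -powR_mulrn ?powR_ge0 // -powRrM -powR_mulrn ?divr_ge0 ?ler0n //.
  apply: ler_powR => //; rewrite natrB; last by lia.
  rewrite mulrAC ler_pdivrMr; last by lra.
  by have : 0 <= delta * (k%:R - 3) by [apply: mulr_ge0; lra]; lra.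
have h : (50 ^ (k - 3) * Delta ^ 2 <= q ^ (k - 3))%N.
  rewrite -(ler_nat R) natrM !natrX mulrC -ler_pdivlMr ?exprn_gt0 //.
  by rewrite -expr_div_n -natrX.
have h1 : (320 * k <= 50 ^ (k - 3))%N.
  (* Powers of two on both sides: [320 <= 2 ^ 9], [k <= 2 ^ k] and [2 ^ 5 <= 50]. *)
  apply: leq_trans (_ : 2 ^ 9 * 2 ^ k <= _)%N.
    by apply: leq_mul => //; apply/ltnW/ltn_expl.
  rewrite -expnD; apply: leq_trans (_ : 2 ^ (5 * (k - 3)) <= _)%N.
    by rewrite leq_exp2l //; lia.
  by rewrite expnM leq_exp2r //; lia.
apply: leq_trans (_ : q ^ (k - 3) <= _)%N; last by rewrite leq_pexp2l; lia.
by apply: leq_trans h; rewrite leq_mul2r h1 orbT.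
Qed.

End Regime.

(** * Extensions of partial colourings *)

Section Counting.
Variables n q : nat.
Notation V := 'I_n.
Notation colouring := {ffun V -> 'I_q}.
Notation pcol := {ffun V -> option 'I_q}.
Implicit Types (s : colouring) (P : pcol) (g h : seq V) (H : seq (seq V)).

Definition mono s g := [exists c, all (fun v => s v == c) g].
Definition proper H s := all (fun g => ~~ mono s g) H.
Definition agrees P s := [forall v, if P v is Some c then s v == c else true].
Definition nocol : pcol := [ffun=> None].
(** Earlier colours on [g] are overwritten, but the recursions only pin edges whose coloured
    vertices already have colour [c]. *)
Definition pin P g c : pcol := [ffun v => if v \in g then Some c else P v].
Definition pins P g := pmap P g.
Definition dom P := [set v | isSome (P v)].
Definition touched P g := pins P g != [::].
Definition ext P H := [set s | agrees P s && proper H s].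
Definition N P H := #|ext P H|.

Lemma agreesP P s : reflect (forall v c, P v = Some c -> s v = c) (agrees P s).
Proof.
apply: (iffP forallP) => [h v c Pv|h v].
  by have := h v; rewrite Pv => /eqP.
by case E: (P v) => [c|] //; apply/eqP/h.
Qed.

Lemma agrees_nocol s : agrees nocol s.
Proof. by apply/agreesP => v c; rewrite ffunE. Qed.

Lemma mem_pins P g c : (c \in pins P g) = has (fun v => P v == Some c) g.
Proof.
rewrite mem_pmap; apply/mapP/hasP => [[v vg e]|[v vg /eqP e]]; exists v => //.
by rewrite -e.
Qed.

Lemma untouchedP P g : reflect (forall v, v \in g -> P v = None) (~~ touched P g).
Proof.
rewrite negbK /pins; elim: g => [|v g IH] /=; first by apply: ReflectT.
case E: (P v) => [c|] /=.
  by apply: ReflectF => /(_ v); rewrite mem_head E => /(_ isT).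
apply: (iffP IH) => h w.
  by rewrite inE => /orP[/eqP->|/h].
by move=> wg; apply: h; rewrite inE wg orbT.
Qed.

Lemma agrees_pin P g c s : (forall c', c' \in pins P g -> c' = c) ->
  agrees (pin P g c) s = agrees P s && all (fun v => s v == c) g.
Proof.
move=> hc; apply/agreesP/andP => [h|[/agreesP h1 /allP h2] v c'].
  split; first (apply/agreesP => v c' Pv).
    have := h v; rewrite ffunE; case: ifP => [vg /(_ c erefl) ->|_]; last exact.
    by apply/esym/hc; rewrite mem_pins; apply/hasP; exists v; rewrite ?Pv.
  by apply/allP => v vg; apply/eqP/h; rewrite ffunE vg.
by rewrite ffunE; case: ifP => [vg [<-]|_ /h1 //]; apply/eqP/h2.
Qed.

Lemma proper_perm H H' s : perm_eq H H' -> proper H s = proper H' s.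
Proof. exact: perm_all. Qed.

Lemma N_split P g H H' : perm_eq H (g :: H') ->
  (N P H + #|[set s | [&& agrees P s, proper H' s & mono s g]]| = N P H')%N.
Proof.
move=> pH; rewrite /N -[RHS](cardsID [set s | mono s g]) addnC; congr (_ + _)%N.
  by apply: eq_card => s; rewrite !inE andbA.
apply: eq_card => s; rewrite !inE (proper_perm _ pH) /=.
by rewrite andbCA.
Qed.

(** A vertex of [g] coloured [c] forces [c] to be the common colour, so for extensions of [P] the
    event that [g] is monochromatic is the event of extending [pin P g c]. *)
Lemma N_unsat P g c H H' : perm_eq H (g :: H') ->
  c \in pins P g -> (forall c', c' \in pins P g -> c' = c) ->
  (N P H + N (pin P g c) H' = N P H')%N.
Proof.
move=> pH cg hc; rewrite -(N_split P pH); congr (_ + _)%N.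
apply: eq_card => s; rewrite !inE agrees_pin // -andbA [all _ _ && _]andbC.
case aP: (agrees P s) => //=; congr (_ && _); rewrite /mono.
apply/idP/existsP => [h|[c' h]]; first by exists c.
have -> // : c = c'.
move: cg; rewrite mem_pins => /hasP[v vg /eqP Pv].
by rewrite -(agreesP _ _ aP v c Pv); apply/eqP/(allP h).
Qed.

Lemma N_sat P g H H' : perm_eq H (g :: H') -> ~~ constant (pins P g) ->
  N P H = N P H'.
Proof.
move=> pH ng; rewrite -(N_split P pH) [X in (_ + X)%N]eq_card0 ?addn0 // => s.
rewrite !inE; apply/negP => /and3P[/agreesP aP _ /existsP[c /allP h]].
move/negP: ng; apply; apply: (@all_pred1_constant _ c); apply/allP => c'.
rewrite mem_pins => /hasP[v vg /eqP /aP e]; apply/eqP; rewrite -e.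
exact/eqP/h.
Qed.

(** The case where averaging finds no vertex to reveal: the edge is already monochromatic, and the
    estimate [0] is exact. *)
Lemma N_full P g H : g \in H -> constant (pins P g) -> touched P g ->
  (forall v, v \in g -> isSome (P v)) -> N P H = 0%N.
Proof.
move=> gH cg tg fg; apply: eq_card0 => s; rewrite !inE; apply/negP.
case/andP=> /agreesP aP /allP /(_ g gH); apply/negP; rewrite negbK.
have [c [cg1 cg2]] : exists c, c \in pins P g /\ forall c', c' \in pins P g -> c' = c.
  move: cg tg; rewrite /touched; case: (pins P g) => // c l /= /allP h _.
  exists c; split; first exact: mem_head.
  by move=> c'; rewrite inE => /orP[/eqP //|/h /eqP].
apply/existsP; exists c; apply/allP => v vg; apply/eqP.
have := fg v vg; case E: (P v) => [c'|] // _; rewrite (aP _ _ E).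
by apply: cg2; rewrite mem_pins; apply/hasP; exists v; rewrite ?E.
Qed.

Lemma agrees_pin1 P w c s : P w = None ->
  agrees (pin P [:: w] c) s = agrees P s && (s w == c).
Proof.
by move=> Pw; rewrite agrees_pin ?[all _ _]andbT // => c'; rewrite mem_pins /= Pw.
Qed.

Lemma agrees_pin0 g c s :
  agrees (pin nocol g c) s = all (fun v => s v == c) g.
Proof.
rewrite agrees_pin ?agrees_nocol // => c'.
by rewrite mem_pins => /hasP[v _]; rewrite ffunE.
Qed.

Lemma N_reveal P w H : P w = None -> N P H = (\sum_(a < q) N (pin P [:: w] a) H)%N.
Proof.
move=> Pw; rewrite /N -sum1_card (partition_big (fun s => s w) xpredT) //=.
apply: eq_bigr => a _; rewrite sum1dep_card; apply: eq_card => s.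
by rewrite !inE agrees_pin1 // -!andbA [proper _ _ && _]andbC.
Qed.

Lemma N_free P w a H : P w = None -> (forall g, g \in H -> w \notin g) ->
  N P H = (q * N (pin P [:: w] a) H)%N.
Proof.
move=> Pw hw; rewrite (N_reveal _ Pw) -[X in (X * _)%N](card_ord q) -sum_nat_const.
apply: eq_bigr => b _.
(* Recolouring [w] injects the extensions with [w] of colour [c] into those with [w] of colour [d].
   One inequality suffices, [c] and [d] being arbitrary. *)
pose chg (c : 'I_q) s : colouring := [ffun v => if v == w then c else s v].
have le_chg c d : (N (pin P [:: w] c) H <= N (pin P [:: w] d) H)%N.
  have inj : {in ext (pin P [:: w] c) H &, injective (chg d)}.
    move=> s s'; rewrite !inE !agrees_pin1 // => /andP[/andP[_ /eqP e] _].
    move=> /andP[/andP[_ /eqP e'] _] /ffunP h; apply/ffunP => v.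
    by have := h v; rewrite !ffunE; case: eqP => [->|//]; rewrite e e'.
  rewrite /N -(card_in_imset inj); apply/subset_leq_card/subsetP => x /imsetP[s].
  rewrite !inE !agrees_pin1 // => /andP[/andP[/agreesP aP _] pH] ->.
  rewrite ffunE eqxx eqxx andbT; apply/andP; split.
    apply/agreesP => v e; rewrite ffunE; case: eqP => [->|_ /aP //].
    by rewrite Pw.
  apply/allP => g gH; apply: contra (allP pH g gH) => /existsP[e /allP h].
  apply/existsP; exists e; apply/allP => v vg; have := h v vg; rewrite ffunE.
  by case: (v =P w) => // vw; case/negP: (hw g gH); rewrite -vw.
by apply/eqP; rewrite eqn_leq !le_chg.
Qed.

Lemma dom_pin1 P w a : P w = None -> #|dom (pin P [:: w] a)| = #|dom P|.+1.
Proof.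
move=> Pw; rewrite -add1n.
have -> : dom (pin P [:: w] a) = w |: dom P.
  by apply/setP => v; rewrite !inE ffunE inE; case: eqP.
by rewrite cardsU1 inE Pw.
Qed.

(** The coloured vertices lie in no edge, so each can be uncoloured by [N_free] at the cost of a
    factor [q]. This equality motivates the normalisation of [Y]. *)
Lemma N_indep P H : (forall g, g \in H -> ~~ touched P g) ->
  (q ^ #|dom P| * N P H = N nocol H)%N.
Proof.
move: {2}(#|_|) (leqnn #|dom P|) => m.
elim: m P => [|m IH] P.
  rewrite leqn0 cards_eq0 => /eqP d0 _; rewrite d0 cards0 mul1n; congr (N _ _).
  apply/ffunP => v; rewrite ffunE; move/setP/(_ v): d0; rewrite !inE.
  by case: (P v).
move=> dP hP.
have [d0|[w]] := set_0Vmem (dom P).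
  by apply: IH => //; rewrite d0 cards0.
rewrite inE; case Pw: (P w) => [a|] // _.
pose P' : pcol := [ffun v => if v == w then None else P v].
have P'w : P' w = None by rewrite ffunE eqxx.
have eP : P = pin P' [:: w] a.
  by apply/ffunP => v; rewrite !ffunE inE; case: eqP => [->|].
have wH g : g \in H -> w \notin g.
  by move=> gH; apply/negP => /(untouchedP _ _ (hP g gH)); rewrite Pw.
rewrite eP dom_pin1 // expnS -(IH P').
- by rewrite (N_free a P'w wH) [RHS]mulnCA mulnA.
- by move: dP; rewrite eP dom_pin1.
move=> g gH; apply/untouchedP => v vg; rewrite ffunE; case: eqP => // _.
exact: (untouchedP _ _ (hP g gH)).
Qed.

(** Exchanging two colours everywhere preserves properness. Hence a single representative colour
    [c0] is enough for all the edge factors. *)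
Lemma N_colour_sym g H c d : N (pin nocol g c) H = N (pin nocol g d) H.
Proof.
pose f s : colouring := [ffun v => tperm c d (s v)].
have fK : involutive f by move=> s; apply/ffunP => v; rewrite !ffunE tpermK.
rewrite /N -(card_imset _ (inv_inj fK)); apply: eq_card => s.
have -> : (s \in f @: ext (pin nocol g c) H) = (f s \in ext (pin nocol g c) H).
  by rewrite -{1}[s]fK (mem_imset _ _ (inv_inj fK)).
rewrite !inE !agrees_pin0; congr (_ && _).
  apply: eq_all => v; rewrite ffunE.
  by rewrite (can2_eq (tpermK c d) (tpermK c d)) tpermL.
apply: eq_all => h; congr negb; apply/existsP/existsP => -[e /allP he];
  exists (tperm c d e); apply/allP => v vh; have := he v vh; rewrite ffunE.
  by move/eqP <-; rewrite tpermK.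
by move/eqP ->.
Qed.

(** The colourings that make [g] monochromatic are sorted by the colour of its first vertex; by
    symmetry the [q] classes have the same size. *)
Lemma N_nocol_split g c H H' : perm_eq H (g :: H') -> g != [::] ->
  (N nocol H + q * N (pin nocol g c) H' = N nocol H')%N.
Proof.
move=> pH g0; rewrite -(N_split nocol pH); congr (_ + _)%N.
case: g g0 pH => // w g _ pH.
rewrite -[X in (X * _)%N](card_ord q) -sum_nat_const.
rewrite -[RHS]sum1_card (partition_big (fun s => s w) xpredT) //=.
apply: eq_bigr => a _; rewrite (N_colour_sym _ _ c a) sum1dep_card.
apply: eq_card => s; rewrite !inE agrees_pin0 agrees_nocol /= [RHS]andbC.
case: (s w =P a) => [<-|//] /=; rewrite andbC; congr (_ && _); rewrite /mono.
apply/idP/existsP => [h|[c' /=/andP[/eqP-> //]]].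
by exists (s w); rewrite /= eqxx.
Qed.

Lemma N_perm P H H' : perm_eq H H' -> N P H = N P H'.
Proof.
by move=> pH; apply: eq_card => s; rewrite !inE (proper_perm _ pH).
Qed.

Lemma N_nocol_nil : N nocol [::] = (q ^ n)%N.
Proof.
rewrite /N; have -> : ext nocol [::] = [set: colouring].
  by apply/setP => s; rewrite !inE agrees_nocol.
by rewrite cardsT card_ffun !card_ord.
Qed.

End Counting.

(** * The local lemma *)

(** A converse to Bernoulli's inequality: with [y = m * x], the induction step leaves the slack
    [x * (1 - 2 * y)], nonnegative as long as [y <= 1 / 2]. *)
Lemma expr1D_le (R : realFieldType) (x : R) m :
  (0 <= x -> m%:R * x <= 1 / 2 -> (1 + x) ^+ m <= 1 + 2 * (m%:R * x))%R.
Proof.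
move=> x0; elim: m => [|m IH] hm; first by rewrite expr0 mul0r mulr0 addr0.
have hm' : (m%:R * x <= 1 / 2)%R.
  by apply: le_trans hm; rewrite ler_wpM2r // ler_nat.
have y0 : (0 <= m%:R * x)%R by rewrite mulr_ge0.
move: hm; rewrite exprS -natr1; set y := (m%:R * x)%R in IH hm' y0 *.
move=> hm.
apply: le_trans (_ : (1 + x) * (1 + 2 * y) <= _)%R.
  by rewrite ler_wpM2l ?IH // addr_ge0.
have : (0 <= x * (1 - 2 * y))%R by apply: mulr_ge0 => //; lra.
have -> : ((m%:R + 1) * x = y + x)%R by rewrite mulrDl mul1r.
lra.
Qed.

Lemma expr1B_ge (R : realFieldType) (x : R) m :
  (0 <= x <= 1 -> 1 - m%:R * x <= (1 - x) ^+ m)%R.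
Proof.
move=> /andP[x0 x1]; elim: m => [|m IH]; first by rewrite expr0 mul0r subr0.
rewrite exprS -natr1.
apply: le_trans (_ : (1 - x) * (1 - m%:R * x) <= _)%R; last first.
  by rewrite ler_wpM2l // subr_ge0.
have : (0 <= m%:R * x * x)%R by rewrite !mulr_ge0.
have -> : ((m%:R + 1) * x = m%:R * x + x)%R by rewrite mulrDl mul1r.
lra.
Qed.

Lemma expr1D_ge (R : realFieldType) (x : R) m :
  (0 <= x -> 1 + m%:R * x <= (1 + x) ^+ m)%R.
Proof.
move=> x0; elim: m => [|m IH]; first by rewrite expr0 mul0r addr0.
rewrite exprS -natr1.
apply: le_trans (_ : (1 + x) * (1 + m%:R * x) <= _)%R; last first.
  by rewrite ler_wpM2l // addr_ge0.
have : (0 <= m%:R * x * x)%R by rewrite !mulr_ge0.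
have -> : ((m%:R + 1) * x = m%:R * x + x)%R by rewrite mulrDl mul1r.
lra.
Qed.

Section LocalLemma.
Variable R : realFieldType.
Variables n q k D : nat.
Notation V := 'I_n.
Notation pcol := {ffun V -> option 'I_q}.
Implicit Types (P : pcol) (g h : seq V) (H : seq (seq V)).

(** An upper bound on the degrees, unlike their exact maximum, survives the removal of edges, so all
    edge lists met by the recursion satisfy it. *)
Definition good H := all (fun g => uniq g && (size g == k)) H &&
  [forall v : V, count (fun g => v \in g) H <= D].

Definition meets g h := has (mem g) h.

Lemma good_perm H H' : perm_eq H H' -> good H -> good H'.
Proof.
move=> pH /andP[h1 /forallP h2]; apply/andP; split; first by rewrite -(perm_all _ pH).
by apply/forallP => v; rewrite -(seq.permP pH).
Qed.

Lemma good_cat H H' : good (H ++ H') -> good H'.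
Proof.
case/andP; rewrite all_cat => /andP[_ h1] /forallP h2; apply/andP; split => //.
by apply/forallP => v; apply: leq_trans (h2 v); rewrite count_cat leq_addl.
Qed.

Lemma good_cons g H : good (g :: H) -> good H.
Proof. exact: (@good_cat [:: g]). Qed.

Lemma good_edge g H : good H -> g \in H -> uniq g /\ size g = k.
Proof. by case/andP=> /allP h _ /h /andP[-> /eqP]. Qed.

Lemma count_meets g H : good H -> count (meets g) H <= size g * D.
Proof.
case/andP=> _ /forallP h; elim: g => [|v g IH].
  rewrite (@eq_count _ _ pred0) ?count_pred0 // => x.
  by apply/hasP => -[].
rewrite mulSn; apply: leq_trans (leq_add (h v) IH).
rewrite -(count_predUI (fun g => v \in g)); apply: leq_trans (leq_addr _ _).
apply: sub_count => x /hasP[w wx]; rewrite inE => /orP[/eqP<-|wg] /=; first by rewrite wx.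
by apply/orP; right; apply/hasP; exists w.
Qed.

Lemma pins_pin_disj P g c h : ~~ meets g h -> pins (pin P g c) h = pins P h.
Proof.
move/hasPn => hd; apply: eq_in_pmap => v vh; rewrite ffunE.
by have /= := hd v vh; case: ifP => // ->.
Qed.

Lemma touched_pin P g c h : touched (pin P g c) h -> touched P h || meets g h.
Proof.
by case mh: (meets g h); rewrite ?orbT // /touched pins_pin_disj ?mh // => ->.
Qed.

Lemma touched_pinl P g c h : touched P h -> touched (pin P g c) h.
Proof.
apply: contraLR => /untouchedP hu; apply/untouchedP => v vh.
by have := hu v vh; rewrite ffunE; case: ifP.
Qed.

Lemma dom_pin0 g c : uniq g -> #|dom (pin (nocol n q) g c)| = size g.
Proof.
move=> ug; rewrite -(card_uniqP ug); apply: eq_card => v.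
by rewrite !inE ffunE; case: ifP => //; rewrite ffunE.
Qed.

Local Open Scope ring_scope.

Hypotheses (q_gt1 : (1 < q)%N) (k_gt1 : (1 < k)%N) (D_gt0 : (0 < D)%N).
Hypothesis big : (320 * k * D ^ 2 <= q ^ k.-1)%N.

(** The probability that an edge of [k] vertices is monochromatic when these are coloured uniformly
    and independently. *)
Definition kap : R := (q ^ k.-1)%:R^-1.

Lemma kap_gt0 : 0 < kap.
Proof. by rewrite invr_gt0 ltr0n expn_gt0 (ltnW q_gt1). Qed.

Lemma kap_le m : (m <= 320 * k * D ^ 2)%N -> m%:R * kap <= 1.
Proof.
move=> hm; rewrite ler_pdivrMr ?mul1r ?ler_nat ?(leq_trans hm) //.
by rewrite ltr0n expn_gt0 (ltnW q_gt1).
Qed.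

Lemma N_mono : forall P H H', (N P (H' ++ H) <= N P H)%N.
Proof.
move=> P H H'; apply/subset_leq_card/subsetP => s; rewrite !inE /proper all_cat.
by case/andP=> -> /andP[].
Qed.

(** Without the touched edges, [N_indep] gives an equality. Putting them back can only decrease the
    count over [P], and costs at most [1 - 2 * kap] per edge in the count over [nocol]. That cost is
    a hypothesis here, limited to fewer than [m] edges, since the lemma serves in the induction
    which proves it. *)
Lemma addback m :
  (forall H g, (size H < m)%N -> good (g :: H) ->
     (1 - 2 * kap) * (N (nocol n q) H)%:R <= (N (nocol n q) (g :: H))%:R) ->
  forall P H, (size H <= m)%N -> good H ->
  (1 - 2 * kap) ^+ count (touched P) H * (q ^ #|dom P| * N P H)%:R
    <= (N (nocol n q) H)%:R.
Proof.
move=> IH P H sH gH.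
have k4 : 4 * kap <= 1 by apply: (@kap_le 4); nia.
have k0 := kap_gt0.
pose H2 := [seq h <- H | touched P h]; pose H1 := [seq h <- H | ~~ touched P h].
have pH : perm_eq (H2 ++ H1) H by apply/permPl/perm_filterC.
have : (1 - 2 * kap) ^+ size H2 * (N (nocol n q) H1)%:R
   <= (N (nocol n q) (H2 ++ H1))%:R.
  have : good (H2 ++ H1) by apply: good_perm gH; rewrite perm_sym.
  have : (size (H2 ++ H1) <= m)%N by rewrite (perm_size pH).
  elim: (H2) => [|h H2' IH2] /= s2 g2; first by rewrite expr0 mul1r.
  rewrite exprS -mulrA; apply: le_trans (IH _ _ s2 g2).
  by rewrite ler_wpM2l ?IH2 ?(ltnW s2) ?(good_cons g2) //; lra.
rewrite size_filter -/(N _ _) (N_perm (nocol n q) pH); apply: le_trans.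
rewrite ler_wpM2l ?exprn_ge0 ?ler_nat //; first by lra.
rewrite -(@N_indep n q P H1); last by move=> g; rewrite mem_filter => /andP[].
by rewrite leq_mul2l -(N_perm P pH) N_mono orbT.
Qed.

(** The probability that [g] is monochromatic is [kap] times a ratio which [addback] bounds by
    [(1 - 2 * kap) ^- t], where [t <= k * D] counts the edges meeting [g]. As
    [4 * k * D * kap <= 1], the ratio is at most 2. *)
Lemma local_lemma (c0 : 'I_q) H g : good (g :: H) ->
  (1 - 2 * kap) * (N (nocol n q) H)%:R <= (N (nocol n q) (g :: H))%:R.
Proof.
move: {2}(size H).+1 (ltnSn (size H)) => m; elim: m H g => [//|m IHm] H g sH gH.
have [ug sg] := good_edge gH (mem_head _ _).
have g0 : g != [::] by rewrite -size_eq0 sg; lia.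
have k0 := kap_gt0.
have E := N_nocol_split c0 (perm_refl (g :: H)) g0.
have gH' := good_cons gH.
have k4 : 4 * kap <= 1 by apply: (@kap_le 4); nia.
have kt : (k * D)%:R * (2 * kap) <= 1 / 2.
  have : (4 * (k * D))%:R * kap <= 1 by apply: kap_le; nia.
  by rewrite natrM; lra.
suff : q%:R * (N (pin (nocol n q) g c0) H)%:R <= 2 * kap * (N (nocol n q) H)%:R.
  by rewrite -E natrD !natrM; lra.
have := addback IHm (pin (nocol n q) g c0) sH gH'.
rewrite dom_pin0 // sg natrM; set t := count _ _; set Np := (N _ H)%:R.
have lt : (t <= k * D)%N.
  rewrite -{1}sg; apply: leq_trans (count_meets g gH'); apply: sub_count => h.
  by move/touched_pin; rewrite /touched /= (eqP (_ : pins (nocol n q) h == [::])) //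
    -[_ == _]negbK; apply/untouchedP => v _; rewrite ffunE.
have p2 : 1 / 2 <= (1 - 2 * kap) ^+ t.
  apply: le_trans (_ : 1 - t%:R * (2 * kap) <= _); last by apply: expr1B_ge; lra.
  have : t%:R * (2 * kap) <= (k * D)%:R * (2 * kap).
    by rewrite ler_wpM2r ?ler_nat //; lra.
  lra.
move=> ub.
have qk : q%:R = kap * (q ^ k)%:R.
  rewrite /kap -(prednK (ltnW k_gt1)) expnS natrM /= mulrCA mulVf ?mulr1 //.
  by rewrite pnatr_eq0 -lt0n expn_gt0 (ltnW q_gt1).
have Np0 : 0 <= (q ^ k)%:R * Np by rewrite mulr_ge0 ?ler0n.
have {}ub : (q ^ k)%:R * Np <= 2 * (N (nocol n q) H)%:R.
  by have := ler_wpM2r Np0 p2; lra.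
by have := ler_wpM2l (ltW k0) ub; rewrite qk; lra.
Qed.

Lemma N_nocol_gt0 (c0 : 'I_q) H : good H -> (0 < N (nocol n q) H)%N.
Proof.
elim: H => [|g H IH] gH.
  by rewrite N_nocol_nil expn_gt0 (ltnW q_gt1).
have := local_lemma c0 gH; have := IH (good_cons gH); rewrite -!(ltr0n R) => h.
apply: lt_le_trans; apply: mulr_gt0 => //.
have : 4 * kap <= 1 by apply: (@kap_le 4); nia.
have := kap_gt0; lra.
Qed.

Definition Y P H : R := (q ^ #|dom P| * N P H)%:R / (N (nocol n q) H)%:R.

Lemma Y_ge0 P H : 0 <= Y P H.
Proof. by rewrite divr_ge0 ?ler0n. Qed.

Lemma Y_le (c0 : 'I_q) P H : good H ->
  (1 - 2 * kap) ^+ count (touched P) H * Y P H <= 1.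
Proof.
move=> gH; rewrite /Y mulrA ler_pdivrMr ?mul1r ?ltr0n ?N_nocol_gt0 //.
by apply: (addback (m := size H)) => // H' g _; apply: local_lemma.
Qed.

End LocalLemma.

(** * The estimator *)

Lemma leq_sum_count (T : eqType) (F G : T -> nat) (p : pred T) (s : seq T) :
  (forall x, x \in s -> F x <= G x + p x) ->
  \sum_(x <- s) F x <= \sum_(x <- s) G x + count p s.
Proof.
elim: s => [|x s IH] hs; first by rewrite !big_nil.
rewrite !big_cons /= addnACA leq_add ?hs ?mem_head ?IH // => y ys.
by apply: hs; rewrite inE ys orbT.
Qed.

(** Capitals are exact values and small letters estimates; [F], [F'] are potentials before and after
    removing an edge of weight 1. The product has error at most [4 * th * F + 2 * th * F], so what
    is needed is [(1 + 2 * kp) + 6 * kp * (1 + 16 * kp) <= (1 - kp) * (1 + 16 * kp)]. This reduces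
    to [112 * kp ^ 2 <= 7 * kp], which is exactly [16 * kp <= 1]. *)
Lemma light_step (R : realFieldType) (kp th F F' z Z y y' X X' : R) :
  (0 < kp -> 16 * kp <= 1 -> 0 <= th <= 1 -> F = (1 + 16 * kp) * F' -> 0 <= F' ->
  X = Z + kp * (X * X') -> 0 <= X <= F -> 0 <= X' <= 2 ->
  `|z - Z| <= th * ((1 + 2 * kp) * F') -> `|y - X| <= th * F ->
  0 <= y' -> `|y' - X'| <= th * 2 ->
  `|z + kp * (y * y') - X| <= th * (1 - kp) * F)%R.
Proof.
move=> k0 k16 /andP[t0 t1] eF F0 eX /andP[X0 XF] /andP[X'0 X'2] ez ey y'0 ey'.
rewrite {1}eX.
have -> : (z + kp * (y * y') - (Z + kp * (X * X')) =
  (z - Z) + kp * ((y - X) * y' + X * (y' - X')))%R by ring.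
apply: le_trans (ler_normD _ _) _; rewrite normrM (gtr0_norm k0).
have tF : (0 <= th * F)%R by apply: mulr_ge0 => //; apply: le_trans X0 XF.
(* The exact value is at most 2, and so is the error. *)
have y'4 : (y' <= 4)%R.
  by move: ey'; rewrite ler_norml => /andP[_ h]; lra.
have h1 : (`|(y - X) * y' + X * (y' - X')| <= 6 * (th * F))%R.
  apply: le_trans (ler_normD _ _) _; rewrite !normrM (ger0_norm y'0) (ger0_norm X0).
  have : (`|y - X| * y' <= th * F * 4)%R by apply: ler_pM.
  have : (X * `|y' - X'| <= F * (th * 2))%R by apply: ler_pM.
  lra.
apply: le_trans (lerD ez (ler_wpM2l (ltW k0) h1)) _; rewrite eF.
have tF' : (0 <= th * F')%R by apply: mulr_ge0.
have h : ((1 + 2 * kp) + 6 * kp * (1 + 16 * kp) <= (1 - kp) * (1 + 16 * kp))%R.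
  by have : (16 * kp * kp <= 1 * kp)%R by [apply: ler_wpM2r => //; apply: ltW]; lra.
have := ler_wpM2l tF' h; lra.
Qed.

Section Estimator.
Variable R : realFieldType.
Variables n q k D : nat.
Notation V := 'I_n.
Notation pcol := {ffun V -> option 'I_q}.
Notation nocol := (nocol n q).
Notation kap := (kap R q k).
Notation good := (@good n k D).
Notation Y := (Y R).
Implicit Types (P : pcol) (g h : seq V) (H : seq (seq V)).

Local Open Scope ring_scope.
Hypotheses (q_gt2 : (2 < q)%N) (k_gt1 : (1 < k)%N) (D_gt0 : (0 < D)%N).
Hypothesis big : (320 * k * D ^ 2 <= q ^ k.-1)%N.
Variable c0 : 'I_q.

Let q_gt1 : (1 < q)%N := ltnW q_gt2.
Let kap_gt0 := kap_gt0 R k q_gt1.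
Let kap_le := kap_le R q_gt1 big.

Let kap16 : 16 * kap <= 1.
Proof. by apply: (kap_le (m := 16)); move: k_gt1 D_gt0; clear; nia. Qed.

(** [est f P H y]: a run of the recursion of depth [f] may return [y] as an
    estimate of [Y P H]; the choice of the edge or vertex to branch on is free. *)
Inductive est : nat -> pcol -> seq (seq V) -> R -> Prop :=
| Est0 P H : est 0 P H 0
| EstFree f P H : (forall g, g \in H -> ~~ touched P g) -> est f.+1 P H 1
| EstLight f P H g H' c y1 y2 y3 y4 :
    perm_eq H (g :: H') -> pins P g = [:: c] ->
    est f P H' y1 -> est f (pin P g c) H' y2 ->
    est f P H y3 -> est f (pin nocol g c0) H' y4 ->
    est f.+1 P H (Num.max 0 (y1 - kap * y2) + kap * (y3 * y4))
| EstSat f P H g H' y1 y3 y4 :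
    perm_eq H (g :: H') -> ~~ constant (pins P g) ->
    est f P H' y1 -> est f P H y3 -> est f (pin nocol g c0) H' y4 ->
    est f.+1 P H (y1 + kap * (y3 * y4))
| EstFull f P H g : g \in H -> touched P g -> constant (pins P g) ->
    (forall v, v \in g -> isSome (P v)) -> est f.+1 P H 0
| EstHeavy f P H g w y :
    (forall h, h \in H -> touched P h ->
       (1 < size (pins P h))%N && constant (pins P h)) ->
    g \in H -> touched P g -> w \in g -> P w = None ->
    (forall a, est f (pin P [:: w] a) H (y a)) ->
    est f.+1 P H ((\sum_(a < q) y a) / q%:R).

Lemma Y_free P H : good H -> (forall g, g \in H -> ~~ touched P g) -> Y P H = 1.
Proof.
move=> gH hu; rewrite /Y N_indep // divff // pnatr_eq0 -lt0n.
exact: (N_nocol_gt0 R q_gt1 k_gt1 D_gt0 big c0 gH).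
Qed.

Let kapK : kap * (q ^ k.-1)%:R = 1.
Proof.
by rewrite mulVf // pnatr_eq0 -lt0n expn_gt0 (ltnW q_gt1).
Qed.

Let kapqk : kap * (q ^ k)%:R = q%:R.
Proof.
have -> : (q ^ k = q * q ^ k.-1)%N by rewrite -expnS prednK // ltnW.
by rewrite natrM mulrCA kapK mulr1.
Qed.

(** Here [B] counts the extensions that [g] forbids. By [N_nocol_split] the two normalisers differ
    by the factor [1 - kap * Y (pin nocol g c0) H']; multiplying it out instead of dividing by it
    yields the last term. *)
Lemma Y_split P g H H' B : perm_eq H (g :: H') -> good H ->
  (N P H + B = N P H')%N ->
  Y P H = Y P H' - (q ^ #|dom P| * B)%:R / (N nocol H')%:R
          + kap * (Y P H * Y (pin nocol g c0) H').
Proof.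
move=> pH gH eB.
have gH1 := good_perm pH gH; have gH' := good_cons gH1.
have [ug sg] := good_edge gH1 (mem_head _ _).
have g0 : g != [::] by rewrite -size_eq0 sg; lia.
have E := N_nocol_split c0 pH g0.
rewrite /Y dom_pin0 // sg.
have := N_nocol_gt0 R q_gt1 k_gt1 D_gt0 big c0 gH.
have := N_nocol_gt0 R q_gt1 k_gt1 D_gt0 big c0 gH'.
rewrite -!(ltr0n R) !natrM -eB -E !natrD natrM.
rewrite -kapqk.
move: (N nocol H)%:R (N P H)%:R (q ^ #|dom P|)%:R (B%:R) (q ^ k)%:R => Z A Q b qk.
move: (N _ H')%:R (kap) => C kp h1 h2.
by field; rewrite !gt_eqF.
Qed.

Lemma dom_pin_light P g c : uniq g -> pins P g = [:: c] ->
  #|dom (pin P g c)| = (#|dom P| + (size g).-1)%N.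
Proof.
move=> ug pg.
have -> : dom (pin P g c) = dom P :|: [set v in g].
  by apply/setP => v; rewrite !inE ffunE; case: ifP; rewrite ?orbT ?orbF.
have : #|dom P :&: [set v in g]| = 1%N.
  transitivity (size (pins P g)); last by rewrite pg.
  rewrite size_pmap -size_filter -(card_uniqP _) ?filter_uniq //.
  by apply: eq_card => v; rewrite !inE mem_filter.
have : #|[set v in g]| = size g by rewrite cardsE; apply/card_uniqP.
have : (0 < size g)%N by case: (g) pg.
by rewrite cardsU; lia.
Qed.

(** With one vertex of [g] coloured, pinning colours exactly [k - 1] new ones, whence the
    coefficient [kap]. *)
Lemma Y_light P g c H H' : perm_eq H (g :: H') -> good H -> pins P g = [:: c] ->
  Y P H = Y P H' - kap * Y (pin P g c) H'
          + kap * (Y P H * Y (pin nocol g c0) H').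
Proof.
move=> pH gH pg.
have [ug sg] := good_edge (good_perm pH gH) (mem_head _ _).
rewrite {1}(Y_split (B := N (pin P g c) H') pH gH).
  congr (_ - _ + _); rewrite /Y dom_pin_light // sg expnD mulnAC [in RHS]natrM.
  by rewrite -[LHS](mul1r (_ / _)) -{1}kapK; ring.
by apply: N_unsat => //; rewrite pg ?mem_head // => c'; rewrite inE => /eqP.
Qed.

Lemma Y_sat P g H H' : perm_eq H (g :: H') -> good H -> ~~ constant (pins P g) ->
  Y P H = Y P H' + kap * (Y P H * Y (pin nocol g c0) H').
Proof.
move=> pH gH ng; rewrite {1}(Y_split (B := 0) pH gH) ?muln0 ?mul0r ?subr0 //.
by rewrite addn0; apply: N_sat pH ng.
Qed.

Lemma Y_reveal P w H : P w = None ->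
  Y P H = (\sum_(a < q) Y (pin P [:: w] a) H) / q%:R.
Proof.
move=> Pw; rewrite /Y (N_reveal _ Pw) -mulr_suml big_distrr natr_sum /=.
under [in RHS]eq_bigr do rewrite dom_pin1 // expnS -mulnA natrM.
rewrite -mulr_sumr mulrAC [q%:R * _]mulrC mulfK //.
by rewrite pnatr_eq0; lia.
Qed.

(** Losing [W - 1 = 9 * D] on the edge of the revealed vertex leaves a drop of at least [8 * D] once
    the other edges through that vertex have gained 1 each. *)
Definition W := (9 * D + 1)%N.

Definition weight P h : nat :=
  if ~~ touched P h then 0%N
  else if (1 < size (pins P h))%N && constant (pins P h) then W else 1%N.

Definition wt P H : nat := (\sum_(h <- H) weight P h)%N.

Definition beta : R := 1 + 16 * kap.

Definition Phi P H : R := beta ^+ wt P H.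

Lemma weight_le P h : (weight P h <= W)%N.
Proof. by rewrite /weight /W; do 2?case: ifP => _ //; lia. Qed.

Lemma wt_pin P g c H : (wt (pin P g c) H <= wt P H + W * count (meets g) H)%N.
Proof.
rewrite /wt -sum1_count big_distrr /= [X in (_ + X)%N]big_mkcond -big_split /=.
apply: leq_sum => h _; case mh: (meets g h).
  by rewrite muln1 (leq_trans (weight_le _ _)) ?leq_addl.
by rewrite addn0 /weight /touched pins_pin_disj ?mh.
Qed.

Lemma touched_wt P H : (count (touched P) H <= wt P H)%N.
Proof.
rewrite /wt -sum1_count big_mkcond; apply: leq_sum => h _; rewrite /weight.
by case: (touched P h) => //=; case: ifP => _ //; rewrite /W; lia.
Qed.

Let beta_gt0 : 0 < beta.
Proof. by have := kap_gt0; rewrite /beta; lra. Qed.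

Let beta_ge1 : 1 <= beta.
Proof. by have := kap_gt0; rewrite /beta; lra. Qed.

Lemma Phi_gt0 P H : 0 < Phi P H.
Proof. exact: exprn_gt0. Qed.

(** The error of the estimate [0] at depth 0. Each touched edge weighs at least 1, and
    [beta * (1 - 2 * kap) >= 1]. *)
Lemma Y_le_Phi P H : good H -> Y P H <= Phi P H.
Proof.
move=> gH; have := Y_le R q_gt1 k_gt1 D_gt0 big c0 P gH.
set t := count _ _ => hY.
have k16 := kap16.
have b1 : 1 <= beta * (1 - 2 * kap).
  by have := kap_gt0; rewrite /beta; nra.
apply: le_trans (_ : beta ^+ t <= _); last by rewrite ler_weXn2l // touched_wt.
apply: le_trans (_ : (beta * (1 - 2 * kap)) ^+ t * Y P H <= _).
  by rewrite ler_peMl ?Y_ge0 // exprn_ege1.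
rewrite exprMn -mulrA -[leRHS]mulr1.
exact: ler_wpM2l (exprn_ge0 _ (ltW beta_gt0)) _ _ hY.
Qed.

(** At most [k * D] edges meet [g], each gaining at most [W]. Keeping the resulting power of [beta]
    below 2 requires [32 * W * k * D * kap <= 1], and [32 * (9 * D + 1) * k * D <= 320 * k * D ^ 2]:
    this is the origin of 320. *)
Lemma beta_pow_le2 g c P H : good H -> size g = k ->
  Phi (pin P g c) H <= 2 * Phi P H.
Proof.
move=> gH sg; rewrite /Phi.
apply: le_trans (_ : beta ^+ (wt P H + W * (k * D)) <= _).
  rewrite ler_weXn2l // (leq_trans (wt_pin _ _ _ _)) // leq_add2l leq_mul2l.
  by have := count_meets g gH; rewrite sg => ->; rewrite orbT.
rewrite exprD mulrC ler_wpM2r ?exprn_ge0 ?(ltW beta_gt0) //.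
have h : (W * (k * D))%:R * (16 * kap) <= 1 / 2.
  have : (32 * (W * (k * D)))%:R * kap <= 1 by apply: kap_le; rewrite /W; nia.
  by rewrite natrM; lra.
apply: le_trans (expr1D_le _ h) _; first by have := kap_gt0; lra.
lra.
Qed.

Lemma wt_nocol H : wt nocol H = 0%N.
Proof.
rewrite /wt big1 // => h _; rewrite /weight.
by have -> : ~~ touched nocol h by apply/untouchedP => v _; rewrite ffunE.
Qed.

Lemma Phi_edge g c H : good H -> size g = k -> Phi (pin nocol g c) H <= 2.
Proof.
move=> gH sg; apply: le_trans (beta_pow_le2 c nocol gH sg) _.
by rewrite /Phi wt_nocol expr0 mulr1.
Qed.

(** * Contraction of the potential when a vertex of a heavy edge is revealed *)

Section HeavyStep.
Variables (P : pcol) (g : seq V) (H : seq (seq V)) (w : V).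
Hypotheses (gH : good H) (heavyP : forall h, h \in H -> touched P h ->
   (1 < size (pins P h))%N && constant (pins P h)).
Hypotheses (g_in : g \in H) (tg : touched P g) (wg : w \in g) (Pw : P w = None).

(** A touched edge already has the largest weight [W], so it cannot gain; an untouched edge through
    [w] gets a single coloured vertex, hence weight 1. *)
Lemma weight_reveal a h : h \in H ->
  (weight (pin P [:: w] a) h <= weight P h + (w \in h))%N.
Proof.
move=> hH; case wh: (w \in h); last first.
  have nm : ~~ meets [:: w] h.
    by apply/hasPn => v vh; apply: contraFN wh; rewrite /= inE => /eqP <-.
  by rewrite /weight /touched pins_pin_disj // addn0.
case th: (touched P h).
  by rewrite {2}/weight th (heavyP hH th) (leq_trans (weight_le _ _)) ?leq_addr.
have [uh _] := good_edge gH hH.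
have -> : weight P h = 0%N by rewrite /weight th.
have e : size (pins (pin P [:: w] a) h) = 1%N.
  rewrite size_pmap (@eq_in_count _ _ (pred1 w)) ?count_uniq_mem ?wh //.
  move=> v vh; rewrite /= ffunE inE; case: eqP => //= _.
  by rewrite (untouchedP _ _ (negbT th)).
by rewrite /weight e /=; case: ifP.
Qed.

Lemma wt_reveal a : (wt (pin P [:: w] a) H <= wt P H + D)%N.
Proof.
have /andP[_ /forallP/(_ w) hD] := gH.
apply: leq_trans (_ : wt P H + count (fun h => w \in h) H <= _)%N; last by rewrite leq_add2l.
exact: leq_sum_count (weight_reveal a).
Qed.

(** The exceptional colour [c] is the common colour of the coloured vertices of [g]; any other one
    gives [g] two colours. *)
Lemma wt_reveal_sat : exists c, forall a, a != c ->
  (wt (pin P [:: w] a) H + 8 * D <= wt P H)%N.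
Proof.
have /andP[s2 cst] := heavyP g_in tg.
have [c cg] : exists c, c \in pins P g.
  by case: (pins P g) s2 => // c l _; exists c; rewrite mem_head.
exists c => a ac.
have wga : weight (pin P [:: w] a) g = 1%N.
  rewrite /weight touched_pinl //=; case: ifP => // /andP[_].
  have ca : a \in pins (pin P [:: w] a) g.
    by rewrite mem_pins; apply/hasP; exists w; rewrite ?ffunE ?inE ?eqxx.
  have cc : c \in pins (pin P [:: w] a) g.
    move: cg; rewrite !mem_pins => /hasP[v vg /eqP e]; apply/hasP; exists v => //.
    rewrite ffunE inE; case: (v =P w) => [vw|_]; last exact/eqP.
    by move: e; rewrite vw Pw.
  move: ca cc; case: (pins _ g) => //= d l; rewrite !inE => ca cc /allP hd.
  have eqd e : (e == d) || (e \in l) -> e = d by case/orP=> [/eqP //|/hd /eqP].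
  by case/eqP: ac; rewrite (eqd _ ca) (eqd _ cc).
have wgP : weight P g = W by rewrite /weight tg s2 cst.
have pH := perm_to_rem g_in.
have /andP[_ /forallP/(_ w) hD] := gH.
have hs : (\sum_(h <- rem g H) weight (pin P [:: w] a) h <=
        \sum_(h <- rem g H) weight P h + count (fun h => w \in h) (rem g H))%N.
  by apply: leq_sum_count => h /mem_rem /(weight_reveal a).
have -> : wt P H = (W + \sum_(h <- rem g H) weight P h)%N.
  by rewrite /wt (perm_big _ pH) /= big_cons wgP.
have -> : wt (pin P [:: w] a) H = (1 + \sum_(h <- rem g H) weight (pin P [:: w] a) h)%N.
  by rewrite /wt (perm_big _ pH) /= big_cons wga.
move: hD; rewrite (seq.permP pH) /= wg.
move: (\sum_(h <- _) _)%N (\sum_(h <- _) _)%N (count _ _) hs => x y z.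
by rewrite /W; clear; lia.
Qed.

(** Let [u = 16 * D * kap]. The exceptional colour contributes at most
    [B * beta ^ (9 * D) <= B * (1 + 18 * u)], each other one at most [B], while
    [Phi P H >= B * (1 + 8 * u)]. Giving up one [u] to absorb [1 - kap], the claim becomes
    [q + 18 * u <= q * (1 + 7 * u)], true for [q >= 3]. *)
Lemma Phi_reveal :
  (\sum_(a < q) Phi (pin P [:: w] a) H) / q%:R <= (1 - kap) * Phi P H.
Proof.
have [c hc] := wt_reveal_sat.
have w8 : (8 * D <= wt P H)%N.
  have [a ac] : exists a : 'I_q, a != c.
    have /card_gt0P[a] : (0 < #|predC1 c|)%N by rewrite cardC1 card_ord; lia.
    by rewrite !inE => ac; exists a.
  by apply: leq_trans (hc a ac); rewrite leq_addl.
have q0 : 0 < q%:R :> R by rewrite ltr0n; lia.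
rewrite ler_pdivrMr // (bigD1 c) //=.
set B := beta ^+ (wt P H - 8 * D).
have B0 : 0 < B by apply: exprn_gt0.
set u := D%:R * (16 * kap).
have u0 : 0 <= u by rewrite mulr_ge0 ?ler0n //; have := kap_gt0; lra.
have hu : (9 * D)%:R * (16 * kap) <= 1 / 2.
  have : (288 * D)%:R * kap <= 1.
    by apply: kap_le; move: k_gt1 D_gt0; clear; nia.
  by rewrite !natrM; lra.
have h1 : Phi (pin P [:: w] c) H <= B * (1 + 18 * u).
  apply: le_trans (_ : beta ^+ (wt P H + D) <= _).
    by rewrite ler_weXn2l // wt_reveal.
  have -> : (wt P H + D = (wt P H - 8 * D) + 9 * D)%N.
    by move: w8; clear; lia.
  rewrite exprD ler_pM2l //; apply: le_trans (expr1D_le _ hu) _.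
    by have := kap_gt0; lra.
  by rewrite natrM /u; lra.
have h2 : \sum_(a < q | a != c) Phi (pin P [:: w] a) H <= (q%:R - 1) * B.
  apply: le_trans (_ : \sum_(a < q | a != c) B <= _).
    apply: ler_sum => a ac; rewrite ler_weXn2l //.
    by move: (hc a ac); clear; lia.
  rewrite sumr_const -[B *+ _]mulr_natl (_ : #|_| = q.-1); last first.
    by rewrite (cardC1 c) card_ord.
  by rewrite -subn1 natrB // ltnW.
have h3 : B * (1 + 8 * u) <= Phi P H.
  have -> : Phi P H = B * beta ^+ (8 * D) by rewrite -exprD subnK.
  rewrite ler_pM2l //; apply: le_trans (expr1D_ge _ _); last by have := kap_gt0; lra.
  by rewrite natrM /u; lra.
have k16 := kap16.
have ku : 16 * kap <= u.
  by rewrite /u ler_peMl ?ler1n //; have := kap_gt0; lra.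
apply: le_trans (lerD h1 h2) _.
have k0 := kap_gt0.
apply: le_trans (_ : (1 - kap) * (B * (1 + 8 * u)) * q%:R <= _); last first.
  by rewrite ler_pM2r // ler_wpM2l //; lra.
have q3 : 3 <= q%:R :> R by rewrite (ler_nat _ 3).
suff h : (1 + 18 * u) + (q%:R - 1) <= (1 - kap) * (1 + 8 * u) * q%:R.
  by have := ler_wpM2l (ltW B0) h; lra.
have h5 : 1 + 7 * u <= (1 - kap) * (1 + 8 * u).
  by have : 16 * kap * u <= 1 * u by [exact: ler_wpM2r]; lra.
apply: le_trans (_ : (1 + 7 * u) * q%:R <= _); last by rewrite ler_pM2r.
have : 3 * u <= q%:R * u by [exact: ler_wpM2r]; lra.
Qed.

End HeavyStep.

(** Induction over the run: [light_step] handles removed edges and [Phi_reveal] the averages.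
    Nonnegativity is carried along because [light_step] asks for it on the second factor of the
    product. *)
Lemma est_error f P H y : est f P H y -> good H ->
  0 <= y /\ `|y - Y P H| <= (1 - kap) ^+ f * Phi P H.
Proof.
have k0 := kap_gt0.
have k16 := kap16.
elim=> {f P H y}.
- move=> P H gH; split => //.
  by rewrite sub0r normrN ger0_norm ?Y_ge0 // expr0 mul1r Y_le_Phi.
- move=> f P H hu gH; split => //; rewrite Y_free // subrr normr0.
  by rewrite mulr_ge0 ?ltW ?Phi_gt0 // exprn_gt0 //; lra.
- move=> f P H g H' c y1 y2 y3 y4 pH pg _ IH1 _ IH2 _ IH3 _ IH4 gH.
  have gH1 := good_perm pH gH; have gH' := good_cons gH1.
  have [ug sg] := good_edge gH1 (mem_head _ _).
  have [p1 e1] := IH1 gH'; have [p2 e2] := IH2 gH'.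
  have [p3 e3] := IH3 gH; have [p4 e4] := IH4 gH'.
  split; first by rewrite addr_ge0 ?le_max ?lexx // mulr_ge0 ?mulr_ge0 // ltW.
  have eY := Y_light pH gH pg; have F4 := Phi_edge c0 gH' sg.
  have t01 : 0 <= (1 - kap) ^+ f <= 1.
    by rewrite exprn_ge0 ?exprn_ile1 //; lra.
  rewrite exprSr; apply: (light_step (F' := Phi P H') (Z := Y P H' - kap * Y (pin P g c) H')
    (X' := Y (pin nocol g c0) H')) => //.
  + have tg : touched P g by rewrite /touched pg.
    by rewrite /Phi /wt (perm_big _ pH) /= big_cons /weight tg pg /= exprS.
  + by rewrite ltW ?Phi_gt0.
  + by rewrite Y_ge0 Y_le_Phi.
  + by rewrite Y_ge0 (le_trans (Y_le_Phi _ _)).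
  (* The exact difference is nonnegative, so truncating its estimate at 0 cannot increase the
     error. *)
  + have Z0 : 0 <= Y P H' - kap * Y (pin P g c) H'.
      have -> : Y P H' - kap * Y (pin P g c) H' = Y P H * (1 - kap * Y (pin nocol g c0) H').
        by rewrite mulrBr mulr1 {1}eY; ring.
      rewrite mulr_ge0 ?Y_ge0 // subr_ge0.
      apply: le_trans (_ : kap * 2 <= _); last by lra.
      by rewrite ler_wpM2l ?(ltW k0) // (le_trans (Y_le_Phi _ _)).
    apply: le_trans (_ : `|(y1 - kap * y2) - (Y P H' - kap * Y (pin P g c) H')| <= _).
      move: (y1 - _) (Y P H' - _) Z0 => z Z Z0.
      case: (lerP 0 z) => z0; first exact: lexx.
      by rewrite sub0r normrN (ger0_norm Z0) ltr0_norm; lra.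
    have -> : y1 - kap * y2 - (Y P H' - kap * Y (pin P g c) H')
      = (y1 - Y P H') - kap * (y2 - Y (pin P g c) H') by ring.
    apply: le_trans (ler_normB _ _) _; rewrite normrM (gtr0_norm k0).
    have t0 : 0 <= (1 - kap) ^+ f by case/andP: t01.
    have e2' := le_trans e2 (ler_wpM2l t0 (beta_pow_le2 c P gH' sg)).
    have := lerD e1 (ler_wpM2l (ltW k0) e2'); lra.
  + apply: le_trans e4 _; rewrite ler_wpM2l //; by case/andP: t01.
- move=> f P H g H' y1 y3 y4 pH ng _ IH1 _ IH3 _ IH4 gH.
  have gH1 := good_perm pH gH; have gH' := good_cons gH1.
  have [ug sg] := good_edge gH1 (mem_head _ _).
  have [p1 e1] := IH1 gH'.
  have [p3 e3] := IH3 gH; have [p4 e4] := IH4 gH'.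
  split; first by rewrite addr_ge0 // mulr_ge0 ?mulr_ge0 // ltW.
  have eY := Y_sat pH gH ng; have F4 := Phi_edge c0 gH' sg.
  have t01 : 0 <= (1 - kap) ^+ f <= 1.
    by rewrite exprn_ge0 ?exprn_ile1 //; lra.
  have t0 : 0 <= (1 - kap) ^+ f by case/andP: t01.
  rewrite exprSr; apply: (light_step (F' := Phi P H') (Z := Y P H')
    (X' := Y (pin nocol g c0) H')) => //.
  + have tg : touched P g.
      by rewrite /touched; apply: contraNneq ng => ->.
    rewrite /Phi /wt (perm_big _ pH) /= big_cons /weight tg (negPf ng) andbF /=.
    by rewrite exprS.
  + by rewrite ltW ?Phi_gt0.
  + by rewrite Y_ge0 Y_le_Phi.
  + by rewrite Y_ge0 (le_trans (Y_le_Phi _ _)).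
  + apply: le_trans e1 _; rewrite ler_wpM2l //.
    by rewrite ler_peMl ?ltW ?Phi_gt0 //; lra.
  + by apply: le_trans e4 _; rewrite ler_wpM2l.
- move=> f P H g gi tg cg fg gH; split => //.
  rewrite /Y (N_full gi cg tg fg) muln0 mul0r subrr normr0.
  by rewrite mulr_ge0 ?ltW ?Phi_gt0 // exprn_gt0 //; lra.
- move=> f P H g w y hv gi tg wg Pw _ IH gH; split.
    by rewrite divr_ge0 ?ler0n // sumr_ge0 // => a _; case: (IH a gH).
  rewrite (Y_reveal H Pw) -mulrBl normrM (ger0_norm (_ : 0 <= q%:R^-1)) ?invr_ge0 ?ler0n //.
  rewrite -sumrB; apply: le_trans
    (_ : (\sum_(a < q) (1 - kap) ^+ f * Phi (pin P [:: w] a) H) / q%:R <= _).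
    rewrite ler_wpM2r ?invr_ge0 ?ler0n // (le_trans (ler_norm_sum _ _ _)) //.
    by apply: ler_sum => a _; case: (IH a gH).
  rewrite -mulr_sumr exprSr -!mulrA ler_wpM2l ?exprn_ge0 //; first lra.
  exact: Phi_reveal gH hv gi tg wg Pw.
Qed.

End Estimator.

(** * Polynomial-time functions on trees *)

Definition polyb (b : nat -> nat) := exists c d, forall n, b n <= c * n.+1 ^ d.

Lemma polyb_le b b' : (forall n, b n <= b' n) -> polyb b' -> polyb b.
Proof. by move=> h [c [d hb]]; exists c, d => n; apply: leq_trans (hb n). Qed.

Lemma polyb_id : polyb id.
Proof. by exists 1, 1 => n; rewrite mul1n expn1. Qed.

Lemma polyb_cst c : polyb (fun=> c).
Proof. by exists c, 0 => n; rewrite expn0 muln1. Qed.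

Lemma polyb_add b b' : polyb b -> polyb b' -> polyb (fun n => b n + b' n).
Proof.
move=> [c [d hb]] [c' [d' hb']]; exists (c + c'), (d + d') => n.
rewrite mulnDl leq_add //.
  by apply: leq_trans (hb n) _; rewrite leq_mul2l leq_pexp2l ?leq_addr ?orbT.
by apply: leq_trans (hb' n) _; rewrite leq_mul2l leq_pexp2l ?leq_addl ?orbT.
Qed.

Lemma polyb_mul b b' : polyb b -> polyb b' -> polyb (fun n => b n * b' n).
Proof.
move=> [c [d hb]] [c' [d' hb']]; exists (c * c'), (d + d') => n.
by rewrite expnD mulnACA leq_mul.
Qed.

Lemma polyb_pow b e : polyb b -> polyb (fun n => b n ^ e).
Proof.
move=> hb; elim: e => [|e IH]; first exact: polyb_cst.
by apply: polyb_le (polyb_mul hb IH) => n; rewrite expnS.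
Qed.

Lemma polyb_comp c d b : polyb b -> polyb (fun n => c * (b n).+1 ^ d).
Proof.
move=> hb; apply: polyb_mul; first exact: polyb_cst.
apply: polyb_pow; apply: polyb_le (polyb_add hb (polyb_cst 1)) => n.
by rewrite addn1.
Qed.

Lemma polyb_S b : polyb b -> polyb (fun n => (b n).+1).
Proof.
by move=> hb; apply: polyb_le (polyb_add hb (polyb_cst 1)) => n; rewrite addn1.
Qed.

Ltac polyb_tac := solve [repeat lazymatch goal with
  | |- polyb (fun n => n) => exact: polyb_id
  | |- polyb (fun n => _ + _) => apply: polyb_add
  | |- polyb (fun n => _ * _) => apply: polyb_mul
  | |- polyb (fun n => _ ^ _) => apply: polyb_pow
  | |- polyb (fun n => _.+1) => apply: polyb_S
  | |- polyb (fun _ => ?c) => exact: (polyb_cst c)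
  | |- polyb succn => exact: (polyb_S polyb_id)
  | |- polyb (muln ?c) => exact: (polyb_mul (polyb_cst c) polyb_id)
  | |- polyb (addn ?c) => exact: (polyb_add (polyb_cst c) polyb_id)
  | |- polyb _ => first [assumption | exact: polyb_id]
  end].

Lemma leq_poly c d m n : m <= n -> c * m.+1 ^ d <= c * n.+1 ^ d.
Proof. by move=> h; case: d => [|d]; rewrite ?expn0 // leq_mul2l leq_exp2r ?ltnS ?h ?orbT. Qed.

Lemma size_gt0 t : 0 < tree_size t.
Proof. by case: t. Qed.

Lemma size_left t : tree_size (tleft t) <= tree_size t.
Proof. by case: t => //= l r; lia. Qed.

Lemma size_right t : tree_size (tright t) <= tree_size t.
Proof. by case: t => //= l r; lia. Qed.

(** Programs are families indexed by a register [x], which holds the argument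
    and then the result; registers below [x] are preserved. *)
Definition run (p : nat -> cmd) (t r : tree) (m : nat) := forall x s, s x = t ->
  exists s' m', [/\ exec (p x) s s' m', s' x = r, m' <= m
                  & forall y, y < x -> s' y = s y].

Definition polytime (F : tree -> tree) := exists p b, polyb b /\
  forall t, run p t (F t) (b (tree_size t)) /\ tree_size (F t) <= b (tree_size t).

Lemma run_le p t r m m' : m <= m' -> run p t r m -> run p t r m'.
Proof.
move=> h hr x s e; have [s' [k [h1 h2 h3 h4]]] := hr x s e.
by exists s', k; split => //; apply: leq_trans h.
Qed.

(** Replaces the bound by a monotone one, so that it can be applied to an upper bound on the size of
    the argument. *)
Lemma polytime_form F : polytime F -> exists p c d, forall t,
  run p t (F t) (c * (tree_size t).+1 ^ d) /\ tree_size (F t) <= c * (tree_size t).+1 ^ d.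
Proof.
move=> [p [b [[c [d hb]] h]]]; exists p, c, d => t; have [h1 h2] := h t.
by split; [apply: run_le h1 | apply: leq_trans h2 _].
Qed.

Lemma updE s x t y : upd s x t y = if y == x then t else s y.
Proof. by []. Qed.

Lemma pt_ext F G : F =1 G -> polytime F -> polytime G.
Proof.
by move=> e [p [b [hb h]]]; exists p, b; split => // t; rewrite -e; apply: h.
Qed.

Lemma pt_assign (e : nat -> expr) F b : polyb b ->
  (forall x s, eval s (e x) = F (s x)) -> (forall t, tree_size (F t) <= b (tree_size t)) ->
  polytime F.
Proof.
move=> hb he hF; exists (fun x => CAssign x (e x)), (fun n => b n + 1).
split; first by apply: polyb_add => //; apply: polyb_cst.
move=> t; split; last by apply: leq_trans (hF t) (leq_addr _ _).
move=> x s ex; eexists; eexists; split; first exact: ExecAssign.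
- by rewrite updE eqxx he ex.
- by rewrite he ex addn1 ltnS.
- by move=> y yx; rewrite updE; case: eqP => // eyx; move: yx; rewrite eyx ltnn.
Qed.

Lemma pt_id : polytime (fun t => t).
Proof. exact: (pt_assign (e := EVar) polyb_id). Qed.

Lemma pt_left : polytime tleft.
Proof. exact: (pt_assign (e := fun x => ELeft (EVar x)) polyb_id _ size_left). Qed.

Lemma pt_right : polytime tright.
Proof. exact: (pt_assign (e := fun x => ERight (EVar x)) polyb_id _ size_right). Qed.

Fixpoint tree_expr (t : tree) : expr :=
  if t is Node l r then ENode (tree_expr l) (tree_expr r) else ELeaf.

Lemma pt_cst t0 : polytime (fun=> t0).
Proof.
apply: (pt_assign (e := fun=> tree_expr t0) (polyb_cst (tree_size t0))) => // _ s.
by elim: t0 => //= l -> r ->.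
Qed.

Lemma pt_comp F G : polytime G -> polytime F -> polytime (fun t => G (F t)).
Proof.
move=> /polytime_form[pG [c [d hG]]] /polytime_form[pF [c' [d' hF]]].
exists (fun x => CSeq (pF x) (pG x)).
pose b n := c' * n.+1 ^ d'.
have pb : polyb b by exists c', d'.
exists (fun n => b n + c * (b n).+1 ^ d + 1); split.
  by apply: polyb_add (polyb_cst 1); apply: polyb_add => //; apply: polyb_comp.
move=> t; have [rF sF] := hF t; have [rG sG] := hG (F t).
have le := leq_poly c d sF.
split; last by apply: leq_trans sG _; rewrite -/(b _) in le *; lia.
move=> x s ex; have [s1 [m1 [e1 r1 l1 f1]]] := rF x s ex.
have [s2 [m2 [e2 r2 l2 f2]]] := rG x s1 r1.
exists s2, (m1 + m2).+1; split => //; first exact: ExecSeq e1 e2.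
  by rewrite -/(b _) in l1 le; lia.
by move=> y yx; rewrite f2 // f1.
Qed.

(** The argument stays in [x] while [F] runs in [x.+1] and then [G] in [x.+2]; preservation of lower
    registers protects both the argument and the first result. *)
Lemma pt_node F G : polytime F -> polytime G -> polytime (fun t => Node (F t) (G t)).
Proof.
move=> /polytime_form[pF [c [d hF]]] /polytime_form[pG [c' [d' hG]]].
exists (fun x => CSeq (CAssign x.+1 (EVar x)) (CSeq (pF x.+1)
  (CSeq (CAssign x.+2 (EVar x)) (CSeq (pG x.+2)
    (CAssign x (ENode (EVar x.+1) (EVar x.+2))))))).
exists (fun n => 2 * (c * n.+1 ^ d) + 2 * (c' * n.+1 ^ d') + 2 * n + 10); split.
  polyb_tac.
move=> t; have [rF sF] := hF t; have [rG sG] := hG t.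
split; last by rewrite /=; lia.
move=> x s ex.
have [|s1 [m1 [e1 r1 l1 f1]]] := rF x.+1 (upd s x.+1 (s x)).
  by rewrite updE eqxx.
have s1x : s1 x = t by rewrite f1 ?ltnS // updE; case: eqP => //; lia.
have [|s2 [m2 [e2 r2 l2 f2]]] := rG x.+2 (upd s1 x.+2 (s1 x)).
  by rewrite updE eqxx.
have e : (upd s1 x.+2 (s1 x)) x.+1 = s1 x.+1 by rewrite updE; case: eqP => //; lia.
eexists; eexists; split.
- apply: ExecSeq; first exact: ExecAssign.
  apply: ExecSeq; first exact: e1.
  apply: ExecSeq; first exact: ExecAssign.
  apply: ExecSeq; first exact: e2.
  exact: ExecAssign.
- by rewrite updE eqxx /= r2 f2 // e r1.
- by rewrite /= r2 f2 // e r1 s1x ex /=; lia.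
- move=> y yx; rewrite updE; case: eqP => [?|_]; first lia.
  rewrite f2 ?updE; last by lia.
  case: eqP => [?|_]; first lia.
  rewrite f1 ?updE; last by lia.
  by case: eqP => // ?; lia.
Qed.

Definition tif (c a b : tree) : tree := if c is Node _ _ then a else b.

Lemma pt_tif C F G : polytime C -> polytime F -> polytime G ->
  polytime (fun t => tif (C t) (F t) (G t)).
Proof.
move=> /polytime_form[pC [c0 [d0 hC]]].
move=> /polytime_form[pF [c [d hF]]] /polytime_form[pG [c' [d' hG]]].
exists (fun x => CSeq (CAssign x.+1 (EVar x)) (CSeq (pC x.+1)
  (CIf (EVar x.+1) (pF x) (pG x)))).
exists (fun n => c0 * n.+1 ^ d0 + c * n.+1 ^ d + c' * n.+1 ^ d' + n + 10); split.
  polyb_tac.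
move=> t; have [rC sC] := hC t; have [rF sF] := hF t; have [rG sG] := hG t.
split; last by case: (C t) => [|? ?] /=; lia.
move=> x s ex.
have [|s1 [m1 [e1 r1 l1 f1]]] := rC x.+1 (upd s x.+1 (s x)).
  by rewrite updE eqxx.
have s1y y : y <= x -> s1 y = s y.
  by move=> yx; rewrite f1 ?ltnS // updE; case: eqP => // ?; lia.
have hs : holds s1 (EVar x.+1) = (if C t is Node _ _ then true else false).
  by rewrite /holds /= r1.
case E: (C t) hs => [|l r] hs /=.
  have [|s2 [m2 [e2 r2 l2 f2]]] := rG x s1; first by rewrite s1y.
  eexists; eexists; split.
  - apply: ExecSeq; first exact: ExecAssign.
    apply: ExecSeq; first exact: e1.
    by apply: ExecIfFalse; [rewrite hs | exact: e2].
  - by [].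
  - by rewrite /= ex; lia.
  - by move=> y yx; rewrite f2 // s1y // ltnW.
have [|s2 [m2 [e2 r2 l2 f2]]] := rF x s1; first by rewrite s1y.
eexists; eexists; split.
- apply: ExecSeq; first exact: ExecAssign.
  apply: ExecSeq; first exact: e1.
  by apply: ExecIfTrue; [rewrite hs | exact: e2].
- by [].
- by rewrite /= ex; lia.
- by move=> y yx; rewrite f2 // s1y // ltnW.
Qed.

(** Loop states are pairs whose left component drives the loop: the rest of a list to traverse, or a
    stack of pending items. *)
Definition looping (t : tree) := if tleft t is Node _ _ then true else false.

Definition loop_cmd (p : nat -> cmd) x := CWhile (ELeft (EVar x)) (p x).

Lemma run_loop p F N m t :
  (forall i, i < N -> run p (iter i F t) (iter i.+1 F t) m) ->
  (forall i, i < N -> looping (iter i F t)) -> ~~ looping (iter N F t) ->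
  run (loop_cmd p) t (iter N F t) (N * m.+1 + 1).
Proof.
elim: N t => [|N IH] t hr hl hN x s ex.
  exists s, 1; split => //; apply: ExecWhileFalse.
  by rewrite /holds /= ex; move: hN; rewrite /looping.
have [s1 [m1 [e1 r1 l1 f1]]] := hr 0 isT x s ex.
have [|||] := IH (F t) _ _ _ x s1 r1.
- by move=> i iN; have := hr i.+1 iN; rewrite !iterSr.
- by move=> i iN; have := hl i.+1 iN; rewrite iterSr.
- by rewrite -iterSr.
move=> s2 [m2 [e2 r2 l2 f2]]; exists s2, (m1 + m2).+1; split.
- apply: ExecWhileTrue e1 e2.
  by rewrite /holds /= ex; have := hl 0 isT; rewrite /looping.
- by rewrite r2 -iterSr.
- by rewrite mulSn; lia.
- by move=> y yx; rewrite f2 // f1.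
Qed.

(** Bounding the number of iterations is not enough: the body is charged according to the current
    state, so every intermediate state must be polynomially bounded too. *)
Lemma pt_loop F G b : polytime F -> polyb b ->
  (forall t, exists N, [/\ N <= b (tree_size t), G t = iter N F t,
     forall i, i < N -> looping (iter i F t), ~~ looping (iter N F t) &
     forall i, i <= N -> tree_size (iter i F t) <= b (tree_size t)]) ->
  polytime G.
Proof.
move=> /polytime_form[p [c [d hF]]] hb hG.
exists (loop_cmd p), (fun n => b n * (c * (b n).+1 ^ d).+1 + 1 + b n); split.
  apply: polyb_add => //; apply: polyb_add (polyb_cst 1).
  apply: polyb_mul => //.
  apply: polyb_le (polyb_add (polyb_comp c d hb) (polyb_cst 1)) => n.
  by rewrite addn1.
move=> t; have [N [hN -> hl he hs]] := hG t; split; last first.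
  by apply: leq_trans (hs N (leqnn _)) _; rewrite leq_addl.
apply: run_le (run_loop (m := c * (b (tree_size t)).+1 ^ d) _ hl he).
  by rewrite -addnA leq_add ?leq_mul ?leq_addr.
move=> i iN /=; apply: run_le (proj1 (hF _)).
by apply/leq_poly/hs/ltnW.
Qed.

(** The parameter [p] is handed to [g] with each element, in place of a closure. *)
Fixpoint tfold (g : tree -> tree) (acc l p : tree) : tree :=
  if l is Node x l' then tfold g (g (Node acc (Node x p))) l' p else acc.

Fixpoint tlen (t : tree) : nat := if t is Node _ r then (tlen r).+1 else 0.

Fixpoint ttake n (t : tree) : tree :=
  if n is n'.+1 then if t is Node x r then Node x (ttake n' r) else Leaf else Leaf.

Lemma tlen_size t : tlen t < tree_size t.
Proof. by elim: t => //= l _ r IH; lia. Qed.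

Lemma size_ttake n t : tree_size (ttake n t) <= tree_size t.
Proof. by elim: n t => [|n IH] [|l r] //=; have := IH r; lia. Qed.

Definition fold_step g (t : tree) : tree :=
  Node (tright (tleft t))
    (Node (g (Node (tleft (tright t)) (Node (tleft (tleft t)) (tright (tright t)))))
          (tright (tright t))).

Lemma iter_fold_step g i l acc p : i <= tlen l ->
  iter i (fold_step g) (Node l (Node acc p)) =
  Node (iter i tright l) (Node (tfold g acc (ttake i l) p) p).
Proof.
elim: i l acc => [|i IH] [|x l] acc //= hi.
by rewrite -iterS iterSr /fold_step /= IH // -iterS iterSr.
Qed.

Lemma ttake_all l : ttake (tlen l) l = l.
Proof. by elim: l => //= x _ l ->. Qed.

Lemma iter_tright_size i l : tree_size (iter i tright l) <= tree_size l.
Proof. by elim: i => //= i IH; apply: leq_trans (size_right _) IH. Qed.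

Lemma looping_iter_tright i l a : looping (Node (iter i tright l) a) = (i < tlen l).
Proof.
elim: i l => [|i IH] [|x l] //=; first by rewrite -iterS iterSr /= IH.
by rewrite -iterS iterSr /= IH.
Qed.

Lemma pt_fold0 g b : polytime g -> polyb b ->
  (forall l acc p, tree_size (tfold g acc l p) <=
                   b (tree_size l + tree_size acc + tree_size p)) ->
  polytime (fun t => tfold g (tleft (tright t)) (tleft t) (tright (tright t))).
Proof.
move=> hg hb hs.
have [c [d hcd]] := hb.
pose init t := Node (tleft t) (Node (tleft (tright t)) (tright (tright t))).
have pr := pt_right; have pl := pt_left.
have prr := pt_comp pr pr; have plr := pt_comp pl pr.
have pll := pt_comp pl pl; have prl := pt_comp pr pl.
have pinit : polytime init by do !apply: pt_node.
have pstep : polytime (fold_step g).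
  apply: pt_node => //; apply: pt_node => //; apply: pt_comp hg _.
  by do !apply: pt_node.
pose G t := iter (tlen (tleft t)) (fold_step g) t.
suff hG : polytime G.
  apply: pt_ext (pt_comp plr (pt_comp hG pinit)) => t.
  by rewrite /G /= iter_fold_step // ttake_all.
(* The argument may be too short to be a triple; after one step this no longer matters, since
   missing components read as [Leaf]. *)
have stepi t i : iter i.+1 (fold_step g) t = iter i.+1 (fold_step g) (init t).
  by rewrite !iterSr.
have sinit t : tree_size (tleft t) + tree_size (tleft (tright t)) +
    tree_size (tright (tright t)) <= tree_size t + 2.
  by case: t => [|l [|r r']] //=; lia.
pose B n := n + c * (n + 2).+1 ^ d + (n + 2) + (n + 2) + 5.
have pB : polyb B by rewrite /B; polyb_tac.
apply: (pt_loop pstep pB) => t; exists (tlen (tleft t)); split => //.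
- by apply: leq_trans (ltnW (tlen_size _)) (leq_trans (size_left t) _); rewrite /B; lia.
- case=> [|i] hi; first by have := looping_iter_tright 0 (tleft t) Leaf; rewrite /looping /= hi.
  by rewrite stepi iter_fold_step ?looping_iter_tright // ltnW.
- case E: (tlen (tleft t)) => [|i].
    by have := looping_iter_tright 0 (tleft t) Leaf; rewrite /looping /= E => ->.
  by rewrite stepi iter_fold_step ?looping_iter_tright E ?ltnn.
case=> [|i] hi; first by rewrite /= /B; lia.
rewrite stepi iter_fold_step //=.
set l := tleft t in hi *; set a := tleft (tright t); set p := tright (tright t).
have h1 := iter_tright_size i l; have h2 := size_right (iter i tright l).
have h3 := leq_trans (hs (ttake i.+1 l) a p) (hcd _).
have h4 : tree_size (ttake i.+1 l) + tree_size a + tree_size p <= tree_size t + 2.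
  by apply: leq_trans (sinit t); rewrite !leq_add2r size_ttake.
have h5 := leq_poly c d h4.
have h6 : tree_size l + tree_size a + tree_size p <= tree_size t + 2 := sinit t.
move: h1 h2 h3 h5 h6; rewrite /B /=; move: (c * _) (c * _) => x y.
by lia.
Qed.

Lemma pt_fold g b A L P : polytime g -> polyb b ->
  (forall l acc p, tree_size (tfold g acc l p) <=
                   b (tree_size l + tree_size acc + tree_size p)) ->
  polytime A -> polytime L -> polytime P ->
  polytime (fun t => tfold g (A t) (L t) (P t)).
Proof.
move=> hg hb hs hA hL hP.
apply: (pt_ext (F := fun t => (fun u => tfold g (tleft (tright u)) (tleft u) (tright (tright u)))
  (Node (L t) (Node (A t) (P t))))) => [t //|].
by apply: pt_comp (pt_fold0 hg hb hs) _; do 2?apply: pt_node.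
Qed.

Lemma tfold_enc (T : Type) (e : T -> tree) g acc s p :
  tfold g acc (enc_seq e s) p = foldl (fun a x => g (Node a (Node (e x) p))) acc s.
Proof. by elim: s acc => //= x s IH acc. Qed.

(** The increment in one step may depend on the element and the parameter but not on the
    accumulator, so increments add up and do not compound. *)
Lemma tfold_grow g c d l acc p :
  (forall acc x p, tree_size (g (Node acc (Node x p))) <=
     tree_size acc + c * (tree_size x + tree_size p).+1 ^ d) ->
  tree_size (tfold g acc l p) <=
  tree_size acc + tlen l * (c * (tree_size l + tree_size p).+1 ^ d).
Proof.
move=> hg; elim: l acc => [|x _ l IH] acc /=; first by rewrite addn0.
apply: leq_trans (IH _) _.
have h1 := hg acc x p.
have h2 : c * (tree_size x + tree_size p).+1 ^ d <=
  c * ((tree_size x + tree_size l).+1 + tree_size p).+1 ^ d.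
  by apply: leq_poly; lia.
have h3 : c * (tree_size l + tree_size p).+1 ^ d <=
  c * ((tree_size x + tree_size l).+1 + tree_size p).+1 ^ d.
  by apply: leq_poly; lia.
have := leq_mul (leqnn (tlen l)) h3; move: h1 h2.
rewrite mulSn; move: (c * _) (c * _) (c * _) => u v w.
by move: (tlen l * _) (tlen l * _) => *; lia.
Qed.

Lemma pt_fold_grow g c d A L P : polytime g ->
  (forall acc x p, tree_size (g (Node acc (Node x p))) <=
     tree_size acc + c * (tree_size x + tree_size p).+1 ^ d) ->
  polytime A -> polytime L -> polytime P ->
  polytime (fun t => tfold g (A t) (L t) (P t)).
Proof.
move=> hg hs; apply: (pt_fold (b := fun n => n + n * (c * n.+1 ^ d))) => //.
  by polyb_tac.
move=> l acc p; apply: leq_trans (tfold_grow l acc p hs) _.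
apply: leq_add; first lia.
by apply: leq_mul; [have := tlen_size l; lia | apply: leq_poly; lia].
Qed.

Create HintDb pt.
#[local] Hint Resolve pt_left pt_right : pt.

Ltac pt_tac := repeat lazymatch goal with
  | |- polytime (fun t => t) => exact: pt_id
  | |- polytime (fun t => Node _ _) => apply: pt_node
  | |- polytime (Node ?c) => exact: (pt_node (pt_cst c) pt_id)
  | |- polytime (fun t => tif _ _ _) => apply: pt_tif
  | |- polytime (fun _ => ?c) => exact: (pt_cst c)
  | |- polytime (fun t => ?f (@?a t)) =>
      first [apply: (@pt_comp a f); [solve [auto with pt nocore] |] ]
  | |- polytime ?f => first [assumption | solve [auto with pt nocore]]
  end.

(** * Binary arithmetic *)

Local Notation tt := (Node Leaf Leaf).

Definition txor a b := tif a (tif b Leaf tt) (tif b tt Leaf).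
Definition tmaj a b c := tif a (tif b tt (tif c tt Leaf)) (tif b (tif c tt Leaf) Leaf).

Definition bit (t : tree) : nat := if t is Node _ _ then 1 else 0.

Fixpoint bval (t : tree) : nat := if t is Node x r then bit x + 2 * bval r else 0.

(** [bval] reads the least significant digit first, [mval] the most significant
    one.  Every tree is a number: a digit is 1 when it is not [Leaf]. *)
Fixpoint mval (v : nat) (t : tree) : nat :=
  if t is Node x r then mval (2 * v + bit x) r else v.

Lemma mvalE v t : mval v t = v * 2 ^ tlen t + mval 0 t.
Proof.
elim: t v => /= [|x _ r IH] v; first by rewrite muln1 addn0.
by rewrite IH [in RHS]IH expnS; lia.
Qed.

Lemma mval_lt t : mval 0 t < 2 ^ tlen t.
Proof.
elim: t => //= x _ r IH; rewrite mvalE expnS.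
by case: x => [|? ?] /=; lia.
Qed.

Lemma bval_lt t : bval t < 2 ^ tlen t.
Proof. by elim: t => //= x _ r IH; rewrite expnS; case: x => [|? ?] /=; lia. Qed.

Lemma bitsS n : 0 < n -> bits n = odd n :: bits n./2.
Proof.
move=> n0; rewrite /bits up_log2S // /mkseq /= divn1; congr (_ :: _).
rewrite (iotaDl 1 0) -map_comp; apply: eq_map => i /=.
by rewrite -divn2 -divnMA expnS.
Qed.

Lemma enc_natS n : 0 < n -> enc_nat n = Node (enc_bool (odd n)) (enc_nat n./2).
Proof. by move=> n0; rewrite /enc_nat bitsS. Qed.

Lemma enc_nat0 : enc_nat 0 = Leaf.
Proof. by []. Qed.

Lemma enc_nat_double v x :
  enc_nat (2 * v + bit x) = tif (enc_nat v) (Node (tif x tt Leaf) (enc_nat v))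
                              (tif x (Node tt Leaf) Leaf).
Proof.
have [->|v0] := posnP v; first by case: x => //= l r; rewrite enc_natS.
rewrite (enc_natS v0) /= -(enc_natS v0) enc_natS; last by lia.
have -> : (2 * v + bit x)./2 = v.
  by case: x => [|? ?] /=; rewrite mul2n ?addn0 ?addn1 ?doubleK //= uphalf_double.
have -> : odd (2 * v + bit x) = odd (bit x) by rewrite oddD mul2n odd_double.
by case: x.
Qed.

Lemma bval_enc n : bval (enc_nat n) = n.
Proof.
elim/ltn_ind: n => n IH; have [->|n0] := posnP n; first by rewrite enc_nat0.
rewrite enc_natS //= IH; last by lia.
by rewrite -[RHS]odd_double_half; case: (odd n) => /=; lia.
Qed.

Lemma enc_nat_inj : injective enc_nat.
Proof. by move=> m n /(congr1 bval); rewrite !bval_enc. Qed.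

Lemma size_enc_nat n m : n < 2 ^ m -> tree_size (enc_nat n) <= 4 * m + 1.
Proof.
elim: m n => [|m IH] n; first by rewrite ltnS leqn0 => /eqP ->.
move=> hn; have [->|n0] := posnP n; first by rewrite enc_nat0 /=; lia.
rewrite enc_natS //=; have := IH n./2; rewrite expnS in hn.
by case: (odd n) => /=; lia.
Qed.

Lemma tlen_enc_nat n : tlen (enc_nat n) = up_log 2 n.+1.
Proof.
rewrite /enc_nat; have : size (bits n) = up_log 2 n.+1 by rewrite size_mkseq.
by move=> <-; elim: (bits n) => //= b s ->.
Qed.

(** Digits are read from the most significant one and consed, which reverses them into the order of
    [enc_nat]; leading zeros are dropped and nonzero digits become [tt]. *)
Definition trim_step u :=
  tif (tleft u) (Node (tif (tleft (tright u)) tt Leaf) (tleft u))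
      (tif (tleft (tright u)) (Node tt Leaf) Leaf).
Definition ttrim t := tfold trim_step Leaf t Leaf.

Lemma ttrimE t : ttrim t = enc_nat (mval 0 t).
Proof.
rewrite /ttrim -enc_nat0; elim: t {1 3}0 => //= x _ r IH v.
by rewrite /trim_step /= -enc_nat_double IH.
Qed.

Lemma pt_trim : polytime ttrim.
Proof.
apply: (pt_fold_grow (c := 8) (d := 0)); rewrite /trim_step; try by pt_tac.
by move=> [|a a'] [|x x'] p /=; lia.
Qed.
#[local] Hint Resolve pt_trim : pt.

(** A full adder when [p] is [Leaf], a full subtractor otherwise: the borrow is the majority of the
    complement of [x], [y] and [c], and [txor x p] complements [x] on demand. *)
Definition ripple_step u :=
  let acc := tleft u in let p := tright (tright u) in
  let x := tleft (tleft (tleft acc)) in let y := tleft (tright (tleft acc)) in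
  let c := tleft (tright acc) in
  Node (Node (tright (tleft (tleft acc))) (tright (tright (tleft acc))))
       (Node (tmaj (txor x p) y c) (Node (txor x (txor y c)) (tright (tright acc)))).

(** The lists folded over only count steps: the lengths of [a] and [b] together exhaust both
    numbers, and one more step over [tt] writes the last carry out. *)
Definition ripple (u : tree) :=
  let p := tright u in
  let a := tleft (tleft u) in let b := tright (tleft u) in
  tfold ripple_step (tfold ripple_step
    (tfold ripple_step (Node (Node a b) tt) a p) b p) tt p.

Lemma pt_ripple_fold A L P : polytime A -> polytime L -> polytime P ->
  polytime (fun t => tfold ripple_step (A t) (L t) (P t)).
Proof.
apply: (pt_fold_grow (c := 16) (d := 0)).
  by rewrite /ripple_step /tmaj /txor; pt_tac.
move=> acc x p; rewrite /ripple_step /= expn0.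
case: acc => [|[|a b] c] /=.
- by case: p => [|? ?] /=; lia.
- by case: c => [|[|? ?] ?]; case: p => [|? ?] /=; lia.
have := size_right a; have := size_right b; have := size_right c.
set X := tmaj _ _ _; set Z := txor _ _.
have : tree_size X <= 3 by rewrite /X /tmaj; do !case: (X in tif X) => [|? ?] //=.
have : tree_size Z <= 3 by rewrite /Z /txor; do !case: (X in tif X) => [|? ?] //=.
by lia.
Qed.

Lemma iter_tright_leaf a i : tlen a <= i -> iter i tright a = Leaf.
Proof.
elim: i a => [|i IH] [|x a] //= h; first by rewrite -iterS iterSr /= IH.
by rewrite -iterS iterSr /= IH.
Qed.

Lemma tmaj_txor x y c : bit x + bit y + bit c = bit (txor x (txor y c)) + 2 * bit (tmaj x y c).
Proof. by case: x y c => [|? ?] [|? ?] [|? ?]. Qed.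

Lemma tmaj_txor_sub x y c l r : bit x + 2 * bit (tmaj (txor x (Node l r)) y c) =
  bit (txor x (txor y c)) + bit y + bit c.
Proof. by case: x y c => [|? ?] [|? ?] [|? ?]. Qed.

Lemma bval_head a : bval a = bit (tleft a) + 2 * bval (tright a).
Proof. by case: a. Qed.

(** The output has its most significant digit first, so what remains to be read is scaled by
    [2 ^ tlen out]. For subtraction, [b] and the borrow are moved across the equation to avoid
    truncated differences. *)
Lemma ripple_run (l a b c out p : tree) : exists c' out',
  tfold ripple_step (Node (Node a b) (Node c out)) l p =
    Node (Node (iter (tlen l) tright a) (iter (tlen l) tright b)) (Node c' out') /\
  let a' := iter (tlen l) tright a in let b' := iter (tlen l) tright b in
  if p is Node _ _ then
    bval a * 2 ^ tlen out + mval 0 out + (bval b' + bit c') * 2 ^ tlen out' =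
    bval a' * 2 ^ tlen out' + mval 0 out' + (bval b + bit c) * 2 ^ tlen out
  else (bval a + bval b + bit c) * 2 ^ tlen out + mval 0 out =
       (bval a' + bval b' + bit c') * 2 ^ tlen out' + mval 0 out'.
Proof.
elim: l a b c out => [|x _ l IH] a b c out.
  by exists c, out; split => //=; case: p => //=; lia.
have [c' [out' [e h]]] := IH (tright a) (tright b)
  (tmaj (txor (tleft a) p) (tleft b) c)
  (Node (txor (tleft a) (txor (tleft b) c)) out).
exists c', out'; split.
  by rewrite [LHS]/= /ripple_step [LHS]/= e !iterSr.
rewrite [tlen _]/= !iterSr; move: h => /=.
rewrite (mvalE _ out) (bval_head a) (bval_head b) expnS.
move: (iter _ _ _) (iter _ _ _) (bval (tright a)) (bval (tright b)) => a' b' A B.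
clear IH; case: p e => [|pl pr] e.
  have -> : txor (tleft a) Leaf = tif (tleft a) tt Leaf by [].
  have := tmaj_txor (tleft a) (tleft b) c.
  have -> : tmaj (tif (tleft a) tt Leaf) (tleft b) c = tmaj (tleft a) (tleft b) c.
    by case: (tleft a).
  move: (bit _) (bit _) (bit _) (bit _) (bit _) (bit _) (2 ^ _) (2 ^ _) (mval 0 _) (mval 0 _).
  by move=> x1 x2 x3 x4 x5 x6 x7 x8 x9 x10 e1 e2; nia.
have := tmaj_txor_sub (tleft a) (tleft b) c pl pr.
move: (bit _) (bit _) (bit _) (bit _) (bit _) (bit _) (2 ^ _) (2 ^ _) (mval 0 _) (mval 0 _).
by move=> x1 x2 x3 x4 x5 x6 x7 x8 x9 x10 e1 e2; nia.
Qed.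

Definition tadd u := ttrim (tright (tright (ripple (Node u Leaf)))).
(** A remaining borrow signals a negative difference, replaced by 0; this also implements the
    truncations at 0 of the estimator. *)
Definition tsub u :=
  let r := ripple (Node u tt) in
  tif (tleft (tright r)) Leaf (ttrim (tright (tright r))).

Lemma pt_ripple : polytime ripple.
Proof.
rewrite /ripple; apply: pt_ripple_fold; [|by pt_tac..].
by apply: pt_ripple_fold; [apply: pt_ripple_fold|..]; pt_tac.
Qed.
#[local] Hint Resolve pt_ripple : pt.

Lemma pt_add : polytime tadd.
Proof. by rewrite /tadd; pt_tac. Qed.

Lemma pt_sub : polytime tsub.
Proof. by rewrite /tsub; pt_tac. Qed.
#[local] Hint Resolve pt_add pt_sub : pt.

Lemma taddE a b : tadd (Node a b) = enc_nat (bval a + bval b).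
Proof.
rewrite /tadd /ripple /=.
have [c1 [o1 [-> /= h1]]] := ripple_run a a b Leaf Leaf Leaf.
have [c2 [o2 [-> /= h2]]] :=
  ripple_run b (iter (tlen a) tright a) (iter (tlen a) tright b) c1 o1 Leaf.
have la : iter (tlen b) tright (iter (tlen a) tright a) = Leaf.
  by rewrite -iterD iter_tright_leaf // leq_addl.
have lb : iter (tlen b) tright (iter (tlen a) tright b) = Leaf.
  by rewrite -iterD iter_tright_leaf // leq_addr.
rewrite la lb /= in h2 *; rewrite (iter_tright_leaf (leqnn (tlen a))) /= in h1 h2.
rewrite ttrimE /= (mvalE _ o2); congr enc_nat.
move: h1 h2; rewrite ?muln1 ?addn0 ?add0n /=.
case: c2 => [|? ?] /=; lia.
Qed.

Lemma tsubE a b : tsub (Node a b) = enc_nat (bval a - bval b).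
Proof.
rewrite /tsub /ripple /=.
have [c1 [o1 [-> /= h1]]] := ripple_run a a b Leaf Leaf tt.
have [c2 [o2 [-> /= h2]]] :=
  ripple_run b (iter (tlen a) tright a) (iter (tlen a) tright b) c1 o1 tt.
have la : iter (tlen b) tright (iter (tlen a) tright a) = Leaf.
  by rewrite -iterD iter_tright_leaf // leq_addl.
have lb : iter (tlen b) tright (iter (tlen a) tright b) = Leaf.
  by rewrite -iterD iter_tright_leaf // leq_addr.
rewrite la lb /= in h2 *; rewrite (iter_tright_leaf (leqnn (tlen a))) /= in h1 h2.
have := mval_lt o2; move: h1 h2; rewrite ?muln1 ?addn0 ?add0n /=.
case: c2 => [|? ?] /= h1 h2 h3.
  by rewrite ttrimE /= (mvalE _ o2) /=; congr enc_nat; lia.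
by have -> : bval a - bval b = 0 by lia.
Qed.

Definition cons_step u := Node (tleft (tright u)) (tleft u).
Definition trev t := tfold cons_step Leaf t Leaf.
Definition mul_step u :=
  tadd (Node (Node Leaf (tleft u)) (tif (tleft (tright u)) (tright (tright u)) Leaf)).
Definition tmul u := tfold mul_step Leaf (trev (tleft u)) (tright u).

Lemma pt_rev : polytime trev.
Proof.
apply: (pt_fold_grow (c := 1) (d := 1)); rewrite /cons_step; try by pt_tac.
by move=> acc x p /=; lia.
Qed.
#[local] Hint Resolve pt_rev : pt.

Lemma mval_rev t : mval 0 (trev t) = bval t.
Proof.
suff h acc : mval 0 (tfold cons_step acc t Leaf) = bval t * 2 ^ tlen acc + mval 0 acc.
  by rewrite /trev h muln1 addn0.
elim: t acc => //= x _ r IH acc; rewrite IH /= mvalE expnS.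
by rewrite mulnDl addnC addnCA addnA [2 * _ * _]mulnAC mulnA [2 * _]mulnC; lia.
Qed.

Lemma mul_stepE acc x p :
  mul_step (Node acc (Node x p)) = enc_nat (2 * bval acc + bit x * bval p).
Proof.
rewrite /mul_step taddE /=; congr enc_nat.
by case: x => [|? ?] /=; rewrite ?mul0n ?mul1n.
Qed.

Lemma mul_foldE v l p : tfold mul_step (enc_nat v) l p =
  enc_nat (v * 2 ^ tlen l + mval 0 l * bval p).
Proof.
elim: l v => [|x _ l IH] v; first by rewrite /= muln1 addn0.
rewrite [LHS]/= mul_stepE bval_enc IH /= [mval (_ + _) l]mvalE expnS; congr enc_nat.
by lia.
Qed.

Lemma tmulE a b : tmul (Node a b) = enc_nat (bval a * bval b).
Proof. by rewrite /tmul -enc_nat0 mul_foldE /= mval_rev. Qed.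

(** Partial results are bounded through their values, hence their numbers of digits: the size bound
    of [tadd] alone would compound over the iterations. *)
Lemma pt_mul : polytime tmul.
Proof.
apply: (pt_fold (b := fun n => 4 * n + 20 + n)); rewrite /mul_step; try by pt_tac.
  by polyb_tac.
move=> [|x l] acc p /=; first lia.
rewrite -/(mul_step (Node acc (Node x p))) mul_stepE mul_foldE.
have hA := bval_lt acc; have hP := bval_lt p; have hM := mval_lt l.
set a := tlen acc in hA; set b := tlen p in hP; set c := tlen l in hM *.
have h : (2 * bval acc + bit x * bval p) * 2 ^ c + mval 0 l * bval p < 2 ^ (3 + a + b + c).
  rewrite !expnD; have := expn_gt0 2 a; have := expn_gt0 2 b; have := expn_gt0 2 c.
  have : bit x <= 1 by case: x.
  move: (2 ^ a) (2 ^ b) (2 ^ c) (bit x) hA hP hM => u v w z hA hP hM z1 /= w0 v0 u0.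
  have h1 : bval acc <= u * v by apply: leq_trans (ltnW hA) _; rewrite leq_pmulr.
  have h2 : z * bval p <= u * v.
    rewrite -[u * v]mul1n leq_mul // (leq_trans (ltnW hP)) // leq_pmull //.
  have h3 : mval 0 l * bval p <= w * (u * v).
    by rewrite leq_mul ?(ltnW hM) // (leq_trans (ltnW hP)) // leq_pmull.
  have h4 : (2 * bval acc + z * bval p) * w <= (3 * (u * v)) * w.
    by rewrite leq_mul2r; apply/orP; right; lia.
  have : 0 < u * v * w by rewrite !muln_gt0 u0 v0 w0.
  by rewrite -/(2 ^ 3) /= -!mulnA in h3 h4 *; lia.
have := size_enc_nat h.
have := tlen_size acc; have := tlen_size p; have := tlen_size l.
by rewrite -/a -/b -/c; lia.
Qed.
#[local] Hint Resolve pt_mul : pt.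

(** Fractions are never reduced; [ebound] controls the growth of their digits. *)
Definition fadd u := let x := tleft u in let y := tright u in
  Node (tadd (Node (tmul (Node (tleft x) (tright y))) (tmul (Node (tleft y) (tright x)))))
       (tmul (Node (tright x) (tright y))).
Definition fsub u := let x := tleft u in let y := tright u in
  Node (tsub (Node (tmul (Node (tleft x) (tright y))) (tmul (Node (tleft y) (tright x)))))
       (tmul (Node (tright x) (tright y))).
Definition fmul u := let x := tleft u in let y := tright u in
  Node (tmul (Node (tleft x) (tleft y))) (tmul (Node (tright x) (tright y))).

Lemma faddE a b c d : fadd (Node (enc_frac a b) (enc_frac c d)) =
  enc_frac (a * d + c * b) (b * d).
Proof. by rewrite /fadd /= taddE !tmulE !bval_enc. Qed.

Lemma fsubE a b c d : fsub (Node (enc_frac a b) (enc_frac c d)) =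
  enc_frac (a * d - c * b) (b * d).
Proof. by rewrite /fsub /= tsubE !tmulE !bval_enc. Qed.

Lemma fmulE a b c d : fmul (Node (enc_frac a b) (enc_frac c d)) =
  enc_frac (a * c) (b * d).
Proof. by rewrite /fmul /= !tmulE !bval_enc. Qed.

Lemma pt_fadd : polytime fadd.
Proof. by rewrite /fadd; pt_tac. Qed.

Lemma pt_fsub : polytime fsub.
Proof. by rewrite /fsub; pt_tac. Qed.

Lemma pt_fmul : polytime fmul.
Proof. by rewrite /fmul; pt_tac. Qed.
#[local] Hint Resolve pt_fadd pt_fsub pt_fmul : pt.

Definition teq_step u :=
  let b := tleft (tleft u) in let ok := tright (tleft u) in let x := tleft (tright u) in
  tif b (Node (tright b) (tif (tleft b) (tif x ok Leaf) (tif x Leaf ok))) tt.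
Definition teq u :=
  let r := tfold teq_step (Node (tright u) tt) (tleft u) Leaf in
  tif (tleft r) Leaf (tright r).

Lemma pt_eq : polytime teq.
Proof.
have h : polytime (fun u => tfold teq_step (Node (tright u) tt) (tleft u) Leaf).
  apply: (pt_fold_grow (c := 3) (d := 0)); rewrite /teq_step; try by pt_tac.
  move=> [|[|b b'] ok] x p //=; try lia.
  by case: x => [|? ?]; case: b => [|? ?] /=; lia.
by rewrite /teq; pt_tac.
Qed.
#[local] Hint Resolve pt_eq : pt.

Lemma teq_bits (a b : seq bool) ok :
  let r := tfold teq_step (Node (enc_seq enc_bool b) ok) (enc_seq enc_bool a) Leaf in
  tif (tleft r) Leaf (tright r) = if a == b then ok else Leaf.
Proof.
have bad (l : seq bool) : tfold teq_step tt (enc_seq enc_bool l) Leaf = tt by elim: l.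
elim: a b ok => [|x a IH] [|y b] ok //=; first by rewrite bad.
rewrite -/enc_seq /teq_step /= -/(enc_seq _ _) IH eqseq_cons.
by case: x; case: y => //=; case: (a == b).
Qed.

Lemma teqE m n : teq (Node (enc_nat m) (enc_nat n)) = enc_bool (m == n).
Proof.
rewrite /teq /= teq_bits; case: (m =P n) => [->|ne]; first by rewrite eqxx.
by case: eqP => // e; case: ne; apply: enc_nat_inj; rewrite /enc_nat e.
Qed.

(** * Edges under a partial colouring *)

(** A looked-up colour is represented by [Node colour Leaf], and its absence by [Leaf]. *)
Definition get_step u :=
  let acc := tleft u in let x := tleft (tright u) in let p := tright (tright u) in
  tif acc acc (tif (teq (Node (tleft x) p)) (Node (tright x) Leaf) Leaf).
Definition tget u := tfold get_step Leaf (tleft u) (tright u).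

Lemma pt_get : polytime tget.
Proof.
apply: (pt_fold_grow (c := 1) (d := 1)); rewrite /get_step; try by pt_tac.
move=> acc x p /=; have := size_right x; have := size_gt0 acc.
by case: acc => [|a a']; case: (teq _) => [|? ?] /=; lia.
Qed.
#[local] Hint Resolve pt_get : pt.

(** The status of an edge: [Leaf] if it has no coloured vertex, and otherwise
    [Node kind c] with [c] the first colour seen. *)
Definition many := tt.
Definition sat := Node Leaf tt.

(** Besides the status, the accumulator keeps the last uncoloured vertex seen, a candidate for
    revealing. It is wrapped in a [Node] because vertex 0 is encoded by [Leaf]. *)
Definition cls_step u :=
  let st := tleft (tleft u) in let fr := tright (tleft u) in
  let x := tleft (tright u) in let r := tget (Node (tright (tright u)) x) in
  tif r
    (Node (tif st
       (Node (tif (teq (Node (tright st) (tleft r)))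
                (tif (tright (tleft st)) sat many) sat) (tright st))
       (Node Leaf (tleft r))) fr)
    (Node st (Node x Leaf)).
Definition tcls u := tfold cls_step tt (tleft u) (tright u).

Lemma size_tget X v : tree_size (tget (Node X v)) <= tree_size X + 2.
Proof.
rewrite /tget /=.
have found X' acc c : acc = Node c Leaf -> tfold get_step acc X' v = acc.
  by move=> ->; elim: X' => //= x _ X' IH.
elim: X => [|x _ X IH] //=.
have -> : get_step (Node Leaf (Node x v)) =
  tif (teq (Node (tleft x) v)) (Node (tright x) Leaf) Leaf by [].
case: (teq _) => [|? ?] /=; first lia.
by rewrite (found _ _ (tright x)) //=; have := size_right x; lia.
Qed.

Lemma pt_cls : polytime tcls.
Proof.
have hs acc x p : let t := cls_step (Node acc (Node x p)) in
  tree_size (tleft t) <= tree_size (tleft acc) + tree_size p + 20 /\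
  tree_size (tright t) <= maxn (tree_size (tright acc)) (tree_size x + 2).
  have hg := size_tget p x; rewrite /cls_step /=.
  case E: (tget _) hg => [|r r'] hg /=; first by lia.
  case: (tleft acc) => [|k c] /=; first by move: hg => /=; lia.
  by case: (teq _) => [|? ?] /=; case: (tright k) => [|? ?] /=; lia.
apply: (pt_fold_grow (c := 40) (d := 1)).
- by rewrite /cls_step; pt_tac.
- move=> acc x p; have [] := hs acc x p.
  have : cls_step (Node acc (Node x p)) =
    Node (tleft (cls_step (Node acc (Node x p)))) (tright (cls_step (Node acc (Node x p)))).
    by rewrite /cls_step /=; case: (tget _).
  move: (cls_step _) => t -> /=.
  have := size_gt0 x; have := size_gt0 p.
  by case: acc => [|a b] /=; lia.
all: by pt_tac.
Qed.
#[local] Hint Resolve pt_cls : pt.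

(** Kind [Leaf] means one coloured vertex. It passes, and so does [sat]; [many] fails since its
    right part is [Leaf]. *)
Definition tlight st := tif st (tif (tleft st) (tright (tleft st)) tt) Leaf.

Definition sel_step u :=
  let found := tleft (tleft u) in let rest := tright (tleft u) in
  let g := tleft (tright u) in let cl := tcls (Node g (tright (tright u))) in
  tif found (Node found (Node g rest))
    (tif (tlight (tleft cl)) (Node (Node cl g) rest) (Node Leaf (Node g rest))).
Definition tsel u := tfold sel_step tt (tleft u) (tright u).

Lemma size_tcls : exists c d, forall g X,
  tree_size (tcls (Node g X)) <= c * (tree_size g + tree_size X).+1 ^ d.
Proof.
have [p0 [c [d h]]] := polytime_form pt_cls; exists (c * 2 ^ d), d => g X.
apply: leq_trans (proj2 (h _)) _; rewrite -mulnA leq_mul2l -expnMn /=.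
apply/orP; right; case: (posnP d) => [->|d0]; first by rewrite !expn0.
by rewrite leq_exp2r //; lia.
Qed.

Lemma pt_sel : polytime tsel.
Proof.
have [c [d h]] := size_tcls.
apply: (pt_fold_grow (c := c + 3) (d := d.+1)).
- by rewrite /sel_step /tlight; pt_tac.
- move=> acc x p; rewrite /sel_step /=; set cl := tcls _.
  have := h x p; rewrite -/cl.
  have h1 : c * (tree_size x + tree_size p).+1 ^ d <= c * (tree_size x + tree_size p).+1 ^ d.+1.
    by rewrite leq_mul2l leq_pexp2l ?orbT.
  have h2 : tree_size x + tree_size p < (tree_size x + tree_size p).+1 ^ d.+1.
    by rewrite expnS leq_pmulr // expn_gt0.
  rewrite mulnDl; set w := (_ + _).+1 ^ d.+1 in h1 h2 *; set v := c * w in h1 *.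
  move=> h3; have {h1}h3 := leq_trans h3 h1; clearbody v w; clear h.
  have hx := size_gt0 x.
  case: acc => [|[|f f'] rest] /=; try lia.
    by case: (tlight _) => [|? ?] /=; lia.
  by case: (tlight _) => [|? ?] /=; lia.
all: by pt_tac.
Qed.
#[local] Hint Resolve pt_sel : pt.

Definition heavy_step u :=
  let cl := tcls (Node (tleft (tright u)) (tright (tright u))) in
  tif (tleft cl) cl (tleft u).
Definition theavy u := tfold heavy_step Leaf (tleft u) (tright u).

Lemma pt_heavy : polytime theavy.
Proof.
have [c [d h]] := size_tcls.
apply: (pt_fold_grow (c := c) (d := d)).
- by rewrite /heavy_step; pt_tac.
- move=> acc x p; rewrite /heavy_step /=; have := h x p.
  by case: (tleft _) => [|? ?] /=; lia.
all: by pt_tac.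
Qed.
#[local] Hint Resolve pt_heavy : pt.

Definition pin_step u := Node (Node (tleft (tright u)) (tright (tright u))) (tleft u).
Definition tpin u := tfold pin_step (tright (tright u)) (tleft u) (tleft (tright u)).

Lemma pt_pin : polytime tpin.
Proof.
apply: (pt_fold_grow (c := 2) (d := 1)); rewrite /pin_step; try by pt_tac.
by move=> acc x p /=; lia.
Qed.
#[local] Hint Resolve pt_pin : pt.


(** * Correctness of the operations on encoded edges and partial colourings *)

Section Specs.
Variables n q : nat.
Notation V := 'I_n.
Notation colour := 'I_q.
Implicit Types (X : seq (V * colour)) (g : seq V) (H : seq (seq V)).

(** The first binding wins, so consing a pair recolours a vertex just as [pin] does. *)
Fixpoint get X v : option colour :=
  if X is (w, c) :: X' then if w == v then Some c else get X' v else None.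
Definition getf X : {ffun V -> option colour} := [ffun v => get X v].

Definition enc_pc X := enc_seq (fun p : V * colour => Node (enc_nat p.1) (enc_nat p.2)) X.
Definition enc_edge g := enc_seq (fun v : V => enc_nat v) g.
Definition enc_edges H := enc_seq enc_edge H.
Definition enc_col (o : option colour) := if o is Some c then Node (enc_nat c) Leaf else Leaf.

Lemma tgetE X (v : V) : tget (Node (enc_pc X) (enc_nat v)) = enc_col (get X v).
Proof.
rewrite /tget /=.
have found l acc c : acc = Node c Leaf -> tfold get_step acc l (enc_nat v) = acc.
  by move=> ->; elim: l => //= x _ l IH.
elim: X => [|[w c] X IH] //=.
have -> : get_step (Node Leaf (Node (Node (enc_nat w) (enc_nat c)) (enc_nat v))) =
  tif (teq (Node (enc_nat w) (enc_nat v))) (Node (enc_nat c) Leaf) Leaf by [].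
rewrite teqE; have -> : (nat_of_ord w == v) = (w == v) by [].
case: (w == v) => /=; last exact: IH.
exact: found.
Qed.

Definition status (l : seq colour) : tree :=
  if l is c :: l' then
    Node (if l' == [::] then Leaf else if all (pred1 c) l' then many else sat) (enc_nat c)
  else Leaf.

Lemma tclsE X g : exists fr,
  tcls (Node (enc_edge g) (enc_pc X)) = Node (status (pins (getf X) g)) fr /\
  ((fr = Leaf /\ forall v, v \in g -> isSome (getf X v)) \/
   exists2 w, w \in g & getf X w = None /\ fr = Node (enc_nat w) Leaf).
Proof.
rewrite /tcls /= tfold_enc; elim/last_ind: g => [|g v [fr [IH hfr]]].
  by exists Leaf; split => //; left.
rewrite -cats1 foldl_cat /= IH /pins pmap_cat /= /cls_step /= tgetE.
rewrite ffunE; case E: (get X v) => [d|] /=; last first.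
  exists (Node (enc_nat v) Leaf); rewrite cats0; split => //; right; exists v.
    by rewrite mem_cat mem_head orbT.
  by rewrite ffunE E.
exists fr; split; last first.
  case: hfr => [[-> h]|[w wg h]]; [left; split => // w|right; exists w => //].
    by rewrite mem_cat inE => /orP[/h //|/eqP ->]; rewrite ffunE E.
  by rewrite mem_cat wg.
congr Node; case: (pmap _ g) => [|c l] //=; rewrite teqE.
have -> : (nat_of_ord c == d) = (d == c) by rewrite eq_sym.
rewrite all_cat /= andbT; have -> : (l ++ [:: d] == [::]) = false by case: (l).
case: (l =P [::]) => [->|] /=; first by case: (d == c).
by case: (all _ l); case: (d == c).
Qed.

Definition lightish (l : seq colour) := (size l == 1) || ~~ constant l.

Lemma tlightE (l : seq colour) : tlight (status l) =
  if lightish l then tt else Leaf.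
Proof.
rewrite /lightish; case: l => [|c [|d l]] //=.
by case: (_ && _).
Qed.

Lemma tselE X H : exists found rest,
  tsel (Node (enc_edges H) (enc_pc X)) = Node found rest /\
  ((found = Leaf /\ forall g, g \in H -> ~~ lightish (pins (getf X) g)) \/
   exists g H', [/\ perm_eq H (g :: H'), lightish (pins (getf X) g),
     found = Node (tcls (Node (enc_edge g) (enc_pc X))) (enc_edge g) &
     rest = enc_edges H']).
Proof.
rewrite /tsel /= tfold_enc.
suff h : exists found rest,
  foldl (fun a x => sel_step (Node a (Node (enc_edge x) (enc_pc X)))) tt H
   = Node found rest /\
  ((found = Leaf /\ (forall g, g \in H -> ~~ lightish (pins (getf X) g)) /\
    exists2 H', perm_eq H H' & rest = enc_edges H') \/
   exists g H', [/\ perm_eq H (g :: H'), lightish (pins (getf X) g),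
     found = Node (tcls (Node (enc_edge g) (enc_pc X))) (enc_edge g) &
     rest = enc_edges H']).
  have [found [rest [e h']]] := h; exists found, rest; split => //.
  by case: h' => [[? [? _]]|?]; [left | right].
elim/last_ind: H => [|H g [found [rest [IH h]]]].
  by exists Leaf, Leaf; split => //; left; split => //; split => //; exists [::].
rewrite -cats1 foldl_cat /= IH /sel_step /=.
case: h => [[-> [hn [H' pH ->]]]|[g' [H' [pH lg -> ->]]]] /=.
  have [fr [e _]] := tclsE X g; rewrite e /= tlightE -e.
  case lg: (lightish _) => /=.
    exists (Node (tcls (Node (enc_edge g) (enc_pc X))) (enc_edge g)), (enc_edges H').
    split => //; right; exists g, H'; split => //.
    by rewrite cats1 perm_rcons perm_cons.
  exists Leaf, (enc_edges (g :: H')); split => //; left; split => //; split.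
    by move=> h; rewrite mem_cat inE => /orP[/hn //|/eqP ->]; rewrite lg.
  by exists (g :: H') => //; rewrite cats1 perm_rcons perm_cons.
exists (Node (tcls (Node (enc_edge g') (enc_pc X))) (enc_edge g')), (enc_edges (g :: H')).
split => //; right; exists g', (g :: H'); split => //.
rewrite cats1 perm_rcons (perm_trans (y := g :: g' :: H')) ?perm_cons //.
by apply/seq.permP => p /=; lia.
Qed.

Lemma theavyE X H :
  (theavy (Node (enc_edges H) (enc_pc X)) = Leaf /\
     forall g, g \in H -> ~~ touched (getf X) g) \/
  exists2 g, g \in H & touched (getf X) g /\
     theavy (Node (enc_edges H) (enc_pc X)) = tcls (Node (enc_edge g) (enc_pc X)).
Proof.
rewrite /theavy /= tfold_enc; elim/last_ind: H => [|H g IH]; first by left.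
rewrite -cats1 foldl_cat /=.
have hstep a : heavy_step (Node a (Node (enc_edge g) (enc_pc X))) =
  let cl := tcls (Node (enc_edge g) (enc_pc X)) in tif (tleft cl) cl a by [].
have [fr [e _]] := tclsE X g; rewrite hstep {hstep}.
case pg: (pins (getf X) g) e => [|c l] e; rewrite e /=.
  case: IH => [[-> h]|[g' g'H [tg' ->]]].
    left; split => // g'; rewrite mem_cat inE => /orP[/h //|/eqP ->].
    by rewrite /touched pg.
  by right; exists g'; rewrite ?mem_cat ?g'H.
right; exists g; rewrite ?mem_cat ?mem_head ?orbT // -e.
by rewrite /touched pg.
Qed.

Lemma tpinE X g (c : colour) : exists X',
  tpin (Node (enc_edge g) (Node (enc_nat c) (enc_pc X))) = enc_pc X' /\
  getf X' = pin (getf X) g c.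
Proof.
rewrite /tpin /= tfold_enc; elim: g X => [|v g IH] X /=.
  by exists X; split => //; apply/ffunP => w; rewrite !ffunE.
have [X' [e1 e2]] := IH ((v, c) :: X); exists X'; split => //.
rewrite e2; apply/ffunP => w; rewrite !ffunE /= inE.
by case: ifP; rewrite ?orbT ?orbF // [v == w]eq_sym; case: ifP.
Qed.

End Specs.

(** * A stack machine for the estimator *)

Definition zero := enc_frac 0 1.
Definition one := enc_frac 1 1.

(** Items of the stack of pending work. [step] tells them apart by the shape of the tag: a [Leaf] on
    the left marks an operation on the value stack, anything else a call to be expanded. *)
Definition i_eval f X H := Node tt (Node f (Node X H)).
Definition i_top f es := Node sat (Node f es).
Definition i_light := Node Leaf Leaf.
Definition i_heavy := Node Leaf tt.
Definition i_mul := Node Leaf (Node tt Leaf).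

Section Machine.
Variables q K : nat.

Definition kapf := enc_frac 1 K.
Definition qinv := enc_frac 1 q.

(** The value of the call made last is on top of the stack. *)
Definition comb_light vals :=
  let v4 := tleft vals in let v3 := tleft (tright vals) in
  let v2 := tleft (tright (tright vals)) in
  let v1 := tleft (tright (tright (tright vals))) in
  Node (fadd (Node (fsub (Node v1 (fmul (Node kapf v2))))
                   (fmul (Node kapf (fmul (Node v3 v4))))))
       (tright (tright (tright (tright vals)))).

Definition hsum_step u :=
  Node (fadd (Node (tleft u) (tleft (tright u)))) (tright (tright u)).

Definition comb_heavy vals :=
  let r := iter q hsum_step (Node zero vals) in
  Node (fmul (Node (tleft r) qinv)) (tright r).

Definition comb_mul vals :=
  Node (fmul (Node (tleft (tright vals)) (fsub (Node one (fmul (Node kapf (tleft vals)))))))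
       (tright (tright vals)).

Definition comb u := let op := tleft u in
  tif op (tif (tleft op) (comb_mul (tright u)) (comb_heavy (tright u)))
         (comb_light (tright u)).

(** The [tt] passed to [tpin] is the pair of colour 0 and the empty colouring, both encoded by
    [Leaf]. *)
Definition top_step u :=
  let f := tleft (tleft u) in let es := tright (tleft u) in
  let rest := tleft (tright u) in let vals := tright (tright u) in
  tif es
    (Node (Node (i_eval f (tpin (Node (tleft es) tt)) (tright es))
      (Node i_mul (Node (i_top f (tright es)) rest))) vals)
    (Node rest vals).

(** The argument is [((fuel, (X, H)), (rest, vals))] followed by what the edge
    selection returned. *)
Definition light_items u :=
  let b := tleft (tleft u) in let s := tright u in
  let f := tright (tleft b) in let X := tleft (tright b) in let H := tright (tright b) in
  let rest := tleft (tright (tleft u)) in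
  let g := tright (tleft s) in let st := tleft (tleft (tleft s)) in let H' := tright s in
  Node (i_eval f X H')
  (Node (i_eval (tif (tleft st) Leaf f) (tpin (Node g (Node (tright st) X))) H')
  (Node (i_eval f X H)
  (Node (i_eval f (tpin (Node g tt)) H')
  (Node i_light rest)))).

Definition reveal_items (l : seq nat) u :=
  let b := tleft (tleft u) in let w := tright u in
  let f := tright (tleft b) in let X := tleft (tright b) in let H := tright (tright b) in
  foldr (fun a items => Node (i_eval f (Node (Node w (enc_nat a)) X) H) items)
    (Node i_heavy (tleft (tright (tleft u)))) l.

Definition heavy_part u :=
  let b := tleft u in let rest := tleft (tright u) in let vals := tright (tright u) in
  let h := theavy (Node (tright (tright b)) (tleft (tright b))) in
  tif h (tif (tright h) (Node (reveal_items (rev (iota 0 q)) (Node u (tleft (tright h)))) vals)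
                        (Node rest (Node zero vals)))
        (Node rest (Node one vals)).

Definition eval_step u :=
  let b := tleft u in let rest := tleft (tright u) in let vals := tright (tright u) in
  let s := tsel (Node (tright (tright b)) (tleft (tright b))) in
  tif (tleft b)
    (tif (tleft s) (Node (light_items (Node u s)) vals) (heavy_part u))
    (Node rest (Node zero vals)).

Definition step s :=
  let it := tleft (tleft s) in let rest := tright (tleft s) in let vals := tright s in
  tif (tleft it)
    (tif (tright (tleft it)) (top_step (Node (tright it) (Node rest vals)))
                             (eval_step (Node (tright it) (Node rest vals))))
    (Node rest (comb (Node (tright it) vals))).

Lemma pt_comb_light : polytime comb_light.
Proof. by rewrite /comb_light; pt_tac. Qed.

Lemma pt_hsum : polytime hsum_step.
Proof. by rewrite /hsum_step; pt_tac. Qed.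

Lemma pt_iter m F : polytime F -> polytime (iter m F).
Proof.
by move=> hF; elim: m => [|m IH]; [exact: pt_id | exact: (pt_comp hF IH)].
Qed.

Lemma pt_comb_heavy : polytime comb_heavy.
Proof.
have h := pt_iter q pt_hsum.
have h' : polytime (fun vals => iter q hsum_step (Node zero vals)).
  by apply: (pt_comp h); pt_tac.
by rewrite /comb_heavy; pt_tac.
Qed.

Lemma pt_comb_mul : polytime comb_mul.
Proof. by rewrite /comb_mul; pt_tac. Qed.
#[local] Hint Resolve pt_comb_light pt_comb_heavy pt_comb_mul : pt.

Lemma pt_comb : polytime comb.
Proof. by rewrite /comb; pt_tac. Qed.

Lemma pt_top : polytime top_step.
Proof. by rewrite /top_step /i_eval /i_top /i_mul; pt_tac. Qed.

Lemma pt_light_items : polytime light_items.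
Proof. by rewrite /light_items /i_eval; pt_tac. Qed.

Lemma pt_reveal_items l : polytime (reveal_items l).
Proof.
elim: l => [|a l IH]; first by rewrite /reveal_items /=; pt_tac.
by rewrite /reveal_items /= /i_eval; apply: pt_node; [pt_tac | exact: IH].
Qed.
#[local] Hint Resolve pt_comb pt_top pt_light_items pt_reveal_items : pt.

Lemma pt_heavy_part : polytime heavy_part.
Proof. by rewrite /heavy_part; pt_tac. Qed.
#[local] Hint Resolve pt_heavy_part : pt.

Lemma pt_eval : polytime eval_step.
Proof. by rewrite /eval_step; pt_tac. Qed.
#[local] Hint Resolve pt_eval : pt.

Lemma pt_step : polytime step.
Proof. by rewrite /step; pt_tac. Qed.

End Machine.

Definition fr (p : nat * nat) : rat := (p.1%:R / p.2%:R)%R.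
Definition encf (p : nat * nat) := enc_frac p.1 p.2.

Arguments encf : simpl never.

Definition below m (p : nat * nat) := [&& 0 < p.2, p.1 < 2 ^ m & p.2 < 2 ^ m].

Definition add_fr (p r : nat * nat) := (p.1 * r.2 + r.1 * p.2, p.2 * r.2).
Definition sub_fr (p r : nat * nat) := (p.1 * r.2 - r.1 * p.2, p.2 * r.2).
Definition mul_fr (p r : nat * nat) := (p.1 * r.1, p.2 * r.2).

Lemma pnat_neq0 n : 0 < n -> (n%:R : rat)%R != 0%R.
Proof. by rewrite pnatr_eq0 -lt0n. Qed.

Lemma fr_ge0 p : (0 <= fr p)%R.
Proof. by rewrite /fr divr_ge0 ?ler0n. Qed.

Lemma fr_add p r : 0 < p.2 -> 0 < r.2 -> (fr (add_fr p r) = fr p + fr r)%R.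
Proof.
move=> /pnat_neq0 p0 /pnat_neq0 r0; rewrite /fr /= natrD !natrM.
by field; rewrite p0 r0.
Qed.

Lemma fr_mul p r : (fr (mul_fr p r) = fr p * fr r)%R.
Proof. by rewrite /fr /= !natrM invfM mulrACA. Qed.

Lemma fr_sub p r : 0 < p.2 -> 0 < r.2 -> (fr (sub_fr p r) = Num.max 0 (fr p - fr r))%R.
Proof.
move=> p0 r0; have p1 := pnat_neq0 p0; have r1 := pnat_neq0 r0.
have e : (fr p - fr r = ((p.1 * r.2)%:R - (r.1 * p.2)%:R) / (p.2 * r.2)%:R)%R.
  by rewrite /fr !natrM; field; rewrite p1 r1.
rewrite e /fr /=; case: (leqP (p.1 * r.2) (r.1 * p.2)) => h.
  have -> : p.1 * r.2 - r.1 * p.2 = 0 by lia.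
  rewrite mul0r; apply/esym/max_idPl.
  by rewrite pmulr_lle0 ?invr_gt0 ?ltr0n ?muln_gt0 ?p0 ?r0 // subr_le0 ler_nat.
rewrite natrB 1?ltnW //; apply/esym/max_idPr.
by rewrite divr_ge0 ?ler0n // subr_ge0 ler_nat ltnW.
Qed.

Lemma below_mul m m' p r : below m p -> below m' r -> below (m + m') (mul_fr p r).
Proof.
case/and3P=> a1 a2 a3 /and3P[b1 b2 b3]; rewrite /below /= muln_gt0 a1 b1 /=.
by rewrite expnD !ltn_mul.
Qed.

Lemma below_add m m' p r : below m p -> below m' r -> below (m + m').+1 (add_fr p r).
Proof.
case/and3P=> a1 a2 a3 /and3P[b1 b2 b3]; rewrite /below /= muln_gt0 a1 b1 /=.
rewrite expnS expnD.
have := ltn_mul a2 b3; have := ltn_mul b2 a3; have := ltn_mul a3 b3.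
by rewrite [2 ^ m' * _]mulnC; move: (2 ^ m * _) => *; apply/andP; split; lia.
Qed.

Lemma below_sub m m' p r : below m p -> below m' r -> below (m + m') (sub_fr p r).
Proof.
case/and3P=> a1 a2 a3 /and3P[b1 b2 b3]; rewrite /below /= muln_gt0 a1 b1 /=.
rewrite expnD (ltn_mul a3 b3) andbT.
by apply: leq_ltn_trans (leq_subr _ _) _; apply: ltn_mul.
Qed.

Lemma below_le m m' p : m <= m' -> below m p -> below m' p.
Proof.
move=> h /and3P[a1 a2 a3]; rewrite /below a1 /=.
by rewrite (leq_trans a2) ?(leq_trans a3) ?leq_pexp2l.
Qed.

Lemma size_encf m p : below m p -> tree_size (encf p) <= 8 * m + 3.
Proof.
case/and3P=> _ h1 h2; rewrite /encf /enc_frac /=.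
by have := size_enc_nat h1; have := size_enc_nat h2; lia.
Qed.

Lemma tree_sizeN l r : tree_size (Node l r) = (tree_size l + tree_size r).+1.
Proof. by []. Qed.

(** * Runs of the machine with bounds on time and memory *)

Section Reach.
Variable F : tree -> tree.

Definition reach s N s' B := [/\ iter N F s = s',
  forall i, i < N -> looping (iter i F s) &
  forall i, i <= N -> tree_size (iter i F s) <= B].

Lemma reach_le s N s' B B' : B <= B' -> reach s N s' B -> reach s N s' B'.
Proof.
by move=> h [h1 h2 h3]; split => // i hi; apply: leq_trans h; apply: h3.
Qed.

Lemma reach_refl s B : tree_size s <= B -> reach s 0 s B.
Proof. by move=> h; split => // i; rewrite leqn0 => /eqP ->. Qed.

Lemma reach_step s B : looping s -> tree_size s <= B -> tree_size (F s) <= B ->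
  reach s 1 (F s) B.
Proof.
by move=> l h1 h2; split => // [[]//|[|[]]].
Qed.

Lemma reach_trans s1 s2 s3 N N' B : reach s1 N s2 B -> reach s2 N' s3 B ->
  reach s1 (N + N') s3 B.
Proof.
move=> [h1 h2 h3] [h4 h5 h6]; split.
- by rewrite addnC iterD h1.
- move=> i hi; have [iN|Ni] := ltnP i N; first exact: h2.
  by rewrite -(subnK Ni) iterD h1; apply: h5; lia.
- move=> i hi; have [iN|Ni] := leqP i N; first exact: h3.
  by rewrite -(subnK (ltnW Ni)) iterD h1; apply: h6; lia.
Qed.

Definition push_vals (vs : seq (nat * nat)) vals := foldr (fun p t => Node (encf p) t) vals vs.
Definition push_items (item : nat -> tree) l rest := foldr (fun a t => Node (item a) t) rest l.

Lemma size_push_items item I (l : seq nat) rest :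
  (forall a, a \in l -> tree_size (item a) <= I) ->
  tree_size (push_items item l rest) <= tree_size rest + size l * (I + 1).
Proof.
elim: l => [|b l IH] h /=; first by rewrite addn0.
have hb := h b (mem_head _ _).
have : tree_size (push_items item l rest) <= tree_size rest + size l * (I + 1).
  by apply: IH => c cl; apply: h; rewrite inE cl orbT.
rewrite mulSn /push_items; move: (foldr _ _ _) hb => t hb.
by clear -hb; lia.
Qed.

(** Memory is stated as an excess over the two stacks. Consecutive calls reuse the excess [S0], so
    it is counted once, while the pending items and stored values add up; the results end up in
    reverse order. *)
Lemma run_list (item : nat -> tree) (Q : nat -> nat * nat -> Prop) n0 S0 I m (l : seq nat) :
  (forall a, a \in l -> tree_size (item a) <= I) ->
  (forall a rest vals, a \in l -> exists N p, [/\ N <= n0, below m p, Q a p &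
     reach (Node (Node (item a) rest) vals) N (Node rest (Node (encf p) vals))
       (tree_size rest + tree_size vals + S0)]) ->
  forall rest vals, exists N ps, [/\ N <= size l * n0, size ps = size l,
    forall i, i < size l -> below m (nth (0, 0) ps i) /\ Q (nth 0 l i) (nth (0, 0) ps i) &
    reach (Node (push_items item l rest) vals) N (Node rest (push_vals (rev ps) vals))
      (tree_size rest + tree_size vals + size l * (I + 8 * m + 5) + S0 + 1)].
Proof.
elim: l => [|a l IH] hI hr rest vals.
  exists 0, [::]; split => //; apply: reach_refl => /=; lia.
have [N1 [p [hN1 bp Qp r1]]] := hr a (push_items item l rest) vals (mem_head _ _).
have [| |N2 [ps [hN2 sps hps r2]]] := IH _ _ rest (Node (encf p) vals).
- by move=> b bl; apply: hI; rewrite inE bl orbT.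
- by move=> b r v bl; apply: hr; rewrite inE bl orbT.
exists (N1 + N2), (p :: ps); split.
- by rewrite mulSn leq_add.
- by rewrite /= sps.
- by case=> [|i] //= hi; apply: hps.
have sp := size_encf bp.
have sl : tree_size (push_items item l rest) <= tree_size rest + size l * (I + 1).
  by apply: size_push_items => b bl; apply: hI; rewrite inE bl orbT.
apply: reach_trans.
  apply: reach_le r1; move: sl; rewrite /= mulSn; clear; nia.
rewrite rev_cons /push_vals foldr_rcons; apply: reach_le r2.
rewrite [size (a :: l)]/= tree_sizeN; move: sp.
by move: (tree_size (encf p)) => e; clear; lia.
Qed.

End Reach.

Lemma size_tpin X g c :
  tree_size (tpin (Node g (Node c X))) <= tree_size X + tree_size g * (tree_size c + 2).
Proof.
rewrite /tpin /=; elim: g X => [|x _ g IH] X /=; first lia.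
apply: leq_trans (IH _) _; rewrite /pin_step /=.
by have := size_gt0 c; have := size_gt0 x; clear; nia.
Qed.

(** * Evaluation of one call by the machine *)

Section Run.
Variables n q k : nat.
Notation V := 'I_n.
Hypotheses (q_gt2 : 2 < q).
Let K := q ^ k.-1.
Variable c0 : 'I_q.
Hypothesis c0E : c0 = 0 :> nat.
Notation step := (step q K).
Notation est := (@est rat n q k c0).
Variables SF SH XB Em : nat.
Implicit Types (X : seq (V * 'I_q)) (g : seq V) (H : seq (seq V)).

Let Cq := 4 * q + 4.
Let I := SF + XB + SH + 20.
Let U := I + 8 * Em + 20.
(** Evaluation is depth first: each level keeps one frame, made of boundedly many items and values,
    so memory is linear in the fuel for given bounds on their sizes. *)
Definition room f := f.+1 * ((q + 6) * (SF + XB + SH + 20 + 8 * Em + 20)).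

(** Numbers of binary digits. An average combines [q] fractions and a removal four, hence the common
    factor [q + 4]; the constant covers the digits of [K] and [q] and the carries. *)
Fixpoint ebound f := if f is f'.+1 then (q + 4) * ebound f' + (2 * K + 2 * q + 4) else 1.
Fixpoint nsteps f := if f is f'.+1 then (q + 4) * nsteps f' + 2 else 1.

Lemma ebound_gt0 f : 0 < ebound f.
Proof. by case: f => //= f; lia. Qed.

Lemma nsteps_gt0 f : 0 < nsteps f.
Proof. by case: f => //= f; lia. Qed.

Let K_gt0 : 0 < K.
Proof. by rewrite /K expn_gt0; lia. Qed.

Lemma size_i_eval (f X H : tree) :
  tree_size (i_eval f X H) = tree_size f + tree_size X + tree_size H + 6.
Proof. by rewrite /= ; lia. Qed.

Lemma size_edge g H : g \in H -> tree_size (enc_edge g) <= tree_size (enc_edges H).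
Proof.
elim: H => //= h H IH; rewrite inE => /orP[/eqP ->|/IH]; rewrite /enc_edges /=; lia.
Qed.

Lemma size_vertex (v : V) g : v \in g -> tree_size (enc_nat v) <= tree_size (enc_edge g).
Proof.
elim: g => //= h g IH; rewrite inE => /orP[/eqP ->|/IH]; rewrite /enc_edge /=; lia.
Qed.

Lemma size_edges_perm H H' : perm_eq H H' ->
  tree_size (enc_edges H) = tree_size (enc_edges H').
Proof.
have e L : tree_size (enc_edges L) = (\sum_(g <- L) (tree_size (enc_edge g)).+1).+1.
  elim: L => [|g L IH]; first by rewrite big_nil.
  by rewrite big_cons [LHS]/= -/(enc_edges L) IH; lia.
by move=> p; rewrite !e (perm_big _ p).
Qed.

Lemma size_colour (c : 'I_q) : tree_size (enc_nat c) <= 4 * q + 1.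
Proof. by apply: size_enc_nat; apply: leq_trans (ltn_ord c) (ltnW (ltn_expl _ _)). Qed.

Lemma step_eval0 (X H rest vals : tree) :
  step (Node (Node (i_eval Leaf X H) rest) vals) = Node rest (Node (encf (0, 1)) vals).
Proof. by []. Qed.

Lemma run_eval0 (X H rest vals : tree) f : tree_size X <= XB -> tree_size H <= SH ->
  reach step (Node (Node (i_eval Leaf X H) rest) vals) 1
    (Node rest (Node (encf (0, 1)) vals)) (tree_size rest + tree_size vals + room f).
Proof.
move=> hX hH; rewrite -(step_eval0 X H).
have hr : SF + XB + SH + 40 <= room f by rewrite /room; nia.
apply: reach_step => //.
  by rewrite !tree_sizeN [tree_size Leaf]/=; lia.
rewrite step_eval0 /=; lia.
Qed.

Lemma hsumE m E ws p vals : below m p -> all (below E) ws ->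
  exists2 r, iter (size ws) hsum_step (Node (encf p) (push_vals ws vals)) =
             Node (encf r) vals &
    below (m + size ws * E.+1) r /\ (fr r = fr p + \sum_(w <- ws) fr w)%R.
Proof.
elim: ws m p => [|w ws IH] m p bp /=.
  by move=> _; exists p => //; rewrite big_nil addr0 addn0.
case/andP=> bw bws.
have [r e [br fr_r]] := IH _ (add_fr p w) (below_add bp bw) bws.
exists r; first by rewrite -iterS iterSr /hsum_step /= /encf faddE.
split; first by apply: below_le br; rewrite mulSn; lia.
rewrite fr_r big_cons addrA fr_add //; [by case/and3P: bp | by case/and3P: bw].
Qed.


(** A level prepends to [X] at most the vertices of one edge with their colour, of size at most
    [SH * Cq]; the bound by [XB] reserves [f] such increments in advance. *)
Lemma eval_run f fl X H rest vals : tlen fl = f -> tree_size fl <= SF ->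
  tree_size (enc_edges H) <= SH -> tree_size (enc_pc X) + f * (SH * Cq) <= XB ->
  ebound f <= Em ->
  exists N p, [/\ N <= nsteps f, below (ebound f) p, est f (getf X) H (fr p) &
    reach step (Node (Node (i_eval fl (enc_pc X) (enc_edges H)) rest) vals) N
      (Node rest (Node (encf p) vals)) (tree_size rest + tree_size vals + room f)].
Proof.
elim: f fl X H rest vals => [|f IH] fl X H rest vals lfl sfl sH sX hE.
  have {lfl sfl} -> : fl = Leaf by case: fl lfl sfl.
  exists 1, (0, 1); split => //.
    by rewrite /fr mul0r; apply: Est0.
  by apply: run_eval0 => //; lia.
case: fl lfl sfl => // x fl [lfl] sfl.
have sfl' : tree_size fl <= SF by move: sfl; rewrite tree_sizeN; lia.
have SH0 : 0 < SH by apply: leq_trans sH; apply: size_gt0.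
have E0 := ebound_gt0 f.
have hE' : ebound f <= Em by apply: leq_trans hE => /=; lia.
have hroom : room f.+1 = room f + (q * U + 6 * U).
  by rewrite -mulnDl /room /U /I mulSn addnC.
have sXB : tree_size (enc_pc X) <= XB by apply: leq_trans sX; apply: leq_addr.
have hU : I + 8 * ebound f + 5 <= U by rewrite /U; lia.
set st := Node (Node _ rest) vals.
have sst : tree_size st <= tree_size rest + tree_size vals + room f.+1.
  rewrite /st !tree_sizeN [tree_size Leaf]/= hroom.
  move: sfl sXB sH; rewrite tree_sizeN {2}/U /I; clear.
  by move: (room f) (q * U) => *; lia.
have [found [H'' [esel hsel]]] := tselE X H.
have estep : step st = (if found is Node _ _ then
    Node (light_items (Node (Node (Node (Node x fl) (Node (enc_pc X) (enc_edges H)))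
                                  (Node rest vals)) (Node found H''))) vals
  else heavy_part q (Node (Node (Node x fl) (Node (enc_pc X) (enc_edges H)))
                          (Node rest vals))).
  by rewrite /st /step /= /eval_step /= esel /=; case: (found).
case: hsel => [[ef hn]|[g [H' [pH lg ef eH'']]]]; last first.
  rewrite ef eH'' in estep.
  have [fr0 [ecls _]] := tclsE X g.
  set P := getf X in ecls lg *.
  set it1 := i_eval fl (enc_pc X) (enc_edges H').
  set it2 := i_eval (tif (tleft (status (pins P g))) Leaf fl)
    (tpin (Node (enc_edge g) (Node (tright (status (pins P g))) (enc_pc X)))) (enc_edges H').
  set it3 := i_eval fl (enc_pc X) (enc_edges H).
  set it4 := i_eval fl (tpin (Node (enc_edge g) tt)) (enc_edges H').
  pose item := nth Leaf [:: it1; it2; it3; it4].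
  have {estep} estep : step st = Node (push_items item (iota 0 4) (Node i_light rest)) vals.
    by rewrite estep ecls.
  have gH : g \in H by rewrite (perm_mem pH) mem_head.
  have sg := leq_trans (size_edge gH) sH.
  have sH' : tree_size (enc_edges H') <= SH.
    by move: sH; rewrite (size_edges_perm pH) [enc_edges _]/= tree_sizeN -/(enc_edges H'); lia.
  have [X0 [eX0 gX0]] := tpinE [::] g c0.
  have eX0' : tpin (Node (enc_edge g) tt) = enc_pc X0 by rewrite -eX0 c0E.
  have {}gX0 : getf X0 = pin (nocol n q) g c0.
    by rewrite gX0; congr pin; apply/ffunP => v; rewrite !ffunE.
  have hSC : SH * 3 <= SH * Cq by rewrite leq_mul2l /Cq; lia.
  have sX0 : tree_size (enc_pc X0) + f * (SH * Cq) <= XB.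
    have : tree_size (enc_pc X0) <= 1 + tree_size (enc_edge g) * 3.
      by rewrite -eX0'; apply: leq_trans (size_tpin _ _ _) _.
    have := size_gt0 (enc_pc X); move: sX hSC sg; rewrite mulSn; clearbody Cq; clear.
    by move: (SH * Cq) => T; move: (f * T) => *; lia.
  have sX1 c : pins P g = [:: c] -> tree_size (tpin (Node (enc_edge g)
      (Node (enc_nat c) (enc_pc X)))) + f * (SH * Cq) <= XB.
    move=> _; have h1 := size_tpin (enc_pc X) (enc_edge g) (enc_nat c).
    have h2 : tree_size (enc_edge g) * (tree_size (enc_nat c) + 2) <= SH * Cq.
      by apply: leq_mul => //; have := size_colour c; rewrite /Cq; lia.
    move: sX h1 h2; rewrite mulSn; clearbody Cq; clear; move: (SH * Cq) => T.
    by move: (f * T) (tree_size (enc_edge g) * _) => *; lia.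
  have sX2 : tree_size (tpin (Node (enc_edge g)
      (Node (tright (status (pins P g))) (enc_pc X)))) <= XB.
    have h1 := size_tpin (enc_pc X) (enc_edge g) (tright (status (pins P g))).
    have h2 : tree_size (enc_edge g) * (tree_size (tright (status (pins P g))) + 2) <= SH * Cq.
      apply: leq_mul => //; case: (pins P g) => [|c l] /=; first by rewrite /Cq; lia.
      by have := size_colour c; rewrite /Cq; lia.
    move: sX h1 h2; rewrite mulSn; clearbody Cq; clear; move: (SH * Cq) => T.
    by move: (f * T) (tree_size (enc_edge g) * _) => *; lia.
  have sX' : tree_size (enc_pc X) + f * (SH * Cq) <= XB.
    by move: sX; rewrite mulSn; clear; move: (SH * _) => T; move: (f * T) => *; lia.
  (* The second call is meaningful for a single coloured vertex only; for a satisfied edge its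
     numerator is 0. *)
  pose Q i p := match i with
    | 0 => est f P H' (fr p)
    | 1 => (forall c, pins P g = [:: c] -> est f (pin P g c) H' (fr p)) /\
           (~~ constant (pins P g) -> p.1 = 0)
    | 2 => est f P H (fr p)
    | _ => est f (pin (nocol n q) g c0) H' (fr p)
    end.
  have hI a : a \in iota 0 4 -> tree_size (item a) <= I.
    rewrite mem_iota add0n /= => a4; rewrite /I.
    case: a a4 => [|[|[|[|a]]]] // _; rewrite /item [nth _ _ _]/=.
    - by rewrite /it1 size_i_eval; move: sX'; clear -sfl' sH'; lia.
    - rewrite /it2 size_i_eval; move: sX2 (size_gt0 fl).
      by case: (tleft _) => [|? ?] /=; clear -sfl' sH'; lia.
    - by rewrite /it3 size_i_eval; move: sX'; clear -sfl' sH; lia.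
    - by rewrite /it4 size_i_eval eX0'; move: sX0; clear -sfl' sH'; lia.
  have hrun a r v : a \in iota 0 4 -> exists N p, [/\ N <= nsteps f,
      below (ebound f) p, Q a p & reach step (Node (Node (item a) r) v) N
      (Node r (Node (encf p) v)) (tree_size r + tree_size v + room f)].
    rewrite mem_iota add0n /= => a4.
    case: a a4 => [|[|[|[|a]]]] // _; rewrite /item [nth _ _ _]/=.
    - exact: IH.
    - rewrite /it2; case/orP: (lg) => [/eqP s1|nc].
        case E: (pins P g) s1 => [|c [|]] // _ /=.
        have [X1 [eX1 gX1]] := tpinE X g c.
        have [|N [p [h1 h2 h3 h4]]] := IH fl X1 H' r v lfl sfl' sH' _ hE'.
          by rewrite -eX1; apply: sX1.
        exists N, p; split => //; last by rewrite eX1.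
        by split=> [c'|]; rewrite ?E // => -[<-]; rewrite -/P in gX1; rewrite -gX1.
      (* A satisfied edge: the second call gets no fuel, hence value 0, so [comb_light] serves both
         [EstLight] and [EstSat]. *)
      have -> : tleft (status (pins P g)) = sat.
        by case: (pins P g) nc => [|c [|d l]] //= /negPf ->.
      exists 1, (0, 1); split => //.
      + exact: nsteps_gt0.
      + by apply: below_le E0 _.
      + by split=> // c E; rewrite E in nc.
      + exact: run_eval0.
    - exact: IH.
    - rewrite /it4 eX0'; have [N [p [h1 h2 h3 h4]]] := IH fl X0 H' r v lfl sfl' sH' sX0 hE'.
      by exists N, p; split => //; rewrite /Q -gX0.
  have [N [ps [hN sps hps hreach]]] := run_list hI hrun (Node i_light rest) vals.
  case: ps sps hps hreach => [|p1 [|p2 [|p3 [|p4 [|? ?]]]]] // _ hps hreach.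
  have [b1 q1] := hps 0 isT; have [b2 [q2 q2']] := hps 1 isT.
  have [b3 q3] := hps 2 isT; have [b4 q4] := hps 3 isT.
  rewrite /= in b1 q1 b2 q2 q2' b3 q3 b4 q4.
  have bK : below K (1, K) by rewrite /below /= K_gt0 ltn_expl // -{1}(expn0 2) ltn_exp2l // K_gt0.
  pose p := add_fr (sub_fr p1 (mul_fr (1, K) p2)) (mul_fr (1, K) (mul_fr p3 p4)).
  have bp : below (ebound f.+1) p.
    apply: below_le (below_add (below_sub b1 (below_mul bK b2)) (below_mul bK (below_mul b3 b4))).
    by rewrite /= mulnDl; clear; move: (q * ebound f) => *; lia.
  exists (1 + N + 1), p; split => //.
  - move: hN; rewrite [size _]/= [nsteps f.+1]/= mulnDl; clear; lia.
  - have fp : fr p = (Num.max 0 (fr p1 - kap rat q k * fr p2)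
                      + kap rat q k * (fr p3 * fr p4))%R.
      have fK : fr (1, K) = kap rat q k by rewrite /fr /= mul1r.
      case/and3P: (b1) (b2) (b3) (b4) => ? _ _ /and3P[? _ _] /and3P[? _ _] /and3P[? _ _].
      by rewrite fr_add ?fr_sub ?fr_mul ?fK //= ?muln_gt0 ?K_gt0 //; apply/and3P.
    case/orP: (lg) => [/eqP s1|nc].
      case E: (pins P g) s1 => [|c [|]] // _.
      by rewrite fp; apply: (EstLight pH E) => //; apply: q2.
    have e2 : fr p2 = 0%R by rewrite /fr q2' // mul0r.
    rewrite fp e2 mulr0 subr0 (elimT max_idPr (fr_ge0 p1)).
    exact: (EstSat pH nc).
  have hB : tree_size (Node i_light rest) + tree_size vals +
    size (iota 0 4) * (I + 8 * ebound f + 5) + room f + 1 <=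
    tree_size rest + tree_size vals + room f.+1.
    rewrite hroom tree_sizeN [tree_size i_light]/= [size _]/=; move: hU; rewrite {2}/U /I.
    by clear; move: (room f) (q * U) => *; lia.
  have {}hreach := reach_le hB hreach; have [eN _ sN] := hreach.
  apply: reach_trans; first apply: reach_trans.
  - by apply: reach_step => //; rewrite estep; apply: (sN 0 isT).
  - by rewrite estep; apply: hreach.
  - have e3 : step (Node (Node i_light rest) (push_vals (rev [:: p1; p2; p3; p4]) vals)) =
      Node rest (Node (encf p) vals).
      by rewrite /step /= /comb /= /comb_light /= /encf /kapf !fmulE fsubE faddE.
    rewrite -e3; apply: reach_step => //; first by rewrite -eN; apply: (sN N).
    rewrite e3 (tree_sizeN rest) (tree_sizeN (encf p)) hroom; have := size_encf bp; move: hE.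
    rewrite {2}/U; clear; move: (ebound f.+1) (tree_size (encf p)) => u v.
    by move: (room f) (q * U) => *; lia.
(* No edge was selected, so every touched edge has at least two coloured vertices, all of one
   colour. *)
rewrite ef in estep; set P := getf X in hn *.
have hfin p' : below (ebound f.+1) p' -> step st = Node rest (Node (encf p') vals) ->
  reach step st 1 (Node rest (Node (encf p') vals)) (tree_size rest + tree_size vals + room f.+1).
  move=> bp e; rewrite -e; apply: reach_step => //.
  rewrite e (tree_sizeN rest) (tree_sizeN (encf p')) hroom; have := size_encf bp; move: hE.
  rewrite {2}/U; clear; move: (ebound f.+1) (tree_size (encf p')) => u v.
  by move: (room f) (q * U) => *; lia.
have E1 := ebound_gt0 f.+1.
case: (theavyE X H) => [[eh hu]|[g gH [tg eh]]].
  have b1 : below (ebound f.+1) (1, 1) by apply: below_le E1 _.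
  exists 1, (1, 1); split => //; first by rewrite /=; lia.
    by rewrite /fr divr1; apply: EstFree.
  by apply: hfin => //; rewrite estep /heavy_part /= eh.
have [fr0 [ecls hfr]] := tclsE X g.
have cg : constant (pins P g).
  by have := hn g gH; rewrite /lightish negb_or negbK => /andP[].
have {}ecls : exists a b, tcls (Node (enc_edge g) (enc_pc X)) = Node (Node a b) fr0.
  move: tg; rewrite ecls /touched; case: (pins _ g) => //= c l _.
  by exists (if l == [::] then Leaf else if all (pred1 c) l then many else sat), (enc_nat c).
have {ecls} [s1 [s2 ecls]] := ecls.
rewrite ecls in eh.
case: hfr => [[efr full]|[w wg [Pw efr]]].
  have b0 : below (ebound f.+1) (0, 1) by apply: below_le E1 _.
  exists 1, (0, 1); split => //; first by rewrite /=; lia.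
    by rewrite /fr mul0r; apply: (@EstFull _ _ _ _ _ _ _ _ g).
  by apply: hfin => //; rewrite estep /heavy_part /= eh efr.
pose item a := i_eval fl (Node (Node (enc_nat w) (enc_nat a)) (enc_pc X)) (enc_edges H).
pose l := rev (iota 0 q).
have {}estep : step st = Node (push_items item l (Node i_heavy rest)) vals.
  by rewrite estep /heavy_part /= eh efr.
have ltl a : a \in l -> a < q by rewrite mem_rev mem_iota add0n.
have sw := leq_trans (leq_trans (size_vertex wg) (size_edge gH)) sH.
have sXa (a : 'I_q) : tree_size (enc_pc ((w, a) :: X)) + f * (SH * Cq) <= XB.
  have h1 : tree_size (enc_nat w) + (4 * q + 1) + 2 <= SH * Cq.
    apply: leq_trans (_ : SH + SH * (4 * q + 3) <= _); last by rewrite /Cq; clear; nia.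
    by move: sw SH0; clear; move: (tree_size _) => z h1 h2; nia.
  have h2 := size_colour a; move: sX h1 h2.
  rewrite [enc_pc (_ :: _)]/= !tree_sizeN -/(enc_pc X) mulSn; clearbody Cq; clear.
  by move: (SH * Cq) => T; move: (f * T) => *; lia.
pose Q (a : nat) p := forall a' : 'I_q, a = a' :> nat -> est f (pin P [:: w] a') H (fr p).
have hI a : a \in l -> tree_size (item a) <= I.
  move=> /ltl aq; have := sXa (Ordinal aq); rewrite /item size_i_eval /I.
  have -> : Node (Node (enc_nat w) (enc_nat a)) (enc_pc X) = enc_pc ((w, Ordinal aq) :: X) by [].
  by clear -sfl' sH; lia.
have hrun a r v : a \in l -> exists N p, [/\ N <= nsteps f,
    below (ebound f) p, Q a p & reach step (Node (Node (item a) r) v) N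
    (Node r (Node (encf p) v)) (tree_size r + tree_size v + room f)].
  move=> /ltl aq; pose a' := Ordinal aq.
  have [N [p [h1 h2 h3 h4]]] := IH fl ((w, a') :: X) H r v lfl sfl' sH (sXa a') hE'.
  exists N, p; split => // b ab.
  have -> : pin P [:: w] b = getf ((w, a') :: X); last by [].
  have -> : b = a' by apply: val_inj; rewrite /= -ab.
  by apply/ffunP => u; rewrite !ffunE /= inE eq_sym.
have [N [ps [hN sps hps hreach]]] := run_list hI hrun (Node i_heavy rest) vals.
have sl : size l = q by rewrite size_rev size_iota.
have hB : tree_size (Node i_heavy rest) + tree_size vals +
    size l * (I + 8 * ebound f + 5) + room f + 1 <=
    tree_size rest + tree_size vals + room f.+1.
  rewrite hroom tree_sizeN [tree_size i_heavy]/= sl.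
  have h := leq_mul (leqnn q) hU.
  have : 20 <= U by rewrite /U; lia.
  by move: h; clear; move: (room f) (q * U) (q * _) => *; lia.
have {}hreach := reach_le hB hreach; have [eN _ sN] := hreach.
(* The colours were pushed in decreasing order and the value stack reverses once more, so [ws] is
   indexed by the colours. *)
pose ws := rev ps.
have sws : size ws = q by rewrite size_rev sps.
have hws a : a < q -> below (ebound f) (nth (0, 0) ws a) /\ Q a (nth (0, 0) ws a).
  move=> aq; rewrite nth_rev sps sl //.
  have h := hps (q - a.+1); rewrite sl in h; have [|h1 h2] := h; first by lia.
  split => //; move: h2; rewrite /l nth_rev ?size_iota ?nth_iota; try lia.
  by have -> : 0 + (q - (q - a.+1).+1) = a by lia.
have aws : all (below (ebound f)) ws.
  by apply/(all_nthP (0, 0)) => i; rewrite sws => /hws[].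
have b01 : below 1 (0, 1) by [].
have [r er [br frr]] := hsumE vals b01 aws.
rewrite sws in er br.
have bq : below q (1, q).
  by rewrite /below /= ltn_expl // -{2}(expn0 2) ltn_exp2l //; apply/andP; split; lia.
have bp : below (ebound f.+1) (mul_fr r (1, q)).
  apply: below_le (below_mul br bq); rewrite /= mulnS mulnDl.
  by clear; move: (q * _) => *; lia.
exists (1 + N + 1), (mul_fr r (1, q)); split => //.
- by move: hN; rewrite sl [nsteps f.+1]/= mulnDl; clear; move: (q * _) => *; lia.
- have -> : fr (mul_fr r (1, q)) = ((\sum_(a < q) fr (nth (0, 0) ws a)) / q%:R)%R.
    rewrite fr_mul frr [fr (1, q)]/fr mul1r /= {1}/fr mul0r add0r.
    by rewrite (big_nth (0, 0)) sws big_mkord.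
  apply: (@EstHeavy _ _ _ _ _ _ _ _ g w (fun a : 'I_q => fr (nth (0, 0) ws a))) => //.
    move=> h hH th; have := hn h hH; rewrite /lightish negb_or negbK => /andP[s1' ->].
    move: th s1'; rewrite /touched -/P; case: (pins P h) => [|? [|]] //.
  by move=> a; have [_] := hws a (ltn_ord a); apply.
apply: reach_trans; first apply: reach_trans.
- by apply: reach_step => //; rewrite estep; apply: (sN 0).
- by rewrite estep; apply: hreach.
have e3 : step (Node (Node i_heavy rest) (push_vals (rev ps) vals)) =
    Node rest (Node (encf (mul_fr r (1, q))) vals).
  rewrite /step /= /comb /= /comb_heavy.
  by have -> : zero = encf (0, 1) by []; rewrite er /= /encf /qinv fmulE.
rewrite -e3; apply: reach_step => //; first by rewrite -eN; apply: (sN N).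
rewrite e3 (tree_sizeN rest) (tree_sizeN (encf _)) hroom; have := size_encf bp; move: hE.
rewrite {2}/U; clear; move: (ebound f.+1) (tree_size (encf _)) => u v.
by move: (room f) (q * U) => *; lia.
Qed.

End Run.

Lemma size_i_top (f es : tree) : tree_size (i_top f es) = tree_size f + tree_size es + 7.
Proof. by rewrite /=; lia. Qed.

(** * The product over the edges *)

Section Top.
Variables n q k : nat.
Notation V := 'I_n.
Hypotheses (q_gt2 : 2 < q).
Let K := q ^ k.-1.
Variable c0 : 'I_q.
Hypothesis c0E : c0 = 0 :> nat.
Notation step := (step q K).
Notation est := (@est rat n q k c0).
Notation ebound := (ebound q k).

(** Here [z] estimates the probability that a uniform colouring is proper, as a telescoping product
    with one run of the estimator per factor. *)
Fixpoint top_est f (es : seq (seq V)) (z : rat) : Prop :=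
  if es is g :: es' then exists y z',
    [/\ est f (pin (nocol n q) g c0) es' y, top_est f es' z' &
        z = (Num.max 0 (1 - kap rat q k * y) * z')%R]
  else z = 1%R.

(** The product is accumulated in the bottom value [p], so its digits grow by at most
    [ebound f + K + 1] per edge: additively in the number of edges. *)
Lemma top_run f fl SH Mt es m p : tlen fl = f -> tree_size (enc_edges es) <= SH ->
  below m p -> m + size es * (ebound f + K + 1) <= Mt ->
  let XB := 1 + f.+1 * (SH * (4 * q + 4)) in
  exists N r z, [/\ N <= size es * (nsteps q f + 2) + 1, below Mt r, top_est f es z,
    fr r = (fr p * z)%R &
    reach step (Node (Node (i_top fl (enc_edges es)) Leaf) (Node (encf p) Leaf)) N
      (Node Leaf (Node (encf r) Leaf))
      (room q (tree_size fl) SH XB (ebound f) f + tree_size fl + SH + 16 * Mt + 100)].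
Proof.
move=> lfl sH bp hM XB; set B := _ + 100.
have hroom : tree_size fl + XB + SH <= room q (tree_size fl) SH XB (ebound f) f.
  rewrite /room; move: (tree_size fl + XB + SH) (8 * _) => u v.
  by apply: leq_trans (_ : 1 * (1 * (u + 20 + v + 20)) <= _); [lia | rewrite !leq_mul //; lia].
have K0 : 0 < K by rewrite /K expn_gt0; lia.
elim: es m p sH bp hM => [|g es IH] m p sH bp hM.
  exists 1, p, 1%R; split => //; first by apply: below_le bp; lia.
    by rewrite mulr1.
  apply: reach_step => //; rewrite /step /= /top_step /=.
    have := size_encf bp; rewrite /encf /enc_frac tree_sizeN /B; move: hM; clear; lia.
  by have := size_encf bp; rewrite /encf /enc_frac tree_sizeN /B; move: hM; clear; lia.
have sH' : tree_size (enc_edges es) <= SH.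
  by move: sH; rewrite [enc_edges _]/= tree_sizeN -/(enc_edges es); lia.
have sg : tree_size (enc_edge g) <= SH.
  by move: sH; rewrite [enc_edges _]/= tree_sizeN; lia.
have [X0 [eX0 gX0]] := tpinE [::] g c0.
have eX0' : tpin (Node (enc_edge g) tt) = enc_pc X0 by rewrite -eX0 c0E.
have {}gX0 : getf X0 = pin (nocol n q) g c0.
  by rewrite gX0; congr pin; apply/ffunP => v; rewrite !ffunE.
have sX0 : tree_size (enc_pc X0) + f * (SH * (4 * q + 4)) <= XB.
  have : tree_size (enc_pc X0) <= 1 + tree_size (enc_edge g) * 3.
    by rewrite -eX0'; apply: leq_trans (size_tpin _ _ _) _.
  have : SH * 3 <= SH * (4 * q + 4) by rewrite leq_mul2l; lia.
  move: sg; rewrite /XB [f.+1 * _]mulSn; clear; move: (SH * (4 * q + 4)) => T.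
  by move: (f * T) => *; lia.
set rest := Node i_mul (Node (i_top fl (enc_edges es)) Leaf).
have [N1 [y [hN1 by_ ey r1]]] := eval_run q_gt2 (k := k) c0E rest (Node (encf p) Leaf) lfl
  (leqnn (tree_size fl)) sH' sX0 (leqnn (ebound f)).
pose p' := mul_fr p (sub_fr (1, 1) (mul_fr (1, K) y)).
have bK : below K (1, K) by rewrite /below /= K0 ltn_expl // -{1}(expn0 2) ltn_exp2l // K0.
have b1 : below 1 (1, 1) by [].
have bp' := below_mul bp (below_sub b1 (below_mul bK by_)).
have [|N2 [r [z [hN2 br hz frr r2]]]] := IH _ p' sH' bp'.
  by move: hM; rewrite [size _]/= mulSn; clear; move: (size es * _) => *; lia.
have mM : m <= Mt by apply: leq_trans hM; apply: leq_addr.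
have sp : tree_size (encf p) <= 8 * Mt + 3.
  by apply: leq_trans (size_encf bp) _; lia.
have sy : tree_size (encf y) <= 8 * Mt + 3.
  apply: leq_trans (size_encf by_) _; move: hM; rewrite [size _]/= mulSn.
  by clear; move: (size es * _) => *; lia.
set st := Node (Node (i_top _ _) Leaf) _.
have e1 : step st = Node (Node (i_eval fl (enc_pc X0) (enc_edges es)) rest) (Node (encf p) Leaf).
  by rewrite /st /step /= /top_step /= eX0'.
have e3 : step (Node rest (Node (encf y) (Node (encf p) Leaf))) =
  Node (Node (i_top fl (enc_edges es)) Leaf) (Node (encf p') Leaf).
  by rewrite /step /= /comb /= /comb_mul /= /encf /kapf /one fmulE fsubE fmulE.
have srest : tree_size rest <= tree_size fl + SH + 20.
  by rewrite /rest /i_mul /i_top !tree_sizeN [tree_size Leaf]/=; move: sH'; clear; lia.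
exists (1 + N1 + 1 + N2), r, (Num.max 0 (1 - kap rat q k * fr y) * z)%R; split => //.
- move: hN1 hN2; rewrite [size (g :: es)]/= mulSn; clear.
  by move: (size es * _) => *; lia.
- by exists (fr y), z; split => //; rewrite -gX0.
- rewrite frr fr_mul fr_sub ?fr_mul //=; last by case/and3P: by_ => *; rewrite muln_gt0 K0.
  have -> : fr (1, K) = kap rat q k by rewrite /fr /= mul1r.
  have -> : fr (1, 1) = 1%R by rewrite /fr /= divr1.
  by rewrite [RHS]mulrA /fr mulrA.

have [_ _ s1] := r1.
apply: reach_trans; last exact: r2.
apply: reach_trans; first apply: reach_trans.
- apply: reach_step => //; last first.
    rewrite e1; apply: leq_trans (s1 0 isT) _; rewrite (tree_sizeN (encf p)) [tree_size Leaf]/=.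
    by rewrite /B; move: srest sp; clear; move: (room _ _ _ _ _ _) => *; lia.
  rewrite /st (tree_sizeN (Node _ _)) (tree_sizeN (i_top _ _)) size_i_top (tree_sizeN (encf p)).
  by rewrite [tree_size Leaf]/= /B; move: sH sp hroom; clear; move: (room _ _ _ _ _ _) => *; lia.
- rewrite e1; apply: reach_le r1; rewrite (tree_sizeN (encf p)) [tree_size Leaf]/=.
  by rewrite /B; move: srest sp; clear; move: (room _ _ _ _ _ _) => *; lia.
rewrite -e3; apply: reach_step => //.
  rewrite (tree_sizeN rest) (tree_sizeN (encf y)) (tree_sizeN (encf p)) [tree_size Leaf]/=.
  by rewrite /B; move: srest sp sy hroom; clear; move: (room _ _ _ _ _ _) => *; lia.
by rewrite e3; have [_ _ /(_ 0 isT)] := r2.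
Qed.

End Top.

(** * Accuracy and running time *)

(** The absolute error [2 * kp * th] becomes a relative error [th], because [1 - kp * x >= 2 * kp].
    Truncation at 0 respects both bounds, which are nonnegative. *)
Lemma factor_accuracy (R : realFieldType) (kp th y x : R) :
  (0 < kp -> 16 * kp <= 1 -> 0 <= th <= 1 -> 0 <= x <= 2 -> `|y - x| <= th * 2 ->
  0 < 1 - kp * x /\
  (1 - th) * (1 - kp * x) <= Num.max 0 (1 - kp * y) <= (1 + th) * (1 - kp * x))%R.
Proof.
move=> k0 k16 /andP[t0 t1] /andP[x0 x2]; rewrite ler_norml => /andP[h1 h2].
have hx : (kp * x <= kp * 2)%R by rewrite ler_wpM2l // ltW.
have t8 : (2 * kp <= 1 - kp * x)%R by lra.
have h3 : (th * (2 * kp) <= th * (1 - kp * x))%R by rewrite ler_wpM2l.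
have h4 : (kp * (y - x) <= kp * (th * 2))%R by rewrite ler_wpM2l ?(ltW k0).
have h5 : (kp * (x - y) <= kp * (th * 2))%R by rewrite ler_wpM2l ?(ltW k0) //; lra.
split; first by lra.
rewrite le_max ge_max; apply/andP; split; first by apply/orP; right; lra.
apply/andP; split; last by lra.
by apply: mulr_ge0; lra.
Qed.

Lemma contraction_range (R : realFieldType) (kp : R) f :
  (0 < kp -> 16 * kp <= 1 -> 0 <= (1 - kp) ^+ f <= 1)%R.
Proof. by move=> k0 k16; rewrite exprn_ge0 ?exprn_ile1 //; lra. Qed.

Section Accuracy.
Variables n q k D : nat.
Hypotheses (q_gt2 : 2 < q) (k_gt1 : 1 < k) (D_gt0 : 0 < D).
Hypothesis big : 320 * k * D ^ 2 <= q ^ k.-1.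
Variable c0 : 'I_q.

Local Open Scope ring_scope.

Let q_gt1 : (1 < q)%N := ltnW q_gt2.

Lemma N_nocol_cons (R : realFieldType) g (H : seq (seq 'I_n)) : good k D (g :: H) ->
  (N (nocol n q) (g :: H))%:R =
  (N (nocol n q) H)%:R * (1 - kap R q k * Y R (pin (nocol n q) g c0) H).
Proof.
move=> gH; have gH' := good_cons gH.
have [ug sg] := good_edge gH (mem_head _ _).
have g0 : g != [::] by rewrite -size_eq0 sg; lia.
have E := N_nocol_split c0 (perm_refl (g :: H)) g0.
have := N_nocol_gt0 R q_gt1 k_gt1 D_gt0 big c0 gH'.
rewrite /Y dom_pin0 // sg -(ltr0n R) => N0.
have qk : q%:R = kap R q k * (q ^ k)%:R.
  have -> : (q ^ k = q * q ^ k.-1)%N by rewrite -expnS prednK // ltnW.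
  rewrite natrM mulrCA mulVf ?mulr1 // pnatr_eq0 -lt0n expn_gt0; apply/orP; left; lia.
have -> : (N (nocol n q) (g :: H))%:R =
   (N (nocol n q) H)%:R - q%:R * (N (pin (nocol n q) g c0) H)%:R :> R.
  by rewrite -E natrD natrM addrK.
rewrite qk natrM; move: N0; move: (kap R q k) (N _ _)%:R (N _ _)%:R (q ^ k)%:R => a b c d N0.
by field; rewrite gt_eqF.
Qed.

Lemma top_est_accurate f es z th : good k D es -> top_est k c0 f es z ->
  th = (1 - kap rat q k) ^+ f ->
  0 <= (N (nocol n q) es)%:R / (q ^ n)%:R :> rat /\
  (1 - th) ^+ size es * ((N (nocol n q) es)%:R / (q ^ n)%:R) <= z
    <= (1 + th) ^+ size es * ((N (nocol n q) es)%:R / (q ^ n)%:R).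
Proof.
move=> gH hz eth.
have k0 : 0 < kap rat q k := kap_gt0 rat k q_gt1.
have k16 : 16 * kap rat q k <= 1.
  by apply: (kap_le rat q_gt1 big (m := 16)); move: k_gt1 D_gt0; clear; nia.
have t01 : 0 <= th <= 1.
  by rewrite eth; apply: contraction_range.
have th1 : 0 <= 1 - th by rewrite subr_ge0; case/andP: t01.
elim: es z gH hz => [|g es IH] z gH /=.
  have q0 : (q ^ n)%:R != 0 :> rat by rewrite pnatr_eq0 -lt0n expn_gt0 (ltnW q_gt1).
  by move=> ->; rewrite N_nocol_nil divff.
case=> y [z' [ey hz' ->]].
have gH' := good_cons gH; have [ug sg] := good_edge gH (mem_head _ _).
have [T0 /andP[h1 h2]] := IH z' gH' hz'.
have [y0 ey'] := est_error q_gt2 k_gt1 D_gt0 big ey gH'; rewrite -eth in ey'.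
have F2 := Phi_edge rat q_gt2 k_gt1 D_gt0 big c0 gH' sg.
have Y2 := le_trans (Y_le_Phi rat q_gt2 k_gt1 D_gt0 big c0 _ gH') F2.
have th0 : 0 <= th by case/andP: t01.
have e2 := le_trans ey' (ler_wpM2l th0 F2).
have Y02 : 0 <= Y rat (pin (nocol n q) g c0) es <= 2 by rewrite Y_ge0 Y2.
have [t0 /andP[h3 h4]] := factor_accuracy k0 k16 t01 Y02 e2.
rewrite N_nocol_cons //.
move: t0 h1 h2 h3 h4 T0; rewrite [_ * (1 - _) / _]mulrAC.
move: (1 - kap rat q k * Y rat _ _) (Num.max 0 _) (_ / _) => t x T t0 h1 h2 h3 h4 T0.
have x0 : 0 <= x by apply: le_trans h3; rewrite mulr_ge0 ?(ltW t0).
have z0 : 0 <= z'.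
  by apply: le_trans h1; rewrite mulr_ge0 ?exprn_ge0.
split; first by rewrite mulr_ge0 // ltW.
rewrite !exprS; apply/andP; split.
  have -> : (1 - th) * (1 - th) ^+ size es * (T * t) =
    ((1 - th) * t) * ((1 - th) ^+ size es * T) by ring.
  apply: ler_pM => //; first by rewrite mulr_ge0 ?(ltW t0).
  by rewrite mulr_ge0 ?exprn_ge0.
have -> : (1 + th) * (1 + th) ^+ size es * (T * t) =
    ((1 + th) * t) * ((1 + th) ^+ size es * T) by ring.
by apply: ler_pM.
Qed.

End Accuracy.

(** * The fuel and the initial state *)

Definition count_step u := tadd (Node (tleft u) (Node tt Leaf)).
Definition tcount t := tfold count_step Leaf t Leaf.

Lemma count_foldE v l p : tfold count_step (enc_nat v) l p = enc_nat (v + tlen l).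
Proof.
elim: l v => [|x _ l IH] v /=; first by rewrite addn0.
by rewrite /count_step [tleft _]/= taddE bval_enc IH; congr enc_nat; rewrite /=; lia.
Qed.

Lemma tcountE t : tcount t = enc_nat (tlen t).
Proof. by rewrite /tcount -enc_nat0 count_foldE. Qed.

Lemma pt_count : polytime tcount.
Proof.
apply: (pt_fold (b := fun n => 8 * n + 20 + n)); rewrite /count_step; try by pt_tac.
  by polyb_tac.
move=> [|x l] acc p; first by rewrite /=; lia.
rewrite /= -/(count_step (Node acc (Node x p))) /count_step [tleft _]/= taddE count_foldE.
have h : bval acc + bval (Node tt Leaf) + tlen l < 2 ^ (tlen acc + tlen l + 1).
  have h1 := bval_lt acc; have h2 := ltn_expl (tlen l) (isT : 1 < 2).
  rewrite !expnD /=; move: (2 ^ tlen acc) (2 ^ tlen l) h1 h2 => u v h1 h2.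
  by nia.
have := size_enc_nat h; have := tlen_size acc; have := tlen_size l; lia.
Qed.
#[local] Hint Resolve pt_count : pt.

Definition drop_step u := tright (tleft u).
(** Applied to the encoded numerator and denominator of [eps], it leaves a list of length about
    [log2 (1 / eps)]. *)
Definition tdrop u := tfold drop_step (tright u) (tleft u) Leaf.

Lemma tlen_tdrop a b : tlen (tdrop (Node a b)) = tlen b - tlen a.
Proof.
rewrite /tdrop /=; elim: a b => [|x _ a IH] b /=; first by rewrite subn0.
by rewrite /drop_step /= IH; case: b => //=; rewrite subSS.
Qed.

Lemma pt_drop : polytime tdrop.
Proof.
apply: (pt_fold_grow (c := 0) (d := 0)); rewrite /drop_step; try by pt_tac.
by move=> acc x p /=; have := size_right acc; lia.
Qed.
#[local] Hint Resolve pt_drop : pt.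

Section Init.
Variables q K : nat.

Definition push_step u := iter K (Node Leaf) (tleft u).

Lemma size_iter_leaf j t : tree_size (iter j (Node Leaf) t) = tree_size t + 2 * j.
Proof. by elim: j => [|j IH] /=; lia. Qed.

Lemma tlen_iter_leaf j t : tlen (iter j (Node Leaf) t) = tlen t + j.
Proof. by elim: j => [|j IH] /=; lia. Qed.

Lemma push_foldE acc l p :
  tlen (tfold push_step acc l p) = tlen acc + K * tlen l /\
  tree_size (tfold push_step acc l p) = tree_size acc + 2 * (K * tlen l).
Proof.
elim: l acc => [|x _ l IH] acc /=; first by lia.
have [-> ->] := IH (push_step (Node acc (Node x p))).
by rewrite /push_step /= size_iter_leaf tlen_iter_leaf; split; lia.
Qed.

Lemma pt_push A L : polytime A -> polytime L ->
  polytime (fun t => tfold push_step (A t) (L t) Leaf).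
Proof.
move=> hA hL; apply: (pt_fold_grow (c := 2 * K) (d := 0)) => //; last exact: pt_cst.
  rewrite /push_step; apply: (pt_comp (G := iter K (Node Leaf))); last exact: pt_left.
  by apply: pt_iter; pt_tac.
by move=> acc x p; rewrite /push_step /= size_iter_leaf expn0; lia.
Qed.

Definition pow_step u := tmul (Node (tleft u) (enc_nat q)).
Definition tpow t := tfold pow_step (enc_nat 1) t Leaf.

Lemma pow_foldE v l p : tfold pow_step (enc_nat v) l p = enc_nat (v * q ^ tlen l).
Proof.
elim: l v => [|x _ l IH] v /=; first by rewrite muln1.
by rewrite /pow_step [tleft _]/= tmulE !bval_enc IH expnS mulnA.
Qed.

Lemma tpowE t : tpow t = enc_nat (q ^ tlen t).
Proof. by rewrite /tpow pow_foldE mul1n. Qed.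

Lemma pow_lt_exp2 m : q ^ m < 2 ^ (q * m).+1.
Proof.
apply: leq_ltn_trans (_ : 2 ^ (q * m) < _); last by rewrite ltn_exp2l.
rewrite expnM; case: m => [|m] //; rewrite leq_exp2r //.
by apply/ltnW/ltn_expl.
Qed.

Lemma pt_pow : polytime tpow.
Proof.
apply: (pt_fold (b := fun n => 4 * ((q + 1) * n) + 20 + n)); rewrite /pow_step; try by pt_tac.
  by polyb_tac.
move=> [|x l] acc p; first by rewrite /=; lia.
rewrite /= -/(pow_step (Node acc (Node x p))) /pow_step [tleft _]/= tmulE bval_enc pow_foldE.
have h : bval acc * q * q ^ tlen l < 2 ^ (tlen acc + (q * (tlen l).+1).+1).
  rewrite -mulnA -expnS expnD; apply: ltn_mul (pow_lt_exp2 _); exact: bval_lt.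
have := size_enc_nat h; have := tlen_size acc; have := tlen_size l.
move: (tlen l) (tlen acc) (tree_size (enc_nat _)) => u v w h1 h2 h3.
have : q * u.+1 <= q * tree_size l by rewrite leq_mul2l h1 orbT.
have : q * tree_size l <= q * ((tree_size x + tree_size l).+1 + tree_size acc + tree_size p).
  by rewrite leq_mul2l; apply/orP; right; lia.
rewrite mulnDl; move: (q * _) (q * _) (q * _) h3 => *; lia.
Qed.
#[local] Hint Resolve pt_pow : pt.

(** By [half_pow], [K] levels halve the error. The required bits are those of [1 / eps], those of
    the number of edges, and 2 more: one for the rounding of [1 / eps] to a power of two and one for
    the margin [eps / 2]. *)
Definition fuel t := tfold push_step
  (tfold push_step (iter (K * 2) (Node Leaf) Leaf) (tdrop (tright t)) Leaf)
  (tcount (tright (tleft t))) Leaf.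

Definition init t :=
  Node (Node (i_top (fuel t) (tright (tleft t))) Leaf)
       (Node (Node (tpow (tleft (tleft t))) (enc_nat 1)) Leaf).

Lemma pt_fuel : polytime fuel.
Proof. by apply: pt_push; [apply: pt_push|]; pt_tac. Qed.
#[local] Hint Resolve pt_fuel : pt.

Lemma pt_init : polytime init.
Proof. by rewrite /init /i_top; pt_tac. Qed.

Lemma fuelE vs es a b :
  let F := K * (2 + (tlen b - tlen a) + tlen (enc_nat (tlen es))) in
  tlen (fuel (Node (Node vs es) (Node a b))) = F /\
  tree_size (fuel (Node (Node vs es) (Node a b))) = 2 * F + 1.
Proof.
rewrite /fuel /= tcountE.
have [-> ->] := push_foldE (tfold push_step (iter (K * 2) (Node Leaf) Leaf)
  (tdrop (Node a b)) Leaf) (enc_nat (tlen es)) Leaf.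
have [-> ->] := push_foldE (iter (K * 2) (Node Leaf) Leaf) (tdrop (Node a b)) Leaf.
rewrite tlen_tdrop size_iter_leaf tlen_iter_leaf /=.
by rewrite !mulnDr; split; lia.
Qed.

End Init.

Lemma eps_frac (eps : rat) : (0 < eps < 1)%R ->
  let a := `|numq eps|%N in let b := `|denq eps|%N in
  [/\ 0 < a, a < b & eps = (a%:R / b%:R)%R].
Proof.
move=> /andP[e0 e1] a b.
have da : (a%:Z = numq eps)%R by rewrite /a gez0_abs // ltW // numq_gt0.
have db : (b%:Z = denq eps)%R by rewrite /b gez0_abs // ltW // denq_gt0.
have ee : eps = (a%:R / b%:R)%R.
  by rewrite -[LHS]divq_num_den -da -db.
have b0 : 0 < b by rewrite -ltz_nat db denq_gt0.
split => //; first by rewrite -ltz_nat da numq_gt0.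
by move: e1; rewrite ee ltr_pdivrMr ?ltr0n // mul1r ltr_nat.
Qed.

(** The first bound limits the running time in terms of [1 / eps], the second guarantees the
    accuracy. *)
Lemma eps_digits a b : 0 < a -> a < b ->
  2 ^ (tlen (enc_nat b) - tlen (enc_nat a)) * a <= 2 * b /\
  b <= 2 * 2 ^ (tlen (enc_nat b) - tlen (enc_nat a)) * a.
Proof.
move=> a0 ab; rewrite !tlen_enc_nat.
have b0 : 0 < b by lia.
have ha := up_logP a.+1 (isT : 1 < 2); have hb := up_logP b.+1 (isT : 1 < 2).
have ha' := up_log_gtn (isT : 1 < 2) (a0 : 1 < a.+1).
have hb' := up_log_gtn (isT : 1 < 2) (b0 : 1 < b.+1).
have la : 0 < up_log 2 a.+1 by rewrite up_log_gt0.
have lb : 0 < up_log 2 b.+1 by rewrite up_log_gt0.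
have lab : up_log 2 a.+1 <= up_log 2 b.+1 by apply: leq_up_log; lia.
move: (up_log 2 a.+1) (up_log 2 b.+1) la lb lab ha hb ha' hb' => u v la lb lab ha hb ha' hb'.
have eu : 2 ^ u = 2 * 2 ^ u.-1 by rewrite -expnS prednK.
have ev : 2 ^ v = 2 * 2 ^ v.-1 by rewrite -expnS prednK.
have e : 2 ^ v = 2 ^ (v - u) * 2 ^ u by rewrite -expnD subnK.
split.
  apply: leq_trans (_ : 2 ^ (v - u) * 2 ^ u <= _).
    by rewrite leq_mul2l; apply/orP; right; lia.
  by rewrite -e ev; lia.
apply: leq_trans (_ : 2 ^ v <= _); first by lia.
rewrite e eu -mulnA mulnCA leq_mul2l /= leq_mul2l; apply/orP; right; lia.
Qed.

(** * From hypergraphs to lists of edges *)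

Section Hypergraphs.
Variables (H : hypergraph) (es : seq (seq 'I_(nvertices H))).
Hypotheses (ues : all uniq es)
  (pes : perm_eq [seq [set v in e] | e <- es] (enum (edges H))).

Lemma num_coloursE q : num_colourings q H = N (nocol (nvertices H) q) es.
Proof.
apply: eq_card => s; rewrite !inE agrees_nocol /= /proper_colouring /proper.
have mE e : monochromatic s [set v in e] = mono s e.
  apply/existsP/existsP => -[c h]; exists c.
    by apply/allP => v ve; have /forallP/(_ v) := h; rewrite inE ve.
  by apply/forallP => v; rewrite inE; apply/implyP => /(allP h).
apply/forallP/allP => [h e ees|h e].
  rewrite -mE; have := h [set v in e]; move/implyP; apply.
  by rewrite -mem_enum -(perm_mem pes); apply/mapP; exists e.
by apply/implyP; rewrite -mem_enum -(perm_mem pes) => /mapP[e' /h e'es ->]; rewrite mE.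
Qed.

Lemma good_edges k D : k_uniform k H -> max_degree H = D -> good k D es.
Proof.
move=> ku mD; apply/andP; split.
  apply/allP => e ees; rewrite (allP ues) //=.
  have eE : [set v in e] \in edges H.
    by rewrite -mem_enum -(perm_mem pes); apply/mapP; exists e.
  by rewrite -(ku _ eE) cardsE (card_uniqP (allP ues e ees)).
apply/forallP => v; rewrite -mD /max_degree.
apply: leq_trans (leq_bigmax (F := fun v => degree (H := H) v) v).
have -> : count (fun g => v \in g) es =
  count (fun E : {set _} => v \in E) [seq [set v in e] | e <- es].
  by rewrite count_map; apply: eq_count => e /=; rewrite inE.
rewrite (seq.permP pes) -size_filter /degree cardE.
apply/eq_leq/perm_size/uniq_perm => [||e].
- exact/filter_uniq/enum_uniq.
- exact: enum_uniq.
by rewrite mem_filter !mem_enum !inE andbC.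
Qed.

End Hypergraphs.

(** Bernoulli gives [(1 + 1 / K) ^ K >= 2], and [(1 - 1 / K) * (1 + 1 / K) <= 1]. *)
Lemma half_pow (R : realFieldType) (K : nat) : 0 < K ->
  ((1 - K%:R^-1) ^+ K <= 2^-1 :> R)%R.
Proof.
move=> K0; have KR : (0 < K%:R :> R)%R by rewrite ltr0n.
have k1 : (0 <= (K%:R^-1 : R) <= 1)%R.
  by rewrite invr_ge0 ltW //= invf_le1 // ler1n.
have /andP[k0 k2] := k1.
have h2 : (2 <= (1 + K%:R^-1) ^+ K :> R)%R.
  have := expr1D_ge K k0; rewrite mulfV ?gt_eqF //; lra.
have p0 : (0 <= (1 - K%:R^-1) ^+ K :> R)%R by rewrite exprn_ge0 // subr_ge0.
rewrite -[leRHS]div1r ler_pdivlMr //; apply: le_trans (ler_wpM2l p0 h2) _.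
rewrite -exprMn exprn_ile1 //.
  by apply: mulr_ge0; lra.
have := mulr_ge0 k0 k0; lra.
Qed.

Lemma accuracy_bound (R : realFieldType) (eps th z T : R) m :
  (0 < eps < 1 -> 0 <= th <= 1 -> m%:R * th <= eps / 2 -> 0 <= T ->
   (1 - th) ^+ m * T <= z <= (1 + th) ^+ m * T ->
   (1 - eps) * T <= z <= (1 + eps) * T)%R.
Proof.
move=> /andP[e0 e1] t01 hm T0 /andP[h1 h2]; have /andP[t0 t1] := t01.
have l1 := expr1B_ge m t01.
have l2 : ((1 + th) ^+ m <= 1 + 2 * (m%:R * th))%R by apply: expr1D_le => //; lra.
have h3 := ler_wpM2r T0 l1; have h4 := ler_wpM2r T0 l2.
have h5 := ler_wpM2r T0 hm.
apply/andP; split.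
  apply: le_trans h1; apply: le_trans h3; rewrite ler_wpM2r //; lra.
by apply: le_trans h2 (le_trans h4 _); rewrite ler_wpM2r //; lra.
Qed.

Definition fin t := tleft (tright t).

Lemma pt_fin : polytime fin.
Proof. by rewrite /fin; pt_tac. Qed.

(** * Polynomial bounds on fuel, digits, memory and time *)

Section Bounds.
Variables q k : nat.
Let K := q ^ k.-1.
Let A := q + 4 + (2 * K + 2 * q + 4).

Lemma ebound_le f : ebound q k f <= A ^ f.
Proof.
have A0 f' : 0 < A ^ f' by rewrite expn_gt0 /A; lia.
elim: f => // f IH; rewrite expnS {1}/A mulnDl; apply: leq_add; first exact: leq_mul.
by rewrite -[X in X <= _]muln1 leq_mul.
Qed.

Lemma nsteps_le f : nsteps q f <= A ^ f.
Proof.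
have A0 f' : 0 < A ^ f' by rewrite expn_gt0 /A; lia.
elim: f => // f IH; rewrite expnS {1}/A mulnDl; apply: leq_add; first exact: leq_mul.
by rewrite -[X in X <= _]muln1 leq_mul //; lia.
Qed.

Definition bF x := x ^ K.
Definition bA x := x ^ (K * A).
Definition bM x := q * x + 1 + x * (bA x + K + 1).
Definition bX x := 1 + (bF x).+1 * (x * (4 * q + 4)).
Definition bR x := (bF x).+1 * ((q + 6) * ((2 * bF x + 1) + bX x + x + 20 + 8 * bA x + 20)).
Definition bB x := bR x + (2 * bF x + 1) + x + 16 * bM x + 100.
Definition bN x := x * (bA x + 2) + 1.
Definition bT ci di cs ds cf df x :=
  ci * x.+1 ^ di + (bN x * (cs * (bB x).+1 ^ ds).+1 + 1) + cf * (bB x).+1 ^ df + 2.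

Lemma polyb_bT ci di cs ds cf df : polyb (bT ci di cs ds cf df).
Proof. by rewrite /bT /bN /bB /bR /bX /bM /bA /bF; polyb_tac. Qed.

Lemma room_le F s x : s <= x -> F <= bF x -> A ^ F <= bA x ->
  room q (2 * F + 1) s (1 + F.+1 * (s * (4 * q + 4))) (ebound q k F) F + (2 * F + 1) + s
  + 16 * (q * s + 1 + s * (ebound q k F + K + 1)) + 100 <= bB x.
Proof.
move=> sx hF hA; have he := leq_trans (ebound_le F) hA.
have hX : 1 + F.+1 * (s * (4 * q + 4)) <= bX x by rewrite /bX leq_add // !leq_mul.
have h1 : 2 * F + 1 <= 2 * bF x + 1 by rewrite leq_add // leq_mul.
rewrite /bB /bR /bM /room; apply: leq_add => //; apply: leq_add; last first.
  by rewrite leq_mul // leq_add ?leq_add ?leq_mul // !leq_add.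
apply: leq_add => //; apply: leq_add => //; apply: leq_mul; first by rewrite ltnS.
by rewrite leq_mul // leq_add // leq_add ?leq_mul // leq_add // leq_add // leq_add.
Qed.

(** The fuel is [K] times a logarithm, so [2 ^ F <= x ^ K]; then [A <= 2 ^ A] gives
    [A ^ F <= (2 ^ F) ^ A], a fixed power of [x]. *)
Lemma bits_pow d m s (x := 8 * 2 ^ d * s.+1) : m <= s ->
  let F := K * (2 + d + tlen (enc_nat m)) in F <= bF x /\ A ^ F <= bA x.
Proof.
move=> ms F.
have h : 2 ^ (2 + d + tlen (enc_nat m)) <= x.
  rewrite !expnD tlen_enc_nat /x; have [->|m0] := posnP m.
    by rewrite up_log1 /=; move: (2 ^ d) => u; nia.
  have hb := up_log_gtn (isT : 1 < 2) (m0 : 1 < m.+1).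
  have lb : 0 < up_log 2 m.+1 by rewrite up_log_gt0.
  have -> : 2 ^ up_log 2 m.+1 = 2 * 2 ^ (up_log 2 m.+1).-1 by rewrite -expnS prednK.
  have -> : 2 ^ 2 = 4 by [].
  rewrite mulnA [4 * _ * 2]mulnAC leq_mul //; lia.
have h2 : 2 ^ F <= x ^ K by rewrite /F mulnC expnM; case: (K) => // K'; rewrite leq_exp2r.
split; first by apply: leq_trans (ltnW (ltn_expl F (isT : 1 < 2))) h2.
apply: leq_trans (_ : (2 ^ A) ^ F <= _).
  case: (F) => // F'; rewrite leq_exp2r //; exact/ltnW/ltn_expl.
rewrite -expnM mulnC expnM /bA expnM leq_exp2r // /A; lia.
Qed.

End Bounds.

Lemma exec_pipeline p1 p2 p3 t t1 t2 t3 m1 m2 m3 :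
  run p1 t t1 m1 -> run p2 t1 t2 m2 -> run p3 t2 t3 m3 ->
  exists2 m, computes_in (CSeq (p1 0) (CSeq (p2 0) (p3 0))) t t3 m & m <= m1 + m2 + m3 + 2.
Proof.
move=> h1 h2 h3.
have [s1 [k1 [e1 r1 l1 _]]] := h1 0 (upd (fun=> Leaf) 0 t) erefl.
have [s2 [k2 [e2 r2 l2 _]]] := h2 0 s1 r1.
have [s3 [k3 [e3 r3 l3 _]]] := h3 0 s2 r2.
exists (k1 + (k2 + k3).+1).+1; last by lia.
by exists s3 => //; apply: ExecSeq e1 (ExecSeq e2 e3).
Qed.

(** Bounds a multiple of [s / e] by the square of [s + 1 / e], the quantity in which [has_FPTAS]
    measures time. *)
Lemma time_bound (R : realFieldType) (e : R) (w s : nat) :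
  (0 < e < 1 -> w%:R * e <= 2 -> (0 < s)%N ->
   (8 * w * s.+1).+1%:R <= 40 * (s%:R + e^-1) ^+ 2)%R.
Proof.
move=> /andP[e0 e1] hw s0.
have i1 : (1 <= e^-1)%R by rewrite invf_ge1 // ltW.
have hw' : (w%:R <= 2 * e^-1)%R by rewrite ler_pdivlMr.
have s1 : (1 <= s%:R :> R)%R by rewrite ler1n.
rewrite -[(8 * w * s.+1).+1]addn1 natrD !natrM -[s.+1]addn1 natrD.
move: (w%:R : R)%R (s%:R : R)%R (e^-1)%R i1 hw' s1 => x y i i1 hx y1.
have h : (x * (y + 1) <= 2 * i * (y + 1))%R by rewrite ler_wpM2r //; lra.
have p1 : (0 <= i * (y - 1))%R by apply: mulr_ge0; lra.
have p2 : (0 <= y * y)%R by apply: mulr_ge0; lra.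
have p3 : (0 <= i * (i - 1))%R by apply: mulr_ge0; lra.
rewrite expr2; lra.
Qed.

Lemma fuel_accuracy (R : realFieldType) (eps th : R) d b m :
  (0 < eps < 1 -> 0 <= th -> th <= 2^-1 ^+ (2 + d + b) -> (m <= 2 ^ b)%N ->
   (2 * 2 ^ d)%:R^-1 <= eps -> m%:R * th <= eps / 2)%R.
Proof.
move=> /andP[e0 _] th0 hth hm he.
have x0 : (0 < (2 ^ d)%:R :> R)%R by rewrite ltr0n expn_gt0.
have y0 : (0 < (2 ^ b)%:R :> R)%R by rewrite ltr0n expn_gt0.
have hm' : (m%:R <= (2 ^ b)%:R :> R)%R by rewrite ler_nat.
have {}hth : (th <= (4 * (2 ^ d)%:R * (2 ^ b)%:R)^-1)%R.
  apply: le_trans hth _; rewrite exprVn !exprD -!natrX.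
  by have -> : ((2 ^ 2)%:R = 4 :> R)%R by [].
apply: le_trans (ler_pM (ler0n _ _) th0 hm' hth) _.
move: he; rewrite natrM; move: ((2 ^ d)%:R)%R ((2 ^ b)%:R)%R x0 y0 => x y x0 y0 he.
have -> : (y * (4 * x * y)^-1 = (2 * x)^-1 / 2)%R.
  by field; rewrite !gt_eqF.
by rewrite ler_wpM2r // invr_ge0.
Qed.

(** * Assembly of the approximation scheme *)

Section FPTAS.
Variables q k D : nat.
Hypotheses (q_gt2 : 2 < q) (k_gt1 : 1 < k) (D_gt0 : 0 < D).
Hypothesis big : 320 * k * D ^ 2 <= q ^ k.-1.
Let K := q ^ k.-1.
Let q_gt0 : 0 < q := ltnW (ltnW q_gt2).
Let c0 : 'I_q := Ordinal q_gt0.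

Lemma approximation (H : hypergraph) es (eps : rat) :
  all uniq es -> perm_eq [seq [set v in e] | e <- es] (enum (edges H)) ->
  k_uniform k H -> max_degree H = D -> (0 < eps < 1)%R ->
  let d := tlen (enc_nat `|denq eps|) - tlen (enc_nat `|numq eps|) in
  let F := K * (2 + d + tlen (enc_nat (size es))) in
  forall z, top_est k c0 F es z ->
  ((1 - eps) * (num_colourings q H)%:R <= (q ^ nvertices H)%:R * z
     <= (1 + eps) * (num_colourings q H)%:R)%R.
Proof.
move=> ues pes ku mD eps01 d F z hz.
have ges := good_edges ues pes ku mD.
have [a0 ab eE] := eps_frac eps01.
have [_ hd] := eps_digits a0 ab; rewrite -/d in hd.
have K0 : 0 < K by rewrite expn_gt0 q_gt0.
pose th : rat := ((1 - kap rat q k) ^+ F)%R.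
have [T0 hT] := top_est_accurate q_gt2 k_gt1 D_gt0 big ges hz (erefl th).
have k0 : (0 < kap rat q k)%R := kap_gt0 rat k (ltnW q_gt2).
have k16 : (16 * kap rat q k <= 1)%R.
  by apply: (kap_le rat (ltnW q_gt2) big (m := 16)); move: k_gt1 D_gt0; clear; nia.
have t01 : (0 <= th <= 1)%R by apply: contraction_range.
have hm : ((size es)%:R * th <= eps / 2)%R.
  have h1 : (th <= (2^-1) ^+ (2 + d + tlen (enc_nat (size es))))%R.
    rewrite /th /F exprM lerXn2r ?nnegrE ?invr_ge0 ?ler0n //; last exact: half_pow.
    by case/andP: (contraction_range K k0 k16).
  have h2 : (size es <= 2 ^ tlen (enc_nat (size es)))%N.
    by rewrite tlen_enc_nat; apply: leq_trans (leqnSn _) (up_logP _ _).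
  apply: fuel_accuracy eps01 (proj1 (andP t01)) h1 h2 _.
  have b0 : (0 < `|denq eps|)%N by apply: leq_trans ab.
  rewrite {1}eE ler_pdivlMr ?ltr0n // mulrC ler_pdivrMr; last by rewrite ltr0n muln_gt0 expn_gt0.
  by rewrite -natrM ler_nat mulnC.
have q0 : (0 < (q ^ nvertices H)%:R :> rat)%R by rewrite ltr0n expn_gt0 q_gt0.
have := accuracy_bound eps01 t01 hm T0 hT; rewrite (num_coloursE pes).
move: (N _ es) => M; rewrite !mulrA !ler_pdivrMr ?ler_pdivlMr // => /andP[h1 h2].
by rewrite [(_ * z)%R]mulrC h1 h2.
Qed.

Theorem colouring_FPTAS : has_FPTAS encodes_hypergraph
  (fun H => k_uniform k H /\ max_degree H = D) (num_colourings q).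
Proof.
have [pi [ci [di hi]]] := polytime_form (pt_init q K).
have [ps [cs [ds hs]]] := polytime_form (pt_step q K).
have [pf [cf [df hf]]] := polytime_form pt_fin.
have [c [d hT]] := polyb_bT q k ci di cs ds cf df.
(* A bound [c * x.+1 ^ d] with [x.+1 <= 40 * (s + 1 / eps) ^ 2] explains the factor [40 ^ d] and the
   exponent [2 * d]. *)
exists (CSeq (pi 0) (CSeq (loop_cmd ps 0) (pf 0))), (c * 40 ^ d), (2 * d).
move=> H code eps [ku mD] [es [ues pes ->]] eps01 input.
set vs := enc_seq _ (enum _) in input *.
rewrite -/(enc_edges es) in input *.
set num := enc_nat `|numq eps|; set den := enc_nat `|denq eps|.
have [fl_len fl_size] := fuelE K vs (enc_edges es) num den.
have tles : tlen (enc_edges es) = size es by elim: (es) => //= e es' ->.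
have tlvs : tlen vs = nvertices H.
  rewrite /vs -[RHS](card_ord (nvertices H)) cardE.
  by elim: (enum _) => //= v l ->.
rewrite tles in fl_len fl_size.
set F := K * _ in fl_len fl_size.
pose s := tree_size input.
have s_es : tree_size (enc_edges es) <= s by rewrite /s /input /=; lia.
have s_m : size es <= s by rewrite -tles; apply: leq_trans (ltnW (tlen_size _)) s_es.
have s_n : nvertices H <= s.
  by rewrite -tlvs; apply: leq_trans (ltnW (tlen_size _)) _; rewrite /s /input /=; lia.
have bn : below (q * s + 1) (q ^ nvertices H, 1).
  rewrite /below /= addn1; apply/andP; split; last first.
    by rewrite expnS; have := expn_gt0 2 (q * s); lia.
  apply: leq_trans (pow_lt_exp2 q _) _.
  by rewrite leq_exp2l // ltnS leq_mul2l s_n orbT.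
pose Mt := q * s + 1 + s * (ebound q k F + K + 1).
have hM : q * s + 1 + size es * (ebound q k F + K + 1) <= Mt.
  by rewrite leq_add2l leq_mul2r s_m orbT.
have [Nn [r [z [hN br hz frr hreach]]]] :=
  top_run q_gt2 (erefl : c0 = 0 :> nat) fl_len s_es bn hM.
have rpos : 0 < r.2 by case/and3P: br.
set B := _ + 100 in hreach.
pose w := tlen den - tlen num.
pose x := 8 * 2 ^ w * s.+1.
have sx : s <= x.
  by rewrite /x; apply: leq_trans (leqnSn s) _; rewrite leq_pmull // muln_gt0 expn_gt0.
have [hF hA] := bits_pow q k w s_m; rewrite -/x -/K -/F in hF hA.
have hB : B <= bB q k x.
  rewrite /B fl_size; exact: room_le.
have [eN lN sN] := hreach.
pose st0 := init q K input.
have est0 : st0 = Node (Node (i_top (fuel K input) (enc_edges es)) Leaf)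
    (Node (encf (q ^ nvertices H, 1)) Leaf).
  by rewrite /st0 /init /= tpowE tlvs.
have r1 : run pi input st0 (ci * s.+1 ^ di) := proj1 (hi input).
have r2 : run (loop_cmd ps) st0 (Node Leaf (Node (encf r) Leaf))
    (Nn * (cs * B.+1 ^ ds).+1 + 1).
  rewrite est0 -[X in run _ _ X]eN; apply: run_loop => //; last by rewrite eN.
  move=> i iN /=; apply: run_le (proj1 (hs _)).
  by apply/leq_poly/sN/ltnW.
have r3 : run pf (Node Leaf (Node (encf r) Leaf)) (encf r) (cf * B.+1 ^ df).
  apply: run_le (proj1 (hf _)); apply: leq_poly.
  by have := sN Nn (leqnn _); rewrite eN.
have [m hm hm'] := exec_pipeline r1 r2 r3.
exists r.1, r.2, m; split => //.
- have mx : m <= c * x.+1 ^ d.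
    apply: leq_trans (hT x); apply: leq_trans hm' _; rewrite /bT.
    rewrite leq_add2r; apply: leq_add; last exact: leq_poly.
    apply: leq_add; first exact: leq_poly.
    rewrite leq_add2r; apply: leq_mul; last by rewrite ltnS; apply: leq_poly.
    apply: leq_trans hN _; rewrite /bN leq_add2r; apply: leq_mul; first exact: leq_trans sx.
    by rewrite leq_add2r; apply: leq_trans (nsteps_le q k F) hA.
  have [a0 ab eE] := eps_frac eps01.
  have [hd _] := eps_digits a0 ab; rewrite -/den -/num -/w in hd.
  have hw : ((2 ^ w)%:R * eps <= 2)%R.
    rewrite eE mulrA ler_pdivrMr; last by rewrite ltr0n; apply: leq_trans ab.
    by rewrite -!natrM ler_nat.
  have s0 : 0 < s by apply: size_gt0.
  apply: le_trans (_ : (c * x.+1 ^ d)%:R <= _)%R; first by rewrite ler_nat.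
  rewrite natrM natrX [X in (_ <= X)%R]mulrC natrM mulrCA ler_wpM2l ?ler0n //.
  rewrite exprM natrX -exprMn lerXn2r ?nnegrE ?ler0n //.
    by rewrite mulr_ge0 ?sqr_ge0.
  by rewrite mulrC; apply: time_bound.
- have -> : (r.1%:R / r.2%:R = (q ^ nvertices H)%:R * z)%R.
    by rewrite -/(fr r) frr /fr /= divr1.
  exact: (approximation ues pes ku mD eps01 hz).
Qed.

End FPTAS.

Local Open Scope ring_scope.

Theorem theorem1p4 (R : realType) (delta : R) (k Delta q : nat)
  (delta_gt0 : 0 < delta)
  (k_ge : 50 * (1 + delta) ^+ 2 / delta ^+ 2 <= k%:R)
  (Delta_ge2 : (2 <= Delta)%N)
  (Delta_le : Delta%:R <= (q%:R / 50) `^ ((k%:R - 3) / (2 + delta))) :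
  has_FPTAS encodes_hypergraph
    (fun H => [/\ k_uniform k H, linear_hypergraph H & max_degree H = Delta])
    (num_colourings q).
Proof.
have [k50 q50 big] := regime_bound delta_gt0 k_ge Delta_ge2 Delta_le.
have q_gt2 : (2 < q)%N by apply: leq_trans q50.
have k_gt1 : (1 < k)%N by apply: leq_trans k50.
have [p [c [d h]]] := colouring_FPTAS q_gt2 k_gt1 (ltnW Delta_ge2) big.
by exists p, c, d => H code eps [ku _ mD]; apply: h.
Qed.
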